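(* Let $\nu>-1/2$ and $0<\delta<\nu+1/2$, and set $p_1=\frac{4(\nu+1)}{2\nu+1-2\delta}$. Then there is $C$ such that for all measurable subsets $E\subset(0,1)$, $$\|\mathcal{B}^\delta\chi_E\|_{L^{p_1,\infty}((0,1),d\mu_\nu)}\le C\|\chi_E\|_{L^{p_1}((0,1),d\mu_\nu)}.$$
   Context: Let $J_\nu$ be the Bessel function of order $\nu$, $0<s_1<s_2<\dots$ its successive positive zeros, $d\mu_\nu(x)=x^{2\nu+1}dx$ on $(0,1)$, $\psi_j(x)=\frac{\sqrt2}{|J_{\nu+1}(s_j)|}x^{-\nu}J_\nu(s_jx)$, $a_j(f)=\int_0^1 f\psi_j\,d\mu_\nu$. For $\delta>0$, $R>0$, $\mathcal{B}_R^\delta(f,x)=\sum_{j\ge1}(1-s_j^2/R^2)_+^\delta a_j(f)\psi_j(x)$ with $(1-s^2)_+=\max\{1-s^2,0\}$, and $\mathcal{B}^\delta f(x)=\sup_{R>0}|\mathcal{B}_R^\delta(f,x)|$. $\chi_E$ is the indicator of $E$. The weak space quasinorm is $\|g\|_{L^{q,\infty}((0,1),d\mu_\nu)}=\sup_{\lambda>0}\lambda\,\mu_\nu(\{|g|>\lambda\})^{1/q}$. *)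

(* Defs.v *)
From mathcomp Require Import all_boot all_order all_algebra.
From mathcomp Require Import all_classical all_reals all_analysis.
Set Implicit Arguments. Unset Strict Implicit. Unset Printing Implicit Defensive.
Import Order.TTheory GRing.Theory Num.Theory.
Import numFieldNormedType.Exports.
Local Open Scope classical_set_scope.
Local Open Scope ring_scope.

Section Defs.
Variable R : realType.

(* The measurable type of Lebesgue-measurable subsets of R (completion of the
   Borel sigma-algebra w.r.t. Lebesgue measure); its carrier is R. *)
Definition LebT : Type :=
  ltac:(let t := type of (@completed_lebesgue_measure R) in
        match t with set ?T -> _ => exact T end).

Definition leb : set LebT -> \bar R := @completed_lebesgue_measure R.

Definition Gamma (s : R) : R :=
  fine (\int[leb]_(t in `]0%R, +oo[%classic) ((t `^ (s - 1)) * expR (- t))%:E)%E.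

Definition besselJ (nu x : R) : R :=
  limn (fun n => \sum_(m < n)
     ((-1) ^+ m / ((m`!)%:R * Gamma (m%:R + nu + 1)))
       * ((x / 2) `^ (2 * m%:R + nu))).

(* s : nat -> R enumerates the successive positive zeros of J_nu:
   s 0 < s 1 < ... (s j is the paper's s_(j+1)), and these are exactly the
   positive zeros. *)
Definition bessel_zeros (nu : R) (s : nat -> R) : Prop :=
  (forall j, 0 < s j) /\ (forall j, s j < s j.+1) /\
  (forall x, 0 < x -> besselJ nu x = 0 <-> exists j, s j = x).

Definition dens (nu x : R) : R := x `^ (2 * nu + 1).

Definition mu_nu (nu : R) (A : set R) : \bar R :=
  (\int[leb]_(x in A `&` `]0%R, 1%R[) (dens nu x)%:E)%E.

Definition psi (nu : R) (s : nat -> R) (j : nat) (x : R) : R :=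
  Num.sqrt 2 / `|besselJ (nu + 1) (s j)| * (x `^ (- nu)) * besselJ nu (s j * x).

Definition coef (nu : R) (s : nat -> R) (f : R -> R) (j : nat) : R :=
  fine (\int[leb]_(x in `]0%R, 1%R[) (f x * psi nu s j x * dens nu x)%:E)%E.

Definition BR (nu delta : R) (s : nat -> R) (Rad : R) (f : R -> R) (x : R) : R :=
  limn (fun n => \sum_(j < n)
    (Num.max (1 - s j ^+ 2 / Rad ^+ 2) 0) `^ delta * coef nu s f j * psi nu s j x).

Definition Bmax (nu delta : R) (s : nat -> R) (f : R -> R) (x : R) : \bar R :=
  ereal_sup [set (`|BR nu delta s Rad f x|)%:E | Rad in [set Rad : R | 0 < Rad]].

Definition weak_norm (nu q : R) (g : R -> \bar R) : \bar R :=
  ereal_sup [set (lam%:E * (mu_nu nu [set x | (lam%:E < `|g x|)%E]) `^ (q^-1))%E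
            | lam in [set lam : R | 0 < lam]].

Definition Lp_norm (nu p : R) (f : R -> R) : \bar R :=
  ((\int[leb]_(x in `]0%R, 1%R[) ((`|f x| `^ p) * dens nu x)%:E) `^ (p^-1))%E.

End Defs.

(* Main.v *)
(* Write al = nu + 1/2, be = al - delta, and e_j for the eigenfunctions psi_j, which
   solve -(W e')' = s_j^2 W e with W = x^(2 nu + 1), so that p1 = (2 al + 1) / be.  The
   argument uses no asymptotic expansion of Bessel functions beyond |e_j(x)| <= C min(s_j, 1/x)^al
   and a lower bound for s_(j+1) - s_j, both obtained from an energy u^2 + u'^2.

   The key estimate bounds the kernel of the Bochner-Riesz mean by
     C R (1 + R|x - y|)^(-1-delta) min(R, 1/x)^al min(R, 1/y)^al.
   The e_j are complete (Picone's identity against e_N), so solutions of the wave equation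
   are limits of sums of cos(t s_j) a_j e_j and propagate with speed at most 1.  Hence, for
   bumps h at x and g at y, sum_j F(s_j / R) a_j(h) a_j(g) vanishes whenever F is band-limited
   to frequencies below R|x - y|.  Convolving the multiplier (1 - u^2)_+^delta with a
   power of sinc at scale b ~ R|x - y| gives such an F with error
   C b^(-delta) (1 + b |1 - |u||)^(-p), and the error is summed over the separated s_j.

   For |x - y| comparable to max(x, y) the kernel times W(y) is at most C x^(-be) y^(be-1),
   and the integral of y^(be-1) over E is at most C mu(E)^(1/p1) by splitting at
   mu(E)^(1/(2 al + 1)).  Near the diagonal the mean is dominated by the Hardy-Littlewood
   maximal function of E, cut off at a fixed fraction of x; the layers x > 2^(-k-1),
   weighted by 2^(-2 al k), reassemble W. *)

(* The exponent p1 is the one for which x^(-be) lies in weak L^p1 but not in L^p1, because be p1 = 2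
   al + 1 is the dimension of the measure near 0; dually, the integral of f(y) y^(be-1) dy is
   controlled only by the Lorentz norm of L^(p1,1). Both losses sit in the off-diagonal part of the
   kernel, hence an indicator on the right and a weak norm on the left. The supremum over R costs
   nothing because every bound is uniform in R: off the diagonal, powers R^delta and R^(-delta)
   cancel. The factor R (1 + R|x - y|)^(-1-delta) arises by counting: the approximation error
   b^(-delta) is concentrated on the s_j within R/b of R, about R/b of them by the spacing of the
   zeros. Finite propagation is a statement about functions with separated supports, so point values
   e_j(x) e_j(y) are reached as limits of pairings with shrinking bumps. Superlevel sets of an
   uncountable supremum are not shown to be measurable; their density is dominated by a measurable
   function. The Lebesgue set E is traded for a Borel subset A with E minus A null, on which the
   maximal inequality is available. *)
Require Import Defs.
From mathcomp Require Import all_boot all_order all_algebra.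
From mathcomp Require Import all_classical all_reals all_analysis.
From mathcomp Require Import measurable_realfun.
From mathcomp Require Import ring lra.
Set Implicit Arguments. Unset Strict Implicit. Unset Printing Implicit Defensive.
Import Order.TTheory GRing.Theory Num.Theory.
Import numFieldNormedType.Exports.
Local Open Scope classical_set_scope.
Local Open Scope ring_scope.

(** * Calculus for continuous functions *)

Section Derive.
Variable R : realType.
Implicit Types (f g : R -> R) (x a b k : R).

(* A plain definition rather than the class [is_derive], so that [apply] leaves
   the derivability premises as goals. *)
Definition isd f x a : Prop := is_derive x (1 : R) f a.

Lemma isd_eq f x a b : isd f x a -> a = b -> isd f x b.
Proof. by move=> fa <-. Qed.

Lemma isdC x k : isd (fun=> k) x 0.
Proof. exact: is_derive_cst. Qed.

Lemma isdI x : isd (fun y => y) x 1.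
Proof. exact: is_derive_id. Qed.

Lemma isdD f g x a b : isd f x a -> isd g x b ->
  isd (fun y => f y + g y) x (a + b).
Proof. by move=> fa gb; exact: is_deriveD. Qed.

Lemma isdN f x a : isd f x a -> isd (fun y => - f y) x (- a).
Proof. by move=> fa; exact: is_deriveN. Qed.

Lemma isdB f g x a b : isd f x a -> isd g x b ->
  isd (fun y => f y - g y) x (a - b).
Proof. by move=> fa gb; exact: is_deriveB. Qed.

Lemma isdM f g x a b : isd f x a -> isd g x b ->
  isd (fun y => f y * g y) x (a * g x + f x * b).
Proof.
move=> fa gb; have H := is_deriveM fa gb; apply: (isd_eq H).
by rewrite /GRing.scale/= addrC [g x * a]mulrC.
Qed.

Lemma isdZ k f x a : isd f x a -> isd (fun y => k * f y) x (k * a).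
Proof. by move=> fa; exact: is_deriveZ. Qed.

Lemma isdX n f x a : isd f x a ->
  isd (fun y => f y ^+ n) x (n%:R * f x ^+ n.-1 * a).
Proof.
move=> fa; case: n => [|n].
  by rewrite 2!mul0r; under eq_fun do rewrite expr0; exact: isdC.
have H := @is_deriveX _ _ f n.+1 x 1 a fa.
have -> : (fun y => f y ^+ n.+1) = f ^+ n.+1 by apply/funext => y; rewrite exprfctE.
by apply: (isd_eq H); rewrite /GRing.scale/= mulr_natl.
Qed.

Lemma isd_comp f g x a b : isd f (g x) a -> isd g x b ->
  isd (fun y => f (g y)) x (a * b).
Proof. by move=> fa gb; exact: is_derive1_comp. Qed.

Lemma isdV f x a : f x != 0 -> isd f x a ->
  isd (fun y => (f y)^-1) x (- a / f x ^+ 2).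
Proof.
move=> fx0 fa; have H := is_deriveV fx0 fa; apply: (isd_eq H).
by rewrite /GRing.scale/= mulrC mulrN mulNr.
Qed.

Lemma isd_sum (I : Type) (r : seq I) (F : I -> R -> R) (dF : I -> R) x :
  (forall i, isd (F i) x (dF i)) ->
  isd (fun y => \sum_(i <- r) F i y) x (\sum_(i <- r) dF i).
Proof.
move=> FdF; elim: r => [|i r ih].
  by rewrite big_nil; under eq_fun do rewrite big_nil; exact: isdC.
by rewrite big_cons; under eq_fun do rewrite big_cons; exact: isdD.
Qed.

Lemma isd_continuous f x a : isd f x a -> {for x, continuous f}.
Proof. by move=> fa; apply/differentiable_continuous; apply/derivable1_diffP; case: fa. Qed.

Lemma isd_cos x : isd (@cos R) x (- sin x).
Proof. exact: is_derive_cos. Qed.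

Lemma isd_sin x : isd (@sin R) x (cos x).
Proof. exact: is_derive_sin. Qed.

Lemma isd_exp x : isd (@expR R) x (expR x).
Proof. exact: is_derive_expR. Qed.

Lemma isd_near f g x a : (\forall y \near x, f y = g y) ->
  isd f x a -> isd g x a.
Proof.
by move=> fg fa; exact: near_eq_is_derive fg fa.
Qed.

Lemma isd_powR p x : 0 < x -> isd (fun y => y `^ p) x (p * x `^ (p - 1)).
Proof.
move=> x0; have xoo : x \in `]0, +oo[ by rewrite in_itv/= x0.
apply: DeriveDef; first exact: derivable_powR.
by rewrite -derive1E powR_derive1.
Qed.

Lemma cont_sum (I : Type) (r : seq I) (F : I -> R -> R) :
  (forall i, continuous (F i)) -> continuous (fun x => \sum_(i <- r) F i x).
Proof.
move=> cF; elim: r => [|i r ih].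
  by under eq_fun do rewrite big_nil; exact: cst_continuous.
by under eq_fun do rewrite big_cons; move=> x; apply: cvgD; [exact: cF|exact: ih].
Qed.

Lemma contC k : continuous (fun _ : R => k).
Proof. exact: cst_continuous. Qed.
Lemma contI : continuous (fun x : R => x).
Proof. by move=> x; exact: cvg_id. Qed.
Lemma contD f g : continuous f -> continuous g -> continuous (fun x => f x + g x).
Proof. by move=> cf cg x; apply: cvgD; [exact: cf|exact: cg]. Qed.
Lemma contN f : continuous f -> continuous (fun x => - f x).
Proof. by move=> cf x; apply: cvgN; exact: cf. Qed.
Lemma contM f g : continuous f -> continuous g -> continuous (fun x => f x * g x).
Proof. by move=> cf cg x; apply: cvgM; [exact: cf|exact: cg]. Qed.
Lemma contX n f : continuous f -> continuous (fun x => f x ^+ n).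
Proof.
move=> cf; elim: n => [|n ih]; first exact: contC.
by under eq_fun do rewrite exprS; exact: contM.
Qed.
Lemma cont_comp f g : continuous f -> continuous g -> continuous (fun x => f (g x)).
Proof. by move=> cf cg x; apply: continuous_comp; [exact: cg|exact: cf]. Qed.
Lemma cont_norm f : continuous f -> continuous (fun x => `|f x|).
Proof. by move=> cf x; apply: cvg_norm; exact: cf. Qed.

Lemma cont_powR p : 0 < p -> continuous (fun x => `|x| `^ p).
Proof.
move=> p0 x; have [->|x0] := eqVneq x 0; last first.
  apply: (@continuous_comp _ _ _ (fun y : R => `|y|) (fun y : R => y `^ p)).
    exact: cvg_norm.
  have nx : 0 < `|x| by rewrite normr_gt0.
  exact: isd_continuous (isd_powR p nx).
apply/cvgrPdist_lt => e e0.
have ep : 0 < e `^ p^-1 by rewrite powR_gt0.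
apply: filterS (@nbhs0_lt R R _ ep) => y ye.
rewrite normr0 powR0 ?gt_eqF// sub0r normrN ger0_norm ?powR_ge0//.
have -> : e = (e `^ p^-1) `^ p by rewrite -powRrM mulVf ?gt_eqF// powRr1// ltW.
by rewrite gt0_ltr_powR// nnegrE ?powR_ge0.
Qed.

End Derive.

Ltac cont_step := match goal with
  | |- continuous (fun _ => ?k) => apply: contC
  | |- continuous (fun x => x) => exact: contI
  | |- continuous (fun x => _ + _) => apply: contD
  | |- continuous (fun x => _ * _) => apply: contM
  | |- continuous ( *%R ?k) => exact: (contM (@contC _ k) (@contI _))
  | |- continuous ( +%R ?k) => exact: (contD (@contC _ k) (@contI _))
  | |- continuous -%R => exact: (contN (@contI _))
  | |- continuous (fun x => - _) => apply: contN
  | |- continuous (fun x => _ ^+ _) => apply: contX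
  | |- continuous (fun x => `|_|) => apply: cont_norm
  | |- continuous (fun x => cos _) => apply: (cont_comp (@continuous_cos _))
  | |- continuous (fun x => sin _) => apply: (cont_comp (@continuous_sin _))
  | |- continuous (fun x => expR _) => apply: (cont_comp (@continuous_expR _))
  | |- continuous (fun x => \sum_(_ <- _) _) => apply: cont_sum => ?
  | |- continuous (fun x => \sum_(_ < _) _) => apply: cont_sum => ?
  end.
Create HintDb cont.
Ltac cont := repeat (first [cont_step | assumption | solve [auto with cont]]).

(** * Integrals of continuous functions over a segment *)

Section Cint.
Variable R : realType.
Local Notation mu := (@lebesgue_measure R).
Implicit Types (f g F : R -> R) (a b c k : R).

Definition cint a b f : R := \int[mu]_(x in `[a, b]) f x.

Lemma continuous_integrable a b f : continuous f ->
  mu.-integrable `[a, b] (EFin \o f).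
Proof.
move=> cf; apply: continuous_compact_integrable; first exact: segment_compact.
exact: continuous_subspaceT.
Qed.
Hint Resolve continuous_integrable : core.

Lemma eq_cint a b f g : (forall x, a <= x <= b -> f x = g x) ->
  cint a b f = cint a b g.
Proof. by move=> fg; apply: eq_Rintegral => x; rewrite inE/= in_itv/=; exact: fg. Qed.

Lemma cintD a b f g : continuous f -> continuous g ->
  cint a b (fun x => f x + g x) = cint a b f + cint a b g.
Proof. by move=> cf cg; rewrite /cint RintegralD//; exact: continuous_integrable. Qed.

Lemma cintZ a b k f : continuous f -> cint a b (fun x => k * f x) = k * cint a b f.
Proof. by move=> cf; rewrite /cint RintegralZl//; exact: continuous_integrable. Qed.

Lemma cintN a b f : continuous f -> cint a b (fun x => - f x) = - cint a b f.
Proof.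
move=> cf; rewrite -mulN1r -cintZ//; apply: eq_cint => x _.
by rewrite mulN1r.
Qed.

Lemma cintB a b f g : continuous f -> continuous g ->
  cint a b (fun x => f x - g x) = cint a b f - cint a b g.
Proof. by move=> cf cg; rewrite /cint RintegralB//; exact: continuous_integrable. Qed.

Lemma cint_sum (I : Type) (r : seq I) a b (F : I -> R -> R) :
  (forall i, continuous (F i)) ->
  cint a b (fun x => \sum_(i <- r) F i x) = \sum_(i <- r) cint a b (F i).
Proof.
move=> cF; elim: r => [|i r ih].
  rewrite big_nil -[RHS](mul0r (cint a b (fun=> 0))) -cintZ; last exact: cst_continuous.
  by apply: eq_cint => x _; rewrite big_nil mul0r.
rewrite big_cons -ih -cintD//.
  by apply: eq_cint => x _; rewrite big_cons.
move=> x; have -> : (fun x => \sum_(i <- r) F i x) = \sum_(i <- r) F i.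
  by apply/funext => y; rewrite fct_sumE.
by apply: (big_ind (fun h : R -> R => h y @[y --> x] --> h x)) => //=;
  [exact: cst_continuous|move=> f g; exact: cvgD|move=> j _; exact: cF].
Qed.

Lemma le_cint a b f g : continuous f -> continuous g ->
  (forall x, a <= x <= b -> f x <= g x) -> cint a b f <= cint a b g.
Proof.
move=> cf cg fg; apply: le_Rintegral => //; do ?exact: continuous_integrable.
Qed.

Lemma cint_ge0 a b f : (forall x, a <= x <= b -> 0 <= f x) -> 0 <= cint a b f.
Proof. by move=> f0; apply: Rintegral_ge0 => x/=; rewrite in_itv/=; exact: f0. Qed.

Lemma cint_cst a b k : a <= b -> cint a b (fun=> k) = k * (b - a).
Proof.
move=> ab; rewrite /cint Rintegral_cst//= lebesgue_measure_itv/= lte_fin.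
by case: ltP => // ba; rewrite (@le_anti _ _ a b) ?ab ?ba// subrr.
Qed.

Lemma cint_norm a b f : continuous f -> `|cint a b f| <= cint a b (fun x => `|f x|).
Proof.
move=> cf; apply: le_normr_Rintegral => //; exact: continuous_integrable.
Qed.

(** The derivative is asked for only inside the interval because the weight [Wt] has in general no
    derivative at 0; continuity of [F] takes care of the endpoints. *)
Lemma cintFTC a b f F : a <= b -> continuous f ->
  (forall x, a <= x <= b -> {for x, continuous F}) ->
  (forall x, a < x < b -> isd F x (f x)) ->
  cint a b f = F b - F a.
Proof.
rewrite le_eqVlt => /predU1P[->|ab] cf cF dF.
  by rewrite subrr /cint set_itv1 Rintegral_set1.
have -> : F b - F a = fine ((F b)%:E - (F a)%:E)%E by [].
rewrite -(@continuous_FTC2 _ f F)//.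
- exact: continuous_subspaceT.
- split.
  + by move=> x; rewrite in_itv/= => /dF[].
  + by apply: cvg_at_right_filter; apply: cF; rewrite lexx ltW.
  + by apply: cvg_at_left_filter; apply: cF; rewrite lexx ltW.
- by move=> x; rewrite in_itv/= => /dF [_ dFx]; rewrite derive1E.
Qed.

Lemma primitive_exists a b f : continuous f ->
  exists F : R -> R, forall x, a <= x <= b -> isd F x (f x).
Proof.
(* Integrating from [a - 1], inside a segment that reaches to [b + 1], keeps [a] and [b] interior,
   so that the derivative there is two-sided. *)
move=> cf; exists (fun x => \int[mu]_(t in `[a - 1, x]) f t) => x /andP[ax xb].
have xb1 : x < b + 1 by lra.
have ax1 : a - 1 < x by lra.
have [dF F'] := continuous_FTC1_closed xb1 (@continuous_integrable (a - 1) (b + 1) f cf) ax1 (cf x).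
by apply: DeriveDef => //; rewrite -derive1E.
Qed.

Lemma cint_primitive a b f F : a <= b -> continuous f ->
  (forall x, a <= x <= b -> isd F x (f x)) ->
  cint a b f = F b - F a.
Proof.
move=> ab cf dF; apply: cintFTC => // x axb; first exact: isd_continuous (dF _ axb).
by apply: dF; case/andP: axb => ? ?; rewrite !ltW.
Qed.

Lemma cint_split a c b f : a <= c <= b -> continuous f ->
  cint a b f = cint a c f + cint c b f.
Proof.
move=> /andP[ac cb] cf; have [F dF] := primitive_exists a b cf.
have ab : a <= b by exact: le_trans cb.
have dF1 x : a <= x <= c -> isd F x (f x).
  by move=> /andP[? ?]; apply: dF; lra.
have dF2 x : c <= x <= b -> isd F x (f x).
  by move=> /andP[? ?]; apply: dF; lra.
rewrite (cint_primitive ab cf dF) (cint_primitive ac cf dF1).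
by rewrite (cint_primitive cb cf dF2); ring.
Qed.

Lemma cint_affine a b k c f : 0 < k -> a <= b -> continuous f ->
  cint a b (fun y => f (c - k * y)) = k^-1 * cint (c - k * b) (c - k * a) f.
Proof.
move=> k0 ab cf; have kab : k * a <= k * b by rewrite ler_pM2l.
have [F dF] := primitive_exists (c - k * b) (c - k * a) cf.
have ckab : c - k * b <= c - k * a by lra.
rewrite (cint_primitive ckab cf dF).
pose G y := - k^-1 * F (c - k * y).
have cfa : continuous (fun y => f (c - k * y)).
  move=> y; apply: (@continuous_comp _ _ _ (fun y => c - k * y) f); last exact: cf.
  by apply: cvgB; [exact: cvg_cst|apply: cvgMr; exact: cvg_id].
have dG x : a <= x <= b -> isd G x (f (c - k * x)).
  move=> /andP[ax xb].
  have dFx : isd F (c - k * x) (f (c - k * x)).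
    by apply: dF; rewrite !lerB// ler_pM2l.
  apply: isd_eq.
    rewrite /G; apply: isdZ; apply: (@isd_comp _ F (fun y => c - k * y) x _ _ dFx).
    by apply: isdB; [exact: isdC|apply: isdZ; exact: isdI].
  by field; rewrite gt_eqF.
by rewrite (cint_primitive ab cfa dG) /G; ring.
Qed.

Lemma cint_cvg0 a b (F : nat -> R -> R) (C : R) :
  (forall n, continuous (F n)) -> (forall n x, a <= x <= b -> `|F n x| <= C) ->
  (forall x, a <= x <= b -> F n x @[n --> \oo] --> (0 : R)) ->
  cint a b (F n) @[n --> \oo] --> (0 : R).
Proof.
move=> cF bF F0.
pose E n (x : measurableTypeR R) := (F n x)%:E.
have [||||_ _] := @dominated_convergence _ _ R mu `[a, b]%classic
   (measurable_itv _) E (fun=> 0%E) (fun=> C%:E) _ (measurable_cst _).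
- by move=> n; case/integrableP : (@continuous_integrable a b _ (cF n)).
- apply: aeW => x /=; rewrite in_itv/= => axb.
  by apply: cvg_EFin; [exact: nearW|exact: F0].
- by apply: (@continuous_integrable a b (cst C)); exact: cst_continuous.
- by apply: aeW => x n /=; rewrite in_itv/= => axb; rewrite lee_fin bF.
rewrite integral0 => /fine_cvg; apply: cvg_trans.
by apply: near_eq_cvg; apply: nearW => n.
Qed.

End Cint.

(** * The Gamma function *)

Section LebBorel.
Variable R : realType.
Local Notation mu := (@lebesgue_measure R).

(** The identity, seen as a map from the completed sigma-algebra to the Borel one; pushing [leb]
    forward along it gives back [lebesgue_measure]. *)
Definition toR (x : LebT R) : measurableTypeR R := x.

Lemma measurable_borel_leb (A : set R) :
  measurable A -> measurable (A : set (LebT R)).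
Proof. exact: sub_caratheodory. Qed.

Lemma measurable_toR : measurable_fun setT toR.
Proof. by move=> _ A mA; rewrite setTI; exact: measurable_borel_leb. Qed.

Lemma ge0_integral_leb (D : set R) (f : R -> \bar R) :
  measurable D -> measurable_fun D f -> (forall x, D x -> (0 <= f x)%E) ->
  (\int[@leb R]_(x in D) f x = \int[mu]_(x in D) f x)%E.
Proof.
move=> mD mf f0.
transitivity (\int[pushforward (@leb R) toR]_(x in D) f x)%E.
  rewrite (@ge0_integral_pushforward _ _ _ _ _ _ measurable_toR)//.
  by move=> x; rewrite inE; exact: f0.
apply: eq_measure_integral; [exact: measurable_toR|by move=> ? A mA AD].
Qed.

End LebBorel.

(** * Functional equation and positivity of the Gamma function *)

Section GammaFacts.
Variable R : realType.
Local Notation mu := (@lebesgue_measure R).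
Implicit Types (a b s t : R).

Lemma integral_cc_FTC (f F : R -> R) a b : a < b ->
  (forall x, a <= x <= b -> {for x, continuous f}) ->
  (forall x, a <= x <= b -> isd F x (f x)) ->
  (\int[mu]_(x in `[a, b]) (f x)%:E = (F b - F a)%:E)%E.
Proof.
move=> ab cf dF; rewrite (@continuous_FTC2 _ f F a b ab) ?EFinB//.
- apply: continuous_in_subspaceT => x; rewrite inE/= in_itv/=; exact: cf.
- split.
  + move=> x; rewrite in_itv/= => /andP[ax xb].
    by have [] : isd F x (f x) by apply: dF; rewrite !ltW.
  + apply: cvg_at_right_filter; apply: isd_continuous (dF a _).
    by rewrite lexx ltW.
  + apply: cvg_at_left_filter; apply: isd_continuous (dF b _).
    by rewrite lexx ltW.
- move=> x; rewrite in_itv/= => /andP[ax xb].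
  have [] : isd F x (f x) by apply: dF; rewrite !ltW.
  by move=> _ dFx; rewrite derive1E.
Qed.

Definition gexp a t : R := t `^ a * expR (- t).

Lemma isd_gexp a t : 0 < t -> isd (gexp a) t (a * gexp (a - 1) t - gexp a t).
Proof.
move=> t0; apply: isd_eq.
  apply: isdM; first exact: isd_powR.
  by apply: (isd_comp (isd_exp _)); apply: isdN; exact: isdI.
by rewrite /gexp; ring.
Qed.

Lemma gexp_cont a t : 0 < t -> {for t, continuous (gexp a)}.
Proof. by move=> t0; exact: isd_continuous (isd_gexp a t0). Qed.

Lemma gexp_ge0 a t : 0 <= gexp a t.
Proof. by rewrite mulr_ge0 ?powR_ge0 ?expR_ge0. Qed.

Lemma measurable_gexp a (D : set R) : measurable D -> 
  measurable_fun D (fun t => (gexp a t)%:E).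
Proof.
move=> mD; apply/measurable_EFinP; apply: measurable_funTS.
apply: measurable_funM; first exact: measurable_powR.
by apply: measurableT_comp => //; exact: measurable_oppr.
Qed.

(** Compact exhaustion of the open half-line, away from the singularity at 0; the [+ 1] keeps [I 0]
    from being a single point. *)
Let I n : set R := `[(n.+1%:R)^-1, n.+1%:R + 1]%classic.
Let G a n := (\int[mu]_(t in I n) (gexp a t)%:E)%E.

Let I0 n t : n.+1%:R^-1 <= t -> 0 < t.
Proof. by apply: lt_le_trans; rewrite invr_gt0. Qed.

Let Ilt n : (n.+1%:R)^-1 < n.+1%:R + 1 :> R.
Proof.
apply: (@le_lt_trans _ _ 1); first by rewrite invf_le1// ler1n.
by rewrite ltrDr.
Qed.

Let IU : \bigcup_n I n = `]0%R, +oo[%classic.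
Proof.
apply/seteqP; split=> [x [n _]|x]/=; rewrite !in_itv/= ?andbT.
  by move=> /andP[/I0].
move=> x0.
pose m := Num.truncn (Num.max x x^-1).
exists m => //; rewrite /I/= in_itv/=.
have h : Num.max x x^-1 < m.+1%:R by exact: truncnS_gt.
move: h; rewrite gt_max => /andP[h1 h2]; apply/andP; split; last by rewrite (le_trans (ltW h1))// lerDl.
by rewrite -[x]invrK lef_pV2 ?posrE ?invr_gt0// ltW.
Qed.

Let G_cvg a : (G a n @[n --> \oo] --> \int[mu]_(t in `]0%R, +oo[) (gexp a t)%:E)%E.
Proof.
rewrite -IU; apply: ge0_nondecreasing_set_cvg_integral => //.
- apply/nondecreasing_seqP => n; apply/subsetPset => x; rewrite /I/= !in_itv/=.
  move=> /andP[nx xn]; apply/andP; split.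
    apply: le_trans nx; rewrite lef_pV2 ?posrE// ler_nat//.
  by apply: le_trans xn _; rewrite lerD2r ler_nat.
- by move=> n; exact: measurable_itv.
- by move=> n; apply: measurable_gexp; exact: measurable_itv.
- by move=> n x _; rewrite lee_fin gexp_ge0.
Qed.

Let mI n : measurable (I n).
Proof. exact: measurable_itv. Qed.
Hint Resolve mI : core.

Let gI a n := \int[mu]_(t in I n) (gexp a t).

Let gexp_within a n : {within I n, continuous (gexp a)}.
Proof.
apply: continuous_in_subspaceT => x; rewrite inE /I/= in_itv/= => /andP[/I0 x0 _].
exact: gexp_cont.
Qed.

Let gexp_int a n : mu.-integrable (I n) (EFin \o gexp a).
Proof. apply: continuous_compact_integrable; [exact: segment_compact|exact: gexp_within]. Qed.

Let GgI a n : G a n = (gI a n)%:E.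
Proof. by rewrite /G /gI /Rintegral fineK//; apply: integrable_fin_num; [exact: measurable_itv|exact: gexp_int]. Qed.

Let gI_rec a n : a * gI (a - 1) n - gI a n =
  gexp a (n.+1%:R + 1) - gexp a n.+1%:R^-1.
Proof.
have iZ : mu.-integrable (I n) (EFin \o (fun t => a * gexp (a - 1) t)).
  apply: continuous_compact_integrable; first exact: segment_compact.
  apply: continuous_in_subspaceT => x; rewrite inE /I/= in_itv/= => /andP[/I0 x0 _].
  by apply: cvgMr; exact: gexp_cont.
rewrite /gI -(@RintegralZl _ _ R mu (I n) _ a (mI n) (gexp_int (a - 1) n)).
rewrite -(@RintegralB _ _ R mu (I n) _ _ (mI n) iZ (gexp_int a n)).
apply: EFin_inj; rewrite -(@integral_cc_FTC (fun t => a * gexp (a - 1) t - gexp a t))//.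
- rewrite /Rintegral fineK//; apply: integrable_fin_num; first exact: measurable_itv.
  apply: continuous_compact_integrable; first exact: segment_compact.
  apply: continuous_in_subspaceT => x; rewrite inE /I/= in_itv/= => /andP[/I0 x0 _].
  by apply: cvgB; [apply: cvgMr; exact: gexp_cont|exact: gexp_cont].
- move=> x /andP[/I0 x0 _].
  by apply: cvgB; [apply: cvgMr; exact: gexp_cont|exact: gexp_cont].
- by move=> x /andP[/I0 x0 _]; exact: isd_gexp.
Qed.

(** Half of the exponential is spent on the power: for t > 1, t^s is at most t^(n+1), which one term
    of the series of exp(t/2) dominates up to the constant 2^(n+1) (n+1)!. *)
Lemma gexp_le_exp s : 0 <= s -> exists2 K, 0 < K & forall t, 0 < t ->
  gexp s t <= K * expR (- (t / 2)).
Proof.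
move=> s0; have [n sn] : exists n : nat, s <= n.+1%:R.
  by exists (Num.truncn s); apply: ltW; exact: truncnS_gt.
exists (2 ^+ n.+1 * n.+1`!%:R); first by rewrite mulr_gt0 ?exprn_gt0 ?ltr0n ?fact_gt0.
move=> t t0; rewrite /gexp.
have -> : - t = - (t / 2) + - (t / 2) by lra.
rewrite expRD mulrA ler_pM2r ?expR_gt0// expRN ler_pdivrMr ?expR_gt0//.
have e1 : 1 <= expR (t / 2) by rewrite -expR0 ler_expR divr_ge0 ?ltW.
have [t1|t1] := leP t 1.
  apply: (@le_trans _ _ 1).
    by have := @ge0_ler_powR _ s s0 t 1; rewrite powR1 !nnegrE ltW//; exact.
  rewrite mulr_ege1// mulr_ege1//; first by rewrite expr_ge1// ler1n.
  by rewrite ler1n fact_gt0.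
apply: (@le_trans _ _ (t ^+ n.+1)).
  by rewrite -powR_mulrn; [apply: ler_powR => //; exact: ltW|exact: ltW].
have -> : t ^+ n.+1 = 2 ^+ n.+1 * (t / 2) ^+ n.+1 by rewrite -exprMn; congr (_ ^+ _); lra.
rewrite -mulrA ler_pM2l ?exprn_gt0// [_ * expR _]mulrC -ler_pdivrMr ?ltr0n ?fact_gt0//.
have t20 : 0 <= t / 2 by rewrite divr_ge0// ltW.
by apply: le_trans (expR_ge1Dxn n t20); rewrite lerDr.
Qed.

Let gI_le s : 0 <= s -> exists K, forall n, gI s n <= K.
Proof.
move=> s0; have [K K0 sK] := gexp_le_exp s0; exists (2 * K) => n.
rewrite -lee_fin -GgI.
pose F t := - (2 * K) * expR (- (t / 2)).
apply: (@le_trans _ _ (\int[mu]_(t in I n) (K * expR (- (t / 2)))%:E)%E).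
  apply: ge0_le_integral => //.
  - exact: mI.
  - by move=> t _; rewrite lee_fin gexp_ge0.
  - by apply: measurable_gexp; exact: measurable_itv.
  - apply/measurable_EFinP; apply: measurable_funTS; apply: continuous_measurable_fun.
    by cont.
  - by move=> t; rewrite /I/= in_itv/= => /andP[/I0 t0 _]; rewrite lee_fin sK.
rewrite (@integral_cc_FTC _ F)//.
- rewrite lee_fin /F.
  have := expR_gt0 (- ((n.+1%:R + 1) / 2) : R).
  have : expR (- (n.+1%:R^-1 / 2)) <= 1 :> R.
    by rewrite expR_le1 oppr_le0 divr_ge0.
  set u := expR _; set v := expR _ => u1 v0.
  rewrite -(ler_pM2l K0) in u1.
  have : 0 < K * v by rewrite mulr_gt0.
  lra.
- have ct : continuous (fun t : R => K * expR (- (t / 2))) by cont.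
  by move=> t _; exact: ct.
- move=> t _; apply: isd_eq.
    rewrite /F; apply: isdZ; apply: (isd_comp (isd_exp _)); apply: isdN.
    by apply: (isdM (isdI _) (isdC _ _)).
  by rewrite /=; field.
Qed.

Let GI a := (\int[mu]_(t in `]0%R, +oo[) (gexp a t)%:E)%E.

(** For s < 1 the integrand t^(s-1) e^(-t) is unbounded at 0. The bound therefore goes through the
    integration by parts [gI_rec]: s times the truncated integral is that of exponent s plus
    boundary terms, all bounded above. *)
Let GI_fin s : 0 < s -> GI (s - 1) \is a fin_num.
Proof.
move=> s0; have [K sK] := gI_le (ltW s0).
have [K' K'0 sK'] := gexp_le_exp (ltW s0).
rewrite ge0_fin_numE; last first.
  by apply: integral_ge0 => t _; rewrite lee_fin gexp_ge0.
apply: (@le_lt_trans _ _ ((K + K') / s)%:E); last exact: ltry.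
have -> : GI (s - 1) = limn (G (s - 1)) by apply/esym/cvg_lim => //; exact: G_cvg.
apply: lime_le; first by apply/cvg_ex; eexists; exact: G_cvg.
apply: nearW => n; rewrite GgI lee_fin ler_pdivlMr//.
have := @gI_rec s n; have := sK n.
have := gexp_ge0 s n.+1%:R^-1.
have : gexp s (n.+1%:R + 1) <= K'.
  apply: le_trans (sK' _ _) _; first by rewrite addr_gt0.
  by rewrite ger_pMr// expR_le1 oppr_le0 divr_ge0.
lra.
Qed.

Let gI_cvg s : 0 < s -> gI (s - 1) n @[n --> \oo] --> fine (GI (s - 1)).
Proof.
move=> s0; apply: fine_cvg; rewrite fineK ?GI_fin//.
exact: (@G_cvg (s - 1)).
Qed.

Let gexp_b0 s : 0 < s -> gexp s (n.+1%:R + 1) @[n --> \oo] --> (0 : R).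
Proof.
move=> s0; have [K K0 sK] := gexp_le_exp (ltW s0).
apply: (@squeeze_cvgr _ _ _ _ (fun=> 0) (fun n => (2 * K) * harmonic n)).
- apply: nearW => n; rewrite gexp_ge0/=.
  have b0 : 0 < n.+1%:R + 1 :> R by exact: addr_gt0.
  apply: le_trans (sK _ b0) _.
  have -> : 2 * K * harmonic n = K * (2 * harmonic n) by ring.
  rewrite ler_pM2l// expRN.
  have h : n.+1%:R / 2 <= expR ((n.+1%:R + 1) / 2) :> R.
    apply: le_trans (expR_ge1Dx _); rewrite mulrDl; lra.
  apply: le_trans (_ : (n.+1%:R / 2)^-1 <= _).
    by rewrite lef_pV2 ?posrE ?expR_gt0// divr_gt0.
  by rewrite invf_div.
- exact: cvg_cst.
- by rewrite -[X in _ --> X](mulr0 (2 * K)); apply: cvgMr; exact: cvg_harmonic.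
Qed.

Let gexp_a0 s : 0 < s -> gexp s n.+1%:R^-1 @[n --> \oo] --> (0 : R).
Proof.
move=> s0; apply: (@squeeze_cvgr _ _ _ _ (fun=> 0) (fun n => `|harmonic n| `^ s)).
- apply: nearW => n; rewrite gexp_ge0/= ger0_norm ?invr_ge0//.
  by rewrite ger_pMr ?powR_gt0 ?invr_gt0// expR_le1 oppr_le0 invr_ge0.
- exact: cvg_cst.
- have h : `|x| `^ s @[x --> (0 : R)] --> `|0 : R| `^ s := @cont_powR R s s0 0.
  rewrite normr0 powR0 ?gt_eqF// in h.
  exact: (cvg_comp _ _ (@cvg_harmonic R) h).
Qed.

Let Gamma_GI s : Gamma s = fine (GI (s - 1)).
Proof.
rewrite /Gamma /GI; congr fine; apply: ge0_integral_leb.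
- exact: measurable_itv.
- by apply: measurable_gexp; exact: measurable_itv.
- by move=> x _; rewrite lee_fin gexp_ge0.
Qed.

Lemma GammaS s : 0 < s -> Gamma (s + 1) = s * Gamma s.
Proof.
move=> s0; rewrite !Gamma_GI.
have s10 : 0 < s + 1 by lra.
have h1 := gI_cvg s10; rewrite addrK in h1.
have h2 : s * gI (s - 1) n @[n --> \oo] --> s * fine (GI (s - 1)).
  by apply: cvgMr; exact: gI_cvg.
have h3 : s * gI (s - 1) n - gI s n @[n --> \oo] -->
    s * fine (GI (s - 1)) - fine (GI s) by exact: cvgB.
have h4 : (s * gI (s - 1) n - gI s n) @[n --> \oo] --> (0 : R).
  have h5 := cvgB (gexp_b0 s0) (gexp_a0 s0); rewrite subr0 in h5.
  suff -> : (fun n => s * gI (s - 1) n - gI s n) =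
            (fun n => gexp s (n.+1%:R + 1) - gexp s n.+1%:R^-1) by exact: h5.
  by apply/funext => n; exact: gI_rec.
have /eqP : s * fine (GI (s - 1)) - fine (GI s) = 0.
  by rewrite -(cvg_lim (@norm_hausdorff _ _) h3) (cvg_lim (@norm_hausdorff _ _) h4).
by rewrite subr_eq0 addrK => /eqP ->.
Qed.

Lemma Gamma_gt0 s : 0 < s -> 0 < Gamma s.
Proof.
move=> s0; rewrite Gamma_GI.
have [c cI cmin] := @EVT_min R (gexp (s - 1)) _ _ (ltW (Ilt 0)) (@gexp_within (s - 1) 0).
have c0 : 0 < gexp (s - 1) c.
  move: cI; rewrite in_itv/= => /andP[/I0 c0 _].
  by rewrite mulr_gt0 ?powR_gt0 ?expR_gt0.
rewrite fine_gt0// -ge0_fin_numE ?GI_fin//; last first.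
  by apply: integral_ge0 => t _; rewrite lee_fin gexp_ge0.
rewrite andbT; apply: (@lt_le_trans _ _ (G (s - 1) 0)); last first.
  rewrite /G /GI; apply: (@ge0_subset_integral _ _ _ mu (I 0) `]0%R, +oo[%classic).
  - exact: mI.
  - exact: measurable_itv.
  - by apply: measurable_gexp; exact: measurable_itv.
  - by move=> t _; rewrite lee_fin gexp_ge0.
  - by rewrite -IU; exact: bigcup_sup.
apply: (@lt_le_trans _ _ (\int[mu]_(t in I 0) (gexp (s - 1) c)%:E)%E).
  rewrite integral_cst//=; last exact: measurable_itv.
  rewrite lebesgue_measure_itv/= lte_fin Ilt -EFinD -EFinM lte_fin.
  by rewrite mulr_gt0// subr_gt0.
apply: ge0_le_integral => //.
- exact: mI.
- by move=> t _; rewrite lee_fin ltW.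
- by apply: measurable_gexp; exact: measurable_itv.
Qed.

End GammaFacts.

(** * Bessel functions *)

Section Monotone.
Variable R : realType.
Implicit Types (F f : R -> R) (a b x y : R).

Lemma isd_MVT F f a b : a < b -> (forall x, a <= x <= b -> isd F x (f x)) ->
  exists2 c, a < c < b & F b - F a = f c * (b - a).
Proof.
move=> ab dF; have [||c cab h] := @MVT R F f a b ab.
- by move=> x; rewrite in_itv/= => /andP[ax xb]; apply: dF; rewrite !ltW.
- apply: continuous_in_subspaceT => x; rewrite inE/= in_itv/= => axb.
  exact: isd_continuous (dF _ axb).
by exists c => //; move: cab; rewrite in_itv.
Qed.

Lemma isd_le F f a b : a <= b -> (forall x, a <= x <= b -> isd F x (f x)) ->
  (forall x, a <= x <= b -> 0 <= f x) -> F a <= F b.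
Proof.
rewrite le_eqVlt => /predU1P[->//|ab] dF f0.
have [c /andP[ac cb] h] := isd_MVT ab dF.
rewrite -subr_ge0 h mulr_ge0 ?subr_ge0 ?(ltW ab)//.
by apply: f0; rewrite !ltW.
Qed.

Lemma isd_ge F f a b : a <= b -> (forall x, a <= x <= b -> isd F x (f x)) ->
  (forall x, a <= x <= b -> f x <= 0) -> F b <= F a.
Proof.
move=> ab dF f0; rewrite -lerN2.
apply: (@isd_le (fun x => - F x) (fun x => - f x)) => // x axb.
  by apply: isdN; exact: dF.
by rewrite oppr_ge0 f0.
Qed.

Lemma isd_powR' p x : 0 < x -> isd (fun y => y `^ p) x (p * x `^ p / x).
Proof.
move=> x0; apply: isd_eq; first exact: isd_powR.
by rewrite powRB ?(gt_eqF x0) ?implybT// (powRr1 (ltW x0)) mulrA.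
Qed.

Lemma continuous_le_bound (f : R -> R) a b : continuous f ->
  exists2 M, 0 < M & forall x, a <= x <= b -> `|f x| <= M.
Proof.
move=> cf; have [ab|ba] := leP a b; last first.
  by exists 1 => // x /andP[ax xb]; move: (le_trans ax xb); rewrite leNgt ba.
have cn : continuous (fun x => `|f x|) by apply: cont_norm.
have [c _ cmax] := EVT_max ab (continuous_subspaceT cn).
exists (`|f c| + 1); first by rewrite ltr_wpDl.
by move=> x axb; apply: (le_trans (cmax x _)); rewrite ?in_itv ?lerDl.
Qed.

Lemma cvgnMk (k : R) (u : nat -> R) (l : R) : u n @[n --> \oo] --> l ->
  k * u n @[n --> \oo] --> k * l.
Proof. by move=> ul; apply: cvgMr. Qed.

Lemma limn_mull (k : R) (u : nat -> R) : cvgn u ->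
  limn (fun n => k * u n) = k * limn u.
Proof. by move=> cu; apply: cvg_lim => //; apply: cvgMr. Qed.

End Monotone.

Local Opaque Gamma.

(** * Power series of the Bessel functions *)

Section BesselSeries.
Variable R : realType.
Implicit Types (nu z x : R) (m n : nat).

(** Taylor coefficients, in the variable z = x^2, of the entire function (x/2)^(-nu) J_nu(x).
    Working in z removes the fractional power, and differentiation becomes the shift from nu to nu +
    1 with factor -1/4. *)
Definition bcoef nu m : R :=
  (-1) ^+ m / (4 ^+ m * m`!%:R * Gamma (m%:R + nu + 1)).

Definition bG nu z : R := limn (pseries (bcoef nu) z).

Let argpos nu m : -1 < nu -> 0 < m%:R + nu + 1.
Proof. by move=> h; have : 0 <= m%:R :> R by []; lra. Qed.

(** From index 1 on, each use of the functional equation multiplies by a factor at least 1, so the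
    smaller of the first two values is a lower bound. *)
Lemma Gamma_lower nu : -1 < nu ->
  exists2 c : R, 0 < c & forall m, c <= Gamma (m%:R + nu + 1).
Proof.
move=> h; have g0 := Gamma_gt0 (argpos 0 h); have g1 := Gamma_gt0 (argpos 1 h).
exists (Num.min (Gamma (0%:R + nu + 1)) (Gamma (1%:R + nu + 1))).
  by rewrite lt_min g0.
elim=> [|[|m] ih]; first by rewrite ge_min lexx.
  by rewrite ge_min lexx orbT.
apply: (le_trans ih).
have -> : m.+2%:R + nu + 1 = (m.+1%:R + nu + 1) + 1 :> R by rewrite -natr1; ring.
have a0 := argpos m.+1 h; rewrite (GammaS a0) ler_peMl ?(ltW (Gamma_gt0 a0))//.
by rewrite -natr1; have : 0 <= m%:R :> R by []; lra.
Qed.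

Lemma cvg_bpseries nu (z : R) : -1 < nu -> cvgn (pseries (bcoef nu) z).
Proof.
move=> h; have [c c0 cm] := Gamma_lower h.
apply: normed_cvg.
apply: (@series_le_cvg _ _ (fun n => c^-1 * exp_coeff `|z| n)).
- by move=> n /=; exact: normr_ge0.
- by move=> n; rewrite /exp_coeff/= mulr_ge0 ?invr_ge0 ?(ltW c0)// divr_ge0 ?exprn_ge0.
- move=> n; rewrite /exp_coeff/= /bcoef.
  have g0 : 0 < Gamma (n%:R + nu + 1) by apply: Gamma_gt0; exact: argpos.
  rewrite !normrM normfV normrX normrN1 expr1n mul1r !normrM normrX !normr_nat.
  rewrite (ger0_norm (ltW g0)) normrX.
  rewrite [leRHS](_ : _ = (c * n`!%:R)^-1 * `|z| ^+ n); last by rewrite invfM; ring.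
  rewrite ler_wpM2r ?exprn_ge0// lef_pV2 ?posrE; last 2 first.
  + by rewrite !mulr_gt0 ?exprn_gt0 ?ltr0n ?fact_gt0.
  + by rewrite mulr_gt0 ?ltr0n ?fact_gt0.
  rewrite mulrC; apply: ler_pM; rewrite ?ler0n ?(ltW c0)//.
  by rewrite ler_peMl// exprn_ege1// ler1n.
- exact: is_cvg_seriesZ (is_cvg_series_exp_coeff _).
Qed.

Arguments cvg_bpseries {nu} z.

Lemma bcoef_diffs nu : -1 < nu ->
  pseries_diffs (bcoef nu) = (fun m => - 4^-1 * bcoef (nu + 1) m).
Proof.
move=> h; apply/funext => m; rewrite /pseries_diffs /bcoef.
have -> : m.+1%:R + nu + 1 = m%:R + (nu + 1) + 1 :> R by rewrite -natr1; ring.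
have g0 : 0 < Gamma (m%:R + (nu + 1) + 1) by apply: Gamma_gt0; apply: argpos; lra.
rewrite factS natrM !exprS; field.
by rewrite expf_neq0 ?gt_eqF ?ltr0n ?fact_gt0//= -(natr1 m).
Qed.

Lemma bcoef_rec nu m : -1 < nu ->
  bcoef nu m = (nu + 1) * bcoef (nu + 1) m + m%:R * bcoef (nu + 1) m.
Proof.
move=> h; rewrite /bcoef.
have a0 := argpos m h; have g0 := Gamma_gt0 a0.
have -> : m%:R + (nu + 1) + 1 = (m%:R + nu + 1) + 1 by ring.
rewrite (GammaS a0); field.
by rewrite !gt_eqF ?exprn_gt0 ?ltr0n ?fact_gt0.
Qed.

Lemma pseriesZ k (c : nat -> R) w n :
  pseries (fun m => k * c m) w n = k * pseries c w n.
Proof.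
by rewrite /pseries /series/= mulr_sumr; apply: eq_bigr => i _; rewrite mulrA.
Qed.

Lemma cvg_pseriesZ k (c : nat -> R) w : cvgn (pseries c w) ->
  cvgn (pseries (fun m => k * c m) w).
Proof.
move=> cc; suff -> : pseries (fun m => k * c m) w = (fun n => k * pseries c w n).
  by apply/cvg_ex; exists (k * limn (pseries c w)); apply: cvgMr.
by apply/funext => n; exact: pseriesZ.
Qed.

Lemma limn_pseriesZ k (c : nat -> R) w : cvgn (pseries c w) ->
  limn (pseries (fun m => k * c m) w) = k * limn (pseries c w).
Proof.
by move=> cc; rewrite -limn_mull//; congr (limn _); apply/funext => n; exact: pseriesZ.
Qed.

Lemma pseries_diffsZ k (c : nat -> R) :
  pseries_diffs (fun m => k * c m) = (fun m => k * pseries_diffs c m).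
Proof. by apply/funext => n; rewrite /pseries_diffs mulrCA. Qed.

Lemma isd_bG nu z : -1 < nu -> isd (bG nu) z (- 4^-1 * bG (nu + 1) z).
Proof.
move=> h; have h1 : -1 < nu + 1 by lra.
have h2 : -1 < nu + 1 + 1 by lra.
have lt1 : `|z| < `| `|z| + 1 | by rewrite [ltRHS]ger0_norm ?ltrDl// addr_ge0.
have := @pseries_snd_diffs R (bcoef nu) (`|z| + 1) z.
rewrite (bcoef_diffs h) pseries_diffsZ (bcoef_diffs h1) => H.
have c1 : cvgn (pseries (fun m => - 4^-1 * bcoef (nu + 1) m) (`|z| + 1)).
  by apply: cvg_pseriesZ; exact: cvg_bpseries.
have c2 : cvgn (pseries (fun m => - 4^-1 * (- 4^-1 * bcoef (nu + 1 + 1) m)) (`|z| + 1)).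
  by do 2 apply: cvg_pseriesZ; exact: cvg_bpseries.
have := H (cvg_bpseries _ h) c1 c2 lt1.
by rewrite (limn_pseriesZ _ (cvg_bpseries _ h1)).
Qed.

(** The three-term recurrence J_nu + J_(nu+2) = (2 (nu + 1) / x) J_(nu+1) in the variable z = x^2.
    With [isd_bG] it replaces Bessel's differential equation throughout. *)
Lemma bG_rec nu z : -1 < nu ->
  (nu + 1) * bG (nu + 1) z - z / 4 * bG (nu + 1 + 1) z = bG nu z.
Proof.
move=> h; have h1 : -1 < nu + 1 by lra.
have h2 : -1 < nu + 1 + 1 by lra.
have cd : cvgn (pseries (pseries_diffs (bcoef (nu + 1))) z).
  by rewrite (bcoef_diffs h1); apply: cvg_pseriesZ; exact: cvg_bpseries.
have H := pseries_diffs_equiv cd.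
rewrite (bcoef_diffs h1) (limn_pseriesZ _ (cvg_bpseries z h2)) in H.
have H1 : (nu + 1) * pseries (bcoef (nu + 1)) z n @[n --> \oo] --> (nu + 1) * bG (nu + 1) z.
  by apply: cvgMr; exact: cvg_bpseries.
rewrite -/(bG _ _) in H.
have H2' := @cvgnMk _ z _ _ H.
have E : pseries (bcoef nu) z = (fun n => (nu + 1) * pseries (bcoef (nu + 1)) z n +
    z * series (fun i : nat => i%:R * bcoef (nu + 1) i * z ^+ i.-1) n).
  apply/funext => n; rewrite /pseries /series/= !mulr_sumr -big_split/=.
  apply: eq_bigr => i _; rewrite (bcoef_rec i h).
  case: i => [|i]; first by rewrite !mul0r mulr0 !addr0 mulrA.
  by rewrite exprS /=; ring.
rewrite [RHS]/bG E; apply/esym; apply: cvg_lim => //.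
have -> : (nu + 1) * bG (nu + 1) z - z / 4 * bG (nu + 1 + 1) z =
  (nu + 1) * bG (nu + 1) z + z * (- 4^-1 * bG (nu + 1 + 1) z).
  by move: (bG _ _) (bG _ _) => A B; ring.
exact: cvgD H1 H2'.
Qed.

Lemma bG0 nu : -1 < nu -> 0 < bG nu 0.
Proof.
move=> h; have -> : bG nu 0 = bcoef nu 0.
  apply: cvg_lim => //; rewrite -(cvg_shiftS _).
  have -> : (fun n => pseries (bcoef nu) 0 n.+1) = (fun=> bcoef nu 0).
    apply/funext => n; rewrite /pseries /series/= big_nat_recl// expr0 mulr1 big1 ?addr0//.
    by move=> i _; rewrite expr0n mulr0.
  exact: cvg_cst.
by rewrite /bcoef expr0 mul1r invr_gt0 mulr_gt0 ?mulr_gt0 ?ltr0n ?fact_gt0 ?Gamma_gt0 ?argpos.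
Qed.

Lemma cont_bG nu : -1 < nu -> continuous (bG nu).
Proof. by move=> h z; exact: isd_continuous (isd_bG z h). Qed.

Lemma besselJE nu x : -1 < nu -> 0 < x ->
  besselJ nu x = (x / 2) `^ nu * bG nu (x ^+ 2).
Proof.
move=> h x0; rewrite /besselJ /bG -limn_mull; last exact: cvg_bpseries.
have x20 : 0 < x / 2 by rewrite divr_gt0.
congr (limn _); apply/funext => n; rewrite /pseries /series/=.
rewrite mulr_sumr big_mkord; apply: eq_bigr => i _.
rewrite powRD; last by rewrite (gt_eqF x20) implybT.
have -> : (x / 2) `^ (2 * i%:R) = (x ^+ 2) ^+ i / 4 ^+ i.
  rewrite -natrM powR_mulrn ?(ltW x20)// exprM -exprVn -exprMn.
  by congr (_ ^+ _); field.
rewrite /bcoef; field.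
by rewrite !gt_eqF ?exprn_gt0 ?ltr0n ?fact_gt0 ?Gamma_gt0 ?argpos.
Qed.

End BesselSeries.

(** * Energy estimates for the normal form of Bessel's equation *)

Section BesselEnergy.
Variable R : realType.
Variable nu : R.
Hypothesis nu_gt : - (1 / 2) < nu.
Implicit Types (x y c : R).

Local Notation al := (nu + 1 / 2).
Let al0 : 0 < al. Proof. by move: nu_gt; lra. Qed.
Let h0 : -1 < nu. Proof. by move: nu_gt; lra. Qed.
Let h1 : -1 < nu + 1. Proof. by move: nu_gt; lra. Qed.
Let h2 : -1 < nu + 1 + 1. Proof. by move: nu_gt; lra. Qed.

(** This is 2^nu sqrt(x) J_nu(x), the Liouville normal form, whose equation has no first-order
    term. *)
Definition bu x : R := x `^ (nu + 1 / 2) * bG nu (x ^+ 2).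
Definition bv x : R := (nu + 1 / 2) * (x `^ (nu + 1 / 2) / x) * bG nu (x ^+ 2)
   - x `^ (nu + 1 / 2) * x / 2 * bG (nu + 1) (x ^+ 2).
Local Notation q := (al * (al - 1)).

Lemma isd_bGsq mu c x : -1 < mu ->
  isd (fun y => bG mu ((c * y) ^+ 2)) x (- (c ^+ 2 * x / 2) * bG (mu + 1) ((c * x) ^+ 2)).
Proof.
move=> h; apply: isd_eq.
  apply: (@isd_comp _ (bG mu) (fun y => (c * y) ^+ 2)); first exact: isd_bG.
  by apply: isdX; apply: isdZ; exact: isdI.
by rewrite /=; field.
Qed.

Lemma isd_bGsq1 mu x : -1 < mu ->
  isd (fun y => bG mu (y ^+ 2)) x (- (x / 2) * bG (mu + 1) (x ^+ 2)).
Proof.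
move=> h; apply: isd_eq.
  apply: (@isd_comp _ (bG mu) (fun y => y ^+ 2)); first exact: isd_bG.
  by apply: isdX; exact: isdI.
by rewrite /=; field.
Qed.

Lemma isd_bu x : 0 < x -> isd bu x (bv x).
Proof.
move=> x0; apply: isd_eq.
  by apply: isdM; [exact: isd_powR'|exact: (isd_bGsq1 x h0)].
rewrite /= /bv; have xn : x != 0 by rewrite gt_eqF.
by move: (bG nu _) (bG (nu + 1) _) (x `^ _) => A B P; field.
Qed.

Lemma isd_bv x : 0 < x -> isd bv x ((q / x ^+ 2 - 1) * bu x).
Proof.
move=> x0; have xn : x != 0 by rewrite gt_eqF.
apply: isd_eq.
  apply: isdB.
    apply: isdM; last exact: (isd_bGsq1 x h0).
    apply: isdZ; apply: isdM; first exact: isd_powR'.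
    exact: (isdV xn (isdI x)).
  apply: isdM; last exact: (isd_bGsq1 x h1).
  apply: isdM; last exact: isdC.
  by apply: isdM; [exact: isd_powR'|exact: isdI].
rewrite /= /bu -(bG_rec (x ^+ 2) h0).
by move: (bG (nu + 1) _) (bG (nu + 1 + 1) _) (x `^ _) => A B P; field.
Qed.

(* For u = x^(nu+1/2) G(x^2), which solves u'' = (c/x^2 - 1) u, the energy
   u^2 + u'^2 is monotone up to factors exp(|c|/x), hence bounded above and
   away from 0 at infinity. *)
Definition benergy x : R := bu x ^+ 2 + bv x ^+ 2.

Lemma benergy_ge0 x : 0 <= benergy x.
Proof. by rewrite addr_ge0 ?sqr_ge0. Qed.

Lemma isd_benergy x : 0 < x -> isd benergy x (2 * q * (bu x * bv x) / x ^+ 2).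
Proof.
move=> x0; apply: isd_eq.
  by apply: isdD; apply: isdX; [exact: isd_bu|exact: isd_bv].
by rewrite /=; field; rewrite gt_eqF.
Qed.

Let q2 x : `|2 * q * (bu x * bv x)| <= `|q| * benergy x.
Proof.
rewrite -mulrA mulrCA normrM ler_wpM2l// ler_norml /benergy.
have := sqr_ge0 (bu x + bv x); have := sqr_ge0 (bu x - bv x).
rewrite !expr2; nra.
Qed.

Let isd_eb k x : 0 < x ->
  isd (fun x => benergy x * expR (k / x)) x
   ((2 * q * (bu x * bv x) - k * benergy x) / x ^+ 2 * expR (k / x)).
Proof.
move=> x0; have xn : x != 0 by rewrite gt_eqF.
apply: isd_eq.
  apply: isdM; first exact: isd_benergy.
  apply: (isd_comp (isd_exp _)); apply: isdZ; exact: (isdV xn (isdI x)).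
by rewrite /=; field.
Qed.

Lemma benergy_le x y : 0 < x -> x <= y -> benergy y <= benergy x * expR (`|q| / x).
Proof.
move=> x0 xy; have y0 := lt_le_trans x0 xy.
apply: (@le_trans _ _ (benergy y * expR (`|q| / y))).
  by rewrite ler_peMr ?benergy_ge0// -expR0 ler_expR divr_ge0// ltW.
apply: (@isd_ge _ (fun x => benergy x * expR (`|q| / x)) _ _ _ xy).
  by move=> z /andP[xz _]; apply: isd_eb; exact: lt_le_trans xz.
move=> z /andP[xz _]; rewrite pmulr_lle0 ?expR_gt0//.
rewrite pmulr_lle0 ?invr_gt0 ?exprn_gt0 ?(lt_le_trans x0 xz)// subr_le0.
by have := q2 z; rewrite ler_norml => /andP[].
Qed.

Lemma benergy_ge x y : 0 < x -> x <= y -> benergy x * expR (- `|q| / x) <= benergy y.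
Proof.
move=> x0 xy; have y0 := lt_le_trans x0 xy.
apply: (@le_trans _ _ (benergy y * expR (- `|q| / y))); last first.
  by rewrite ler_piMr ?benergy_ge0// expR_le1 mulNr oppr_le0 divr_ge0// ltW.
apply: (@isd_le _ (fun x => benergy x * expR (- `|q| / x)) _ _ _ xy).
  by move=> z /andP[xz _]; apply: isd_eb; exact: lt_le_trans xz.
move=> z /andP[xz _]; rewrite pmulr_lge0 ?expR_gt0//.
rewrite pmulr_lge0 ?invr_gt0 ?exprn_gt0 ?(lt_le_trans x0 xz)//.
by have := q2 z; rewrite ler_norml mulNr opprK => /andP[+ _]; lra.
Qed.

(** A uniqueness argument: by [benergy_ge], zero energy at x forces zero energy at every smaller y,
    so [bG nu] would vanish on an interval ending at 0, against [bG nu 0 > 0]. *)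
Lemma benergy_gt0 x : 0 < x -> 0 < benergy x.
Proof.
move=> x0; rewrite lt_neqAle benergy_ge0 andbT; apply/eqP => E0.
have uy y : 0 < y <= x -> bG nu (y ^+ 2) = 0.
  move=> /andP[y0 yx]; have := benergy_ge y0 yx; rewrite -E0.
  rewrite pmulr_lle0 ?expR_gt0// => ey.
  have /eqP : benergy y = 0 by apply/eqP; rewrite eq_le ey benergy_ge0.
  rewrite /benergy paddr_eq0 ?sqr_ge0// => /andP[+ _].
  by rewrite sqrf_eq0 /bu mulf_eq0 gt_eqF ?powR_gt0//= => /eqP.
have G0 := bG0 h0.
have cG : continuous (fun y => bG nu (y ^+ 2)).
  by apply: (cont_comp (cont_bG h0)); apply: contX; exact: contI.
have H : \forall t \near (0 : R), 0 < bG nu (t ^+ 2).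
  by apply: (cvgr_gt (bG nu (0 ^+ 2)) (cG 0)); rewrite expr0n.
have : \forall y \near (0:R), `|y| < x by exact: (@nbhs0_lt R R).
move=> H2; have [e /= e0 He] := filterI H H2.
have e2 : 0 < e / 2 by rewrite divr_gt0.
have [|A B] := He (e / 2); first by rewrite /ball_/= sub0r normrN gtr0_norm//; lra.
move: A; rewrite uy ?ltxx// e2/=; apply: ltW.
by move: B; rewrite gtr0_norm.
Qed.

(** Continuity handles x <= 1 and the energy bound handles x > 1. The two estimates become the two
    halves of the bound by min(s_j, 1/x)^al. *)
Lemma bG_bound : exists2 C : R, 0 < C &
  forall x, 0 < x -> `|bG nu (x ^+ 2)| <= C /\ x `^ (nu + 1 / 2) * `|bG nu (x ^+ 2)| <= C.
Proof.
have cG : continuous (fun y => bG nu (y ^+ 2)).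
  by apply: (cont_comp (cont_bG h0)); apply: contX; exact: contI.
have [M M0 HM] := @continuous_le_bound R _ 0 1 cG.
exists (M + (1 + benergy 1 * expR `|q|)).
  by rewrite addr_gt0// ltr_wpDr// mulr_ge0 ?benergy_ge0 ?expR_ge0.
have K0 : 0 <= benergy 1 * expR `|q| by rewrite mulr_ge0 ?benergy_ge0 ?expR_ge0.
move=> x x0; have [x1|x1] := leP x 1.
  have Mx : `|bG nu (x ^+ 2)| <= M by apply: HM; rewrite x1 ltW.
  have xa1 : x `^ (nu + 1 / 2) <= 1.
    by have := @ge0_ler_powR _ _ (ltW al0) x 1; rewrite powR1 !nnegrE (ltW x0); exact.
  split; first lra.
  have : x `^ (nu + 1 / 2) * `|bG nu (x ^+ 2)| <= 1 * M.
    by apply: ler_pM => //; exact: powR_ge0.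
  lra.
have ux : `|bu x| <= 1 + benergy 1 * expR `|q|.
  have := @benergy_le 1 x ltr01 (ltW x1); rewrite divr1 {1}/benergy.
  have := sqr_ge0 (bv x); have := sqr_ge0 (`|bu x| - 1).
  rewrite -[bu x ^+ 2]real_normK ?num_real// !expr2; nra.
have xa1 : 1 <= x `^ (nu + 1 / 2).
  by have := @ge0_ler_powR _ _ (ltW al0) 1 x; rewrite powR1 !nnegrE (ltW x0) ler01 (ltW x1); exact.
have E : x `^ (nu + 1 / 2) * `|bG nu (x ^+ 2)| = `|bu x|.
  by rewrite /bu normrM (ger0_norm (powR_ge0 _ _)).
rewrite E; split; last lra.
apply: (@le_trans _ _ `|bu x|); last lra.
by rewrite -E ler_peMl.
Qed.

End BesselEnergy.

Local Opaque Gamma bG.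

(** * Spacing of the zeros and the normalised eigenfunctions *)

Section Eigenfunctions.
Variable R : realType.
Variables (nu : R) (s : nat -> R).
Hypothesis nu_gt : - (1 / 2) < nu.
Hypothesis zs : bessel_zeros nu s.
Implicit Types (x y : R) (j : nat).

Local Notation al := (nu + 1 / 2).
Let al0 : 0 < al. Proof. by move: nu_gt; lra. Qed.
Let h0 : -1 < nu. Proof. by move: nu_gt; lra. Qed.
Let h1 : -1 < nu + 1. Proof. by move: nu_gt; lra. Qed.
Let h2 : -1 < nu + 1 + 1. Proof. by move: nu_gt; lra. Qed.

Lemma s_gt0 j : 0 < s j.
Proof. by case: zs => + _; exact. Qed.

Lemma s_neq0 j : s j != 0.
Proof. by rewrite gt_eqF ?s_gt0. Qed.

Lemma s_lt i j : (i < j)%N -> s i < s j.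
Proof.
case: zs => _ [sm _]; elim: j => // j ih; rewrite ltnS leq_eqVlt => /predU1P[->//|/ih h].
exact: lt_trans h (sm j).
Qed.

Lemma s_le i j : (i <= j)%N -> s i <= s j.
Proof. by rewrite leq_eqVlt => /predU1P[->//|/s_lt/ltW]. Qed.

Lemma bG_zero x : 0 < x -> bG nu (x ^+ 2) = 0 <-> exists j, s j = x.
Proof.
move=> x0; case: zs => _ [_ /(_ x x0)]; rewrite (besselJE h0 x0) => H.
have p0 : (x / 2) `^ nu != 0 by rewrite gt_eqF// powR_gt0// divr_gt0.
split; first by move=> G0; apply/H; rewrite G0 mulr0.
by move=> /H/eqP; rewrite mulf_eq0 (negbTE p0) => /eqP.
Qed.

Lemma bG_s j : bG nu (s j ^+ 2) = 0.
Proof. by apply/bG_zero; [exact: s_gt0|exists j]. Qed.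

Lemma bu_s j : bu nu (s j) = 0.
Proof. by rewrite /bu bG_s mulr0. Qed.

Lemma bv_s j : bv nu (s j) = - (s j `^ al * s j / 2) * bG (nu + 1) (s j ^+ 2).
Proof. by rewrite /bv bG_s mulr0 sub0r mulNr. Qed.

Lemma bv_bounds : exists2 c : R, 0 < c &
  (forall x, s 0 <= x -> c <= benergy nu x) /\
  exists2 C : R, 0 < C & forall x, s 0 <= x -> `|bv nu x| <= C.
Proof.
set q := al * (al - 1).
have s00 := s_gt0 0.
exists (benergy nu (s 0) * expR (- `|q| / s 0)).
  by rewrite mulr_gt0 ?benergy_gt0 ?expR_gt0.
split; first by move=> x sx; exact: benergy_ge.
exists (1 + benergy nu (s 0) * expR (`|q| / s 0)).
  by rewrite addr_gt0// mulr_gt0 ?benergy_gt0 ?expR_gt0.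
move=> x sx; have := benergy_le nu_gt s00 sx; rewrite {1}/benergy.
have := sqr_ge0 (bu nu x); have := sqr_ge0 (`|bv nu x| - 1).
rewrite -[bv nu x ^+ 2]real_normK ?num_real// -/q.
move: (benergy _ _ * expR _) => K; move: (bu nu x) `|bv nu x| => a b.
rewrite !expr2; nra.
Qed.

(* At a critical point of u between two zeros the energy bound keeps |u| away
   from 0, while |u| is at most C times the gap. *)
Lemma s_spacing : exists2 g : R, 0 < g & forall j, g <= s j.+1 - s j.
Proof.
have [c c0 [cE [C C0 CV]]] := bv_bounds.
(* The cap 1 on the gap is what allows (x - s_j)^2 to be replaced by x - s_j below. *)
exists (Num.min 1 (c / C ^+ 2)); first by rewrite lt_min ltr01 divr_gt0// exprn_gt0.
move=> j; rewrite leNgt; apply/negP; rewrite lt_min => /andP[d1 d2].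
have sj0 := s_gt0 j; have sjj : s j < s j.+1 by exact: s_lt.
have dbu x : s j <= x <= s j.+1 -> isd (bu nu) x (bv nu x).
  by move=> /andP[sx _]; apply: isd_bu => //; exact: lt_le_trans sx.
have [x /andP[ax xb]] := isd_MVT sjj dbu; rewrite !bu_s subrr => vx0.
have d0 : s j.+1 - s j != 0 by rewrite subr_eq0 gt_eqF.
have vx : bv nu x = 0 by apply: (mulIf d0); rewrite mul0r -vx0.
have s0x : s 0 <= x by apply: le_trans (ltW ax); exact: s_le.
have := cE x s0x; rewrite /benergy vx expr0n/= addr0 => cu.
have dbu' y : s j <= y <= x -> isd (bu nu) y (bv nu y).
  by move=> /andP[? ?]; apply: dbu; lra.
have [y /andP[sy yx]] := isd_MVT ax dbu'; rewrite bu_s subr0 => ux.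
have s0y : s 0 <= y by apply: le_trans (ltW sy); exact: s_le.
have xs1 : 0 <= x - s j by lra.
have vC := CV y s0y.
have u2 : bu nu x ^+ 2 <= C ^+ 2 * (x - s j).
  rewrite ux exprMn -[bv nu y ^+ 2]real_normK ?num_real//.
  apply: ler_pM; rewrite ?sqr_ge0//.
    by rewrite lerXn2r ?nnegrE// ltW.
  by rewrite expr2 ler_piMl//; lra.
have : C ^+ 2 * (x - s j) < C ^+ 2 * (c / C ^+ 2).
  by rewrite ltr_pM2l ?exprn_gt0//; lra.
rewrite mulrCA mulfV ?mulr1 ?gt_eqF ?exprn_gt0//.
lra.
Qed.

(** What remains of the constants of [psi] when both Bessel functions are written through [bG]: the
    powers of s_j / 2 cancel down to 2 / s_j. *)
Definition kap j : R := 2 * Num.sqrt 2 / (s j * `|bG (nu + 1) (s j ^+ 2)|).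

(** Agrees with [psi] for x > 0 ([psiE]) but is differentiable on the whole line, so the calculus of
    globally continuous functions applies. *)
Definition ef j x : R := kap j * bG nu ((s j * x) ^+ 2).

Definition de j x : R := kap j * (- (s j ^+ 2 * x / 2) * bG (nu + 1) ((s j * x) ^+ 2)).

(** The absolute value gives a weight continuous on the whole line that equals [dens] for x > 0. *)
Definition Wt x : R := `|x| `^ (2 * nu + 1).

Lemma bG1_neq0 x : 0 < x -> bG nu (x ^+ 2) = 0 -> bG (nu + 1) (x ^+ 2) != 0.
Proof.
move=> x0 G0; apply/eqP => G1; have := benergy_gt0 nu_gt x0.
by rewrite /benergy /bu /bv G0 G1 !mulr0 subrr expr0n/= addr0 ltxx.
Qed.

Lemma bG1s_neq0 j : bG (nu + 1) (s j ^+ 2) != 0.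
Proof. by apply: bG1_neq0; [exact: s_gt0|exact: bG_s]. Qed.

Lemma kap_gt0 j : 0 < kap j.
Proof.
by rewrite divr_gt0 ?mulr_gt0 ?sqrtr_gt0 ?s_gt0 ?normr_gt0 ?bG1s_neq0.
Qed.

Lemma psiE j x : 0 < x -> psi nu s j x = ef j x.
Proof.
move=> x0; have sj := s_gt0 j; rewrite /psi /ef /kap.
rewrite (besselJE h1 sj) (besselJE h0); last by rewrite mulr_gt0.
have s2 : 0 < s j / 2 by rewrite divr_gt0.
have -> : s j * x / 2 = (s j / 2) * x by ring.
rewrite (powRM _ (ltW s2) (ltW x0)) powRN normrM (ger0_norm (powR_ge0 _ _)).
rewrite (@powRD _ (s j / 2) nu 1) ?(gt_eqF s2) ?implybT// (powRr1 (ltW s2)).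
have px : x `^ nu != 0 by rewrite gt_eqF// powR_gt0.
have ps : (s j / 2) `^ nu != 0 by rewrite gt_eqF// powR_gt0.
have G1 : `|bG (nu + 1) (s j ^+ 2)| != 0 by rewrite normr_eq0 bG1s_neq0.
have sn := s_neq0 j.
move: (Num.sqrt 2) (x `^ nu) ((s j / 2) `^ nu) `|bG (nu + 1) (s j ^+ 2)| (bG nu _) px ps G1.
move=> a b c d e b0 c0 d0.
by field; rewrite b0 c0 d0 sn.
Qed.

(** At a zero the energy reduces to [bv nu (s j) ^+ 2], while [kap j] times |bv(s_j)| is exactly
    sqrt(2) s_j^al. The lower bound on the energy thus gives kap_j <= C s_j^al, and [bG_bound] at
    s_j x supplies the rest. *)
Lemma ef_bound : exists2 C : R, 0 < C & forall j x, 0 < x ->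
  `|ef j x| <= C * s j `^ al /\ `|ef j x| <= C * (x `^ al)^-1.
Proof.
have [c c0 [cE _]] := bv_bounds.
have [B B0 HB] := bG_bound nu_gt.
exists (Num.sqrt 2 * B * (1 + c^-1)).
  by rewrite !mulr_gt0 ?sqrtr_gt0// addr_gt0// invr_gt0.
move=> j x x0; have sj := s_gt0 j.
have sx0 : 0 < s j * x by rewrite mulr_gt0.
have kj : kap j <= Num.sqrt 2 * (1 + c^-1) * s j `^ al.
  have := cE (s j) (s_le (leq0n j)); rewrite /benergy bu_s expr0n/= add0r.
  have p0 : 0 < s j `^ al by rewrite powR_gt0.
  have : kap j * `|bv nu (s j)| = Num.sqrt 2 * s j `^ al.
    rewrite bv_s normrM normrN normrM normrM (gtr0_norm p0) (gtr0_norm sj).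
    rewrite [`|2^-1|]gtr0_norm// /kap.
    have G1 : `|bG (nu + 1) (s j ^+ 2)| != 0 by rewrite normr_eq0 bG1s_neq0.
    have sn := s_neq0 j.
    move: `|bG (nu + 1) (s j ^+ 2)| G1 (Num.sqrt 2) (s j `^ al) => d d0 a b.
    by field; rewrite d0 sn.
  rewrite -[bv nu (s j) ^+ 2]real_normK ?num_real//.
  move: `|bv nu (s j)| (normr_ge0 (bv nu (s j))) => v v0 kv cv.
  have vp : 0 < v.
    rewrite lt_neqAle v0 andbT; apply/eqP => v00.
    by move: cv; rewrite -v00 expr0n/= leNgt c0.
  have -> : kap j = Num.sqrt 2 * s j `^ al / v by rewrite -kv mulfK// gt_eqF.
  rewrite -[Num.sqrt 2 * (1 + _) * _]mulrA [(1 + _) * _]mulrC mulrA.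
  rewrite ler_pM2l ?mulr_gt0 ?sqrtr_gt0//.
  have [v1|v1] := leP 1 v.
    apply: (@le_trans _ _ 1); first by rewrite invf_le1.
    by rewrite lerDl invr_ge0 ltW.
  apply: (@le_trans _ _ (c^-1)); last by rewrite lerDr.
  rewrite lef_pV2 ?posrE//; apply: (le_trans cv).
  by rewrite expr2 ger_pMl// ltW.
have [b1 b2] := HB _ sx0.
have nE : `|ef j x| = kap j * `|bG nu ((s j * x) ^+ 2)|.
  by rewrite /ef normrM gtr0_norm ?kap_gt0.
have p0 : 0 <= Num.sqrt 2 * (1 + c^-1) * s j `^ al.
  by rewrite !mulr_ge0 ?powR_ge0 ?addr_ge0 ?invr_ge0 ?sqrtr_ge0 ?(ltW c0).
split.
  rewrite nE [leRHS](_ : _ = Num.sqrt 2 * (1 + c^-1) * s j `^ al * B); last by ring.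
  by apply: ler_pM => //; exact/ltW/kap_gt0.
apply: (@le_trans _ _ (Num.sqrt 2 * (1 + c^-1) * s j `^ al * `|bG nu ((s j * x) ^+ 2)|)).
  by rewrite nE ler_wpM2r.
move: b2; rewrite (powRM _ (ltW sj) (ltW x0)) => b2.
have xp : 0 < x `^ al by rewrite powR_gt0.
rewrite ler_pdivlMr//.
have -> : Num.sqrt 2 * (1 + c^-1) * s j `^ al * `|bG nu ((s j * x) ^+ 2)| * x `^ al =
  Num.sqrt 2 * (1 + c^-1) * (s j `^ al * x `^ al * `|bG nu ((s j * x) ^+ 2)|) by ring.
rewrite [leRHS](_ : _ = Num.sqrt 2 * (1 + c^-1) * B); last by ring.
by rewrite ler_wpM2l// mulr_ge0 ?addr_ge0 ?invr_ge0 ?sqrtr_ge0 ?(ltW c0).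
Qed.

Lemma isd_ef j x : isd (ef j) x (de j x).
Proof. by apply: isdZ; exact: isd_bGsq. Qed.

Lemma cont_ef j : continuous (ef j).
Proof. by move=> x; exact: isd_continuous (isd_ef j x). Qed.

Lemma isd_de j x : 0 < x ->
  isd (de j) x (- ((2 * nu + 1) / x * de j x + s j ^+ 2 * ef j x)).
Proof.
move=> x0; have xn : x != 0 by rewrite gt_eqF.
apply: isd_eq.
  apply: isdZ; apply: isdM; last exact: (isd_bGsq (s j) x h1).
  apply: isdN; apply: isdM; last exact: isdC.
  by apply: isdZ; exact: isdI.
rewrite /= /de /ef -(bG_rec ((s j * x) ^+ 2) h0).
by move: (bG (nu + 1) _) (bG (nu + 1 + 1) _) (kap j) => A B k; field.
Qed.

Lemma cont_de j : continuous (de j).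
Proof.
have cG : continuous (fun x => bG (nu + 1) ((s j * x) ^+ 2)).
  apply: (@cont_comp _ (bG (nu + 1)) (fun x => (s j * x) ^+ 2)).
    exact: (cont_bG h1).
  by cont.
rewrite -[de j]/(fun x => kap j * (- (s j ^+ 2 * x / 2) * bG (nu + 1) ((s j * x) ^+ 2))).
by cont.
Qed.

Let e20 : 0 < 2 * nu + 1. Proof. by move: nu_gt; lra. Qed.

Lemma cont_Wt : continuous Wt.
Proof. exact: cont_powR. Qed.

Lemma Wt_ge0 x : 0 <= Wt x.
Proof. exact: powR_ge0. Qed.

Lemma Wt_gt0 x : 0 < x -> 0 < Wt x.
Proof. by move=> x0; rewrite powR_gt0// gtr0_norm. Qed.

Lemma Wt0 : Wt 0 = 0.
Proof. by rewrite /Wt normr0 powR0// gt_eqF. Qed.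

Lemma Wt1 : Wt 1 = 1.
Proof. by rewrite /Wt normr1 powR1. Qed.

Lemma isd_Wt x : 0 < x -> isd Wt x ((2 * nu + 1) * Wt x / x).
Proof.
move=> x0; have := isd_powR' (2 * nu + 1) x0; rewrite {2}/Wt gtr0_norm//.
apply: isd_near; near=> y; rewrite /Wt gtr0_norm//.
by near: y; exact: lt_nbhsr.
Unshelve. all: by end_near. Qed.

Lemma isd_flux j x : 0 < x ->
  isd (fun x => Wt x * de j x) x (- (s j ^+ 2 * (ef j x * Wt x))).
Proof.
move=> x0; apply: isd_eq.
  by apply: isdM; [exact: isd_Wt|exact: isd_de].
by rewrite /=; field; rewrite gt_eqF.
Qed.

Lemma ef1 j : ef j 1 = 0.
Proof. by rewrite /ef mulr1 bG_s mulr0. Qed.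

Lemma de_neq0 j x : 0 < x -> ef j x = 0 -> de j x != 0.
Proof.
move=> x0 /eqP; rewrite mulf_eq0 gt_eqF ?kap_gt0//= => /eqP G0.
have k0 : kap j != 0 by rewrite gt_eqF// kap_gt0.
have G1 : bG (nu + 1) ((s j * x) ^+ 2) != 0.
  by apply: bG1_neq0 => //; rewrite mulr_gt0// s_gt0.
have sx : s j ^+ 2 * x / 2 != 0 by rewrite gt_eqF// !mulr_gt0 ?exprn_gt0 ?s_gt0.
by apply: mulf_neq0 => //; apply: mulf_neq0 => //; rewrite oppr_eq0.
Qed.

Lemma ef_zero N x : 0 < x < 1 -> ef N x = 0 -> exists2 i, (i < N)%N & x = s i / s N.
Proof.
move=> /andP[x0 x1] /eqP; rewrite mulf_eq0 gt_eqF ?kap_gt0//= => /eqP.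
move/(bG_zero (mulr_gt0 (s_gt0 N) x0)) => [i si]; exists i; last first.
  by rewrite si mulrAC mulfV ?mul1r ?s_neq0.
rewrite ltnNge; apply/negP => /s_le; rewrite si.
by rewrite -{1}[s N]mulr1 ler_pM2l ?s_gt0// leNgt x1.
Qed.

Lemma de1_sq j : de j 1 ^+ 2 = 2 * s j ^+ 2.
Proof.
have G1 := bG1s_neq0 j; have sn := s_neq0 j.
have g2 : `|bG (nu + 1) (s j ^+ 2)| ^+ 2 = bG (nu + 1) (s j ^+ 2) ^+ 2.
  by rewrite real_normK ?num_real.
have t2 : Num.sqrt 2 ^+ 2 = 2 :> R by rewrite sqr_sqrtr.
have n1 : `|bG (nu + 1) (s j ^+ 2)| != 0 by rewrite normr_eq0.
have key (n a t : R) : n != 0 -> (2 * t / (s j * n) * (- (s j ^+ 2 / 2) * a)) ^+ 2 =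
    t ^+ 2 * s j ^+ 2 * (a ^+ 2 / n ^+ 2) by move=> n0; field; rewrite n0 sn.
by rewrite /de /kap !mulr1 key// t2 g2 mulfV ?mulr1// expf_neq0.
Qed.

#[local] Hint Resolve cont_ef cont_de cont_Wt : cont.

(** [Q] is a Rellich-Pohozaev quantity: by the equation its derivative is 2 s_j^2 e_j^2 W. It
    vanishes at 0 with the weight, and at 1 it equals e_j'(1)^2 = 2 s_j^2, which is what the
    constant in [psi] is made for. *)
Lemma ef_norm j : cint 0 1 (fun x => ef j x * ef j x * Wt x) = 1.
Proof.
pose Q x := x * Wt x * (de j x ^+ 2 + s j ^+ 2 * ef j x ^+ 2) +
   2 * nu * (Wt x * de j x * ef j x).
have cf : continuous (fun x => ef j x * ef j x * Wt x).
  by cont.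
have s2 : 2 * s j ^+ 2 != 0 by rewrite mulf_neq0// expf_neq0 ?s_neq0.
apply: (mulfI s2); rewrite -cintZ// mulr1.
rewrite (@cintFTC _ 0 1 _ Q ler01).
- by rewrite /Q Wt0 Wt1 ef1 de1_sq; ring.
- by cont.
- have cQ : continuous Q.
    by rewrite -[Q]/(fun x => x * Wt x * (de j x ^+ 2 + s j ^+ 2 * ef j x ^+ 2) +
      2 * nu * (Wt x * de j x * ef j x)); cont.
  by move=> x _; exact: cQ.
move=> x /andP[x0 _]; have xn : x != 0 by rewrite gt_eqF.
apply: isd_eq.
  apply: isdD.
    apply: isdM.
      by apply: isdM; [exact: isdI|exact: isd_Wt].
    apply: isdD; first by apply: isdX; exact: isd_de.
    by apply: isdZ; apply: isdX; exact: isd_ef.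
  by apply: isdZ; apply: isdM; [exact: isd_flux|exact: isd_ef].
by rewrite /=; field.
Qed.

End Eigenfunctions.

(** * Completeness of the eigenfunctions *)

Section FTCInequality.
Variable R : realType.
Implicit Types (F G f g p v : R -> R) (a b x z c : R).

Lemma isd_le_oo F f a b : a <= b ->
  (forall x, a <= x <= b -> {for x, continuous F}) ->
  (forall x, a < x < b -> isd F x (f x)) ->
  (forall x, a < x < b -> 0 <= f x) -> F a <= F b.
Proof.
rewrite le_eqVlt => /predU1P[->//|ab] cF dF f0.
have [||c cab h] := @MVT R F f a b ab.
- by move=> x; rewrite in_itv/=; exact: dF.
- by apply: continuous_in_subspaceT => x; rewrite inE/= in_itv/=; exact: cF.
rewrite -subr_ge0 h mulr_ge0 ?subr_ge0 ?(ltW ab)//.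
by apply: f0; move: cab; rewrite in_itv.
Qed.

(** The interval is cut at each exceptional point, where only continuity of [G] is available. This
    serves quotients with removable singularities. *)
Lemma FTC_le (zs : seq R) G g f a b : a <= b -> continuous f ->
  (forall x, a <= x <= b -> {for x, continuous G}) ->
  (forall x, a < x < b -> x \notin zs -> isd G x (g x) /\ g x <= f x) ->
  G b - G a <= cint a b f.
Proof.
move=> + cf; elim: zs a b => [|z zs ih] a b ab cG dG.
  have [F dF] := primitive_exists a b cf.
  rewrite (cint_primitive ab cf dF).
  suff : F a - G a <= F b - G b by lra.
  apply: (@isd_le_oo (fun x => F x - G x) (fun x => f x - g x)) => // x axb.
  - by apply: cvgB; [exact: isd_continuous (dF _ axb)|exact: cG].
  - have [h _] := dG x axb isT; apply: isdB => //; apply: dF.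
    by case/andP: axb => ? ?; rewrite !ltW.
  - by rewrite subr_ge0; have [] := dG x axb isT.
have [/andP[az zb]|nz] := boolP (a < z < b); last first.
  apply: ih => // x axb xzs; apply: dG => //; rewrite inE negb_or xzs andbT.
  by apply: contra nz => /eqP <-.
have azb : a <= z <= b by rewrite !ltW.
have := @ih a z (ltW az); have := @ih z b (ltW zb).
rewrite (cint_split azb cf) => H1 H2.
have {}H1 : G b - G z <= cint z b f.
  apply: H1 => [x /andP[zx xb]|x /andP[zx xb] xzs].
    by apply: cG; rewrite xb (le_trans (ltW az)).
  by apply: dG; rewrite ?(lt_trans az zx)// inE negb_or xzs andbT gt_eqF.
have {}H2 : G z - G a <= cint a z f.
  apply: H2 => [x /andP[ax xz]|x /andP[ax xz] xzs].
    by apply: cG; rewrite ax (le_trans xz (ltW zb)).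
  by apply: dG; rewrite ?ax ?(lt_trans xz zb)// inE negb_or xzs andbT lt_eqF.
lra.
Qed.

Lemma isd_approx f z c e : isd f z c -> 0 < e ->
  \forall y \near z, `|f y - f z - c * (y - z)| <= e * `|y - z|.
Proof.
move=> [df Df] e0.
have H : h^-1 *: (f (h *: 1 + z) - f z) @[h --> (0 : R)^'] --> c.
  by rewrite -Df; exact: df.
have H2 : \forall h \near (0 : R), h != 0 -> `|c - h^-1 *: (f (h *: 1 + z) - f z)| <= e.
  by move/cvgrPdist_le : H => /(_ e e0); rewrite near_withinE.
move/nbhs_ballP : H2 => [d /= d0 Hd].
apply/nbhs_ballP; exists d => //= y zy.
have [->|yz] := eqVneq y z; first by rewrite !subrr mulr0 subrr normr0 mulr0.
have yz0 : y - z != 0 by rewrite subr_eq0.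
have zy' : ball 0 d (y - z) by move: zy; rewrite /ball/= sub0r normrN distrC.
have := Hd (y - z) zy' yz0.
rewrite /GRing.scale/= mulr1 subrK => h.
have -> : f y - f z - c * (y - z) = - (c - (y - z)^-1 * (f y - f z)) * (y - z).
  by field.
by rewrite normrM normrN ler_wpM2r.
Qed.

(** The zero of [p] is simple, so |p| is at least a multiple of |y - z|, while v^2 is of order |y -
    z|^2. *)
Lemma cvg_sq_div p v z cp cv : isd p z cp -> cp != 0 -> isd v z cv ->
  p z = 0 -> v z = 0 -> v y ^+ 2 / p y @[y --> z] --> (0 : R).
Proof.
move=> dp cp0 dv pz vz.
have cp2 : 0 < `|cp| / 2 by rewrite divr_gt0// normr_gt0.
have Hp := isd_approx dp cp2.
have Hv := isd_approx dv ltr01.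
pose K := (`|cv| + 1) ^+ 2 / (`|cp| / 2).
apply: (@norm_cvg0 _ _); apply: (@squeeze_cvgr _ _ _ _ (fun=> 0) (fun y => K * `|y - z|)).
- near=> y; rewrite normr_ge0/=.
  have [yz|yz] := eqVneq y z.
    by rewrite yz pz invr0 mulr0 normr0 mulr_ge0// /K divr_ge0 ?sqr_ge0 ?ltW.
  have yz0 : 0 < `|y - z| by rewrite normr_gt0 subr_eq0.
  have h1 : `|p y - cp * (y - z)| <= `|cp| / 2 * `|y - z|.
    by near: y; move: Hp; rewrite pz; apply: filterS => y; rewrite subr0.
  have h2 : `|v y - cv * (y - z)| <= 1 * `|y - z|.
    by near: y; move: Hv; rewrite vz; apply: filterS => y; rewrite subr0.
  have p1 : `|cp| / 2 * `|y - z| <= `|p y|.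
    have := ler_normB (p y) (p y - cp * (y - z)); rewrite opprB addrC subrK normrM.
    lra.
  have v1 : `|v y| <= (`|cv| + 1) * `|y - z|.
    have := ler_normD (v y - cv * (y - z)) (cv * (y - z)); rewrite subrK normrM; lra.
  rewrite normrM normfV normrX /K.
  have pp : 0 < `|p y| by apply: lt_le_trans p1; rewrite mulr_gt0.
  rewrite ler_pdivrMr// mulrC.
  apply: (@le_trans _ _ (((`|cv| + 1) * `|y - z|) ^+ 2)).
    by rewrite lerXn2r ?nnegrE// mulr_ge0// addr_ge0.
  have -> : ((`|cv| + 1) * `|y - z|) ^+ 2 =
      (`|cp| / 2 * `|y - z|) * ((`|cv| + 1) ^+ 2 / (`|cp| / 2) * `|y - z|).
    by field; rewrite normr_eq0.
  by rewrite ler_wpM2r// mulr_ge0// divr_ge0 ?sqr_ge0// ltW.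
- exact: cvg_cst.
- have ck : continuous (fun y => K * `|y - z|) by cont.
  have ckz : K * `|y - z| @[y --> z] --> K * `|z - z| := ck z.
  by rewrite subrr normr0 mulr0 in ckz.
Unshelve. all: by end_near. Qed.

Lemma quad_expand (I : finType) (e : I -> R -> R) (b : I -> R) (r W : R -> R) :
  (forall i, continuous (e i)) -> continuous r -> continuous W ->
  cint 0 1 (fun x => (r x + \sum_i b i * e i x) ^+ 2 * W x) =
  cint 0 1 (fun x => r x ^+ 2 * W x)
  + 2 * (\sum_i b i * cint 0 1 (fun x => r x * e i x * W x))
  + \sum_i \sum_j b i * b j * cint 0 1 (fun x => e i x * e j x * W x).
Proof.
move=> ce cr cW.
have -> : \sum_i b i * cint 0 1 (fun x => r x * e i x * W x) =
    cint 0 1 (fun x => \sum_i b i * (r x * e i x * W x)).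
  rewrite cint_sum; last by move=> i; cont.
  by apply: eq_bigr => i _; rewrite cintZ//; cont.
have -> : \sum_i \sum_j b i * b j * cint 0 1 (fun x => e i x * e j x * W x) =
    cint 0 1 (fun x => \sum_i \sum_j b i * b j * (e i x * e j x * W x)).
  rewrite cint_sum; last by move=> i; cont.
  apply: eq_bigr => i _; rewrite cint_sum; last by move=> j; cont.
  by apply: eq_bigr => j _; rewrite cintZ//; cont.
rewrite -cintZ; last by cont.
rewrite -cintD; [|by cont..].
rewrite -cintD; [|by cont..].
apply: eq_cint => x _.
have -> : \sum_i b i * (r x * e i x * W x) = r x * W x * \sum_i b i * e i x.
  by rewrite mulr_sumr; apply: eq_bigr => i _; ring.
have -> : \sum_i \sum_j b i * b j * (e i x * e j x * W x) =
    (\sum_i b i * e i x) * (\sum_i b i * e i x) * W x.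
  rewrite mulr_suml mulr_suml; apply: eq_bigr => i _.
  by rewrite mulr_sumr mulr_suml; apply: eq_bigr => j _; ring.
by ring.
Qed.

End FTCInequality.

(** * Picone's identity and the rate of convergence of eigenfunction expansions *)

Section Completeness.
Variable R : realType.
Variables (nu : R) (s : nat -> R).
Hypothesis nu_gt : - (1 / 2) < nu.
Hypothesis zs : bessel_zeros nu s.
Implicit Types (x y : R) (i j N : nat) (v dv g dg : R -> R).

Local Notation W := (Wt nu).
Local Notation e := (ef nu s).
Local Notation d := (de nu s).

Let ce j : continuous (e j). Proof. exact: cont_ef. Qed.
Let cd j : continuous (d j). Proof. exact: cont_de. Qed.
Let cW : continuous W. Proof. exact: cont_Wt. Qed.
#[local] Hint Resolve ce cd cW : cont.

(** Only the Dirichlet condition at 1 is recorded: at 0 all boundary terms carry the factor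
    [Wt 0 = 0]. *)
Definition C1 v dv := [/\ forall x, isd v x (dv x), continuous dv & v 1 = 0].

Lemma C1_cont v dv : C1 v dv -> continuous v.
Proof. by move=> [dvx _ _] x; exact: isd_continuous (dvx x). Qed.

Lemma C1_ef j : C1 (e j) (d j).
Proof. by split; [exact: isd_ef|exact: cd|exact: ef1]. Qed.

Lemma C1_sum (I : finType) (h : I -> nat) (b : I -> R) v dv : C1 v dv ->
  C1 (fun x => v x + \sum_i b i * e (h i) x) (fun x => dv x + \sum_i b i * d (h i) x).
Proof.
move=> [dvx cdv v1]; split.
- move=> x; apply: isdD => //; apply: isd_sum => i; apply: isdZ; exact: isd_ef.
- by cont.
- by rewrite v1 add0r big1// => i _; rewrite ef1// mulr0.
Qed.

Lemma ef_ibp j v dv : C1 v dv ->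
  cint 0 1 (fun x => d j x * dv x * W x) = s j ^+ 2 * cint 0 1 (fun x => e j x * v x * W x).
Proof.
move=> Cv; have cv := C1_cont Cv; case: Cv => dvx cdv v1.
apply/eqP; rewrite -subr_eq0; apply/eqP.
rewrite -cintZ; last by cont.
rewrite -cintB; [|by cont..].
rewrite (@cintFTC _ 0 1 _ (fun x => W x * d j x * v x) ler01).
- by rewrite v1 Wt0// !mul0r mulr0 subrr.
- by cont.
- have cF : continuous (fun x => W x * d j x * v x) by cont.
  by move=> x _; exact: cF.
- move=> x /andP[x0 _]; apply: isd_eq.
    by apply: isdM; [exact: isd_flux|exact: dvx].
  by rewrite /=; ring.
Qed.

Lemma ef_orth i j : cint 0 1 (fun x => e i x * e j x * W x) = (i == j)%:R.
Proof.
have [->|ij] := eqVneq i j; first exact: ef_norm.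
have H1 := ef_ibp i (C1_ef j); have H2 := ef_ibp j (C1_ef i).
have E1 : cint 0 1 (fun x => d j x * d i x * W x) = cint 0 1 (fun x => d i x * d j x * W x).
  by apply: eq_cint => x _; ring.
have E2 : cint 0 1 (fun x => e j x * e i x * W x) = cint 0 1 (fun x => e i x * e j x * W x).
  by apply: eq_cint => x _; ring.
move: H2; rewrite E1 E2 H1 => /eqP; rewrite -subr_eq0 -mulrBl mulf_eq0 subr_eq0.
rewrite eqrXn2 ?(ltW (s_gt0 zs _))// => /orP[/eqP sij|/eqP//].
case: (ltngtP i j) => [/(s_lt zs)|/(s_lt zs)|/eqP]; rewrite ?sij ?ltxx//.
by rewrite (negbTE ij).
Qed.

Lemma de_orth i j : cint 0 1 (fun x => d i x * d j x * W x) = s i ^+ 2 * (i == j)%:R.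
Proof. by rewrite (ef_ibp i (C1_ef j)) ef_orth. Qed.

Lemma ef_0_neq0 j : e j 0 != 0.
Proof.
by rewrite /ef mulr0 expr0n/= mulf_neq0// gt_eqF// ?kap_gt0// bG0//; move: nu_gt; lra.
Qed.

(* Picone's identity with comparison function e_N: the boundary terms of
   v^2 e_N' / e_N vanish because v is 0 wherever e_N is. *)
Lemma picone N v dv : C1 v dv -> (forall i, (i < N)%N -> v (s i / s N) = 0) ->
  s N ^+ 2 * cint 0 1 (fun x => v x ^+ 2 * W x) <= cint 0 1 (fun x => dv x ^+ 2 * W x).
Proof.
move=> Cv vz; have cv := C1_cont Cv; case: Cv => dvx cdv v1.
rewrite -subr_ge0 -cintZ; last by cont.
rewrite -cintB; [|by cont..].
pose G x := W x * d N x * (v x ^+ 2 / e N x).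
pose f x := dv x ^+ 2 * W x - s N ^+ 2 * (v x ^+ 2 * W x).
(* The derivative of [G] away from the zeros of [e N]: completing the square leaves [f] minus a
   nonnegative term. *)
pose g x := f x - W x * (dv x - v x * d N x / e N x) ^+ 2.
have G10 : G 1 - G 0 = 0 by rewrite /G Wt0// v1 !mul0r expr0n/= mul0r mulr0 subrr.
rewrite -[leLHS]G10.
have vez x : 0 <= x <= 1 -> e N x = 0 -> 0 < x /\ v x = 0.
  move=> /andP[x0 x1] ex.
  have xp : 0 < x.
    by rewrite lt_neqAle x0 andbT; apply/eqP => xx; rewrite -xx in ex; have := ef_0_neq0 N; rewrite ex eqxx.
  split=> //; move: x1; rewrite le_eqVlt => /predU1P[->//|x1].
  have x01 : 0 < x < 1 by rewrite xp.
  by have [i iN ->] := ef_zero nu_gt zs x01 ex; exact: vz.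
apply: (@FTC_le _ [seq s i / s N | i <- iota 0 N] G g f _ _ ler01).
- by rewrite /f; cont.
- move=> x x01.
  have cWd : continuous (fun x => W x * d N x) by cont.
  have [ex|ex] := eqVneq (e N x) 0; last first.
    apply: (@cvgM _ _ _ _ (fun x => W x * d N x) (fun x => v x ^+ 2 / e N x)); first exact: cWd.
    have c2 : continuous (fun x => v x ^+ 2) by cont.
    by apply: cvgM; [exact: c2|apply: cvgV => //; exact: ce].
  have [x0 vx] := vez x x01 ex.
  have dex : isd (e N) x (d N x) by exact: isd_ef.
  (* At a zero of [e N] the quotient is 0 / 0, which is 0 by convention; the limit is 0 too, so [G]
     is continuous there. *)
  have H := cvg_sq_div dex (de_neq0 nu_gt zs x0 ex) (dvx x) ex vx.
  rewrite /prop_for /continuous_at/= {2}/G vx expr0n/= mul0r.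
  exact: cvgM (cWd x) H.
- move=> x /andP[x0 x1] xz.
  have ex : e N x != 0.
    apply/eqP => ex; have x01 : 0 < x < 1 by rewrite x0.
    have [i iN xE] := ef_zero nu_gt zs x01 ex.
    have : s i / s N \in [seq s i / s N | i <- iota 0 N].
      by apply: (map_f (fun i => s i / s N)); rewrite mem_iota.
    by rewrite -xE (negbTE xz).
  split; last by rewrite /g lerBlDr lerDl mulr_ge0 ?sqr_ge0 ?Wt_ge0.
  apply: isd_eq.
    apply: isdM; first exact: isd_flux.
    apply: isdM; first by apply: isdX; exact: dvx.
    by apply: isdV => //; exact: isd_ef.
  rewrite /= /g /f; move: (W x) (d N x) (e N x) (v x) (dv x) (s N) ex => w p q r t z q0.
  by field.
Qed.

Lemma sum_diag (I : finType) (b c : I -> R) :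
  \sum_i \sum_j b i * b j * (c i * (i == j)%:R) = \sum_i c i * b i ^+ 2.
Proof.
apply: eq_bigr => i _; rewrite (bigD1 i)//= eqxx big1; last first.
  by move=> j ji; rewrite eq_sym (negbTE ji) !mulr0.
by rewrite addr0 mulr1 mulrC expr2.
Qed.

(** A combination of e_0, ..., e_(N-1) that vanishes at all interior zeros of e_N satisfies Picone's
    inequality, which by orthogonality reads s_N^2 sum b_i^2 <= sum s_i^2 b_i^2. As s_i < s_N, all
    b_i are 0. *)
Lemma ef_matrix N : (\matrix_(i < N, k < N) e i (s k / s N) : 'M[R]_N) \in unitmx.
Proof.
rewrite -row_free_unit; apply: inj_row_free => u u0.
pose b (i : 'I_N) := u 0 i.
have C0 : C1 (fun=> 0 : R) (fun=> 0 : R).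
  by split => //; [move=> x; exact: isdC|exact: contC].
have Cw := @C1_sum _ (@nat_of_ord N) b _ _ C0.
have wz i : (i < N)%N -> 0 + \sum_(k < N) b k * e k (s i / s N) = 0.
  move=> iN; rewrite add0r; have /matrixP /(_ 0 (Ordinal iN)) := u0.
  rewrite mxE [in RHS]mxE => H; rewrite -[RHS]H.
  by apply: eq_bigr => k _; rewrite mxE.
have := picone Cw wz.
rewrite (quad_expand b (fun k : 'I_N => @ce k) (@contC _ 0) cW).
rewrite (quad_expand b (fun k : 'I_N => @cd k) (@contC _ 0) cW).
have z0 : cint 0 1 (fun x => (0 : R) ^+ 2 * W x) = 0.
  by rewrite (@eq_cint _ _ _ _ (fun=> 0 * 0)) ?cintZ ?mul0r//; [exact: contC|move=> x _; rewrite expr0n/= !mul0r].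
have zz (h : R -> R) : cint 0 1 (fun x => 0 * h x * W x) = 0.
  by rewrite (@eq_cint _ _ _ _ (fun=> 0 * 0)) ?cintZ ?mul0r//; [exact: contC|move=> x _; rewrite !mul0r].
rewrite z0; under eq_bigr do rewrite zz mulr0.
under [X in _ <= _ + 2 * X + _]eq_bigr do rewrite zz mulr0.
have S0 : \sum_(i < N) (0 : R) = 0 by rewrite big1.
rewrite !S0 mulr0 !add0r.
under eq_bigr do under eq_bigr do rewrite ef_orth -[(_ == _)%:R]mul1r.
under [X in _ <= X]eq_bigr do under eq_bigr do rewrite de_orth.
rewrite (sum_diag b (fun=> 1)) (sum_diag b (fun i : 'I_N => s i ^+ 2)).
rewrite mulr_sumr -subr_ge0 -sumrB => H.
apply/rowP => k; rewrite mxE; apply/eqP/negP => /negP bk.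
suff : \sum_(i < N) (s i ^+ 2 * b i ^+ 2 - s N ^+ 2 * (1 * b i ^+ 2)) < 0 by rewrite ltNge H.
have sN (i : 'I_N) : s i ^+ 2 < s N ^+ 2.
  by rewrite ltrXn2r ?nnegrE ?(ltW (s_gt0 zs _))//; apply: (s_lt zs); exact: ltn_ord.
rewrite (bigD1 k)//= -[ltRHS]addr0; apply: ltr_leD.
  by rewrite mul1r -mulrBl pmulr_llt0 ?subr_lt0// exprn_even_gt0.
apply: sumr_le0 => i _; rewrite mul1r -mulrBl mulr_le0_ge0 ?sqr_ge0// subr_le0.
exact: ltW.
Qed.

(** Adding the combination of e_0, ..., e_(N-1) that cancels [v] at the zeros of e_N makes Picone's
    inequality applicable. By orthogonality the added part contributes s_N^2 b_i^2 on the left and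
    only s_i^2 b_i^2 on the right, so it can be removed. *)
Lemma rayleigh N v dv : C1 v dv ->
  (forall i, (i < N)%N -> cint 0 1 (fun x => v x * e i x * W x) = 0) ->
  s N ^+ 2 * cint 0 1 (fun x => v x ^+ 2 * W x) <= cint 0 1 (fun x => dv x ^+ 2 * W x).
Proof.
move=> Cv vo; have cv := C1_cont Cv; have cdv : continuous dv by case: Cv.
pose A : 'M[R]_N := \matrix_(i < N, k < N) e i (s k / s N).
pose rv : 'rV[R]_N := \row_k v (s k / s N).
pose u := - rv *m invmx A.
have uA : u *m A = - rv by rewrite mulmxKV// ef_matrix.
pose b (i : 'I_N) := u 0 i.
have Cw := @C1_sum _ (@nat_of_ord N) b _ _ Cv.
have wz i : (i < N)%N -> v (s i / s N) + \sum_(k < N) b k * e k (s i / s N) = 0.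
  move=> iN; have /matrixP /(_ 0 (Ordinal iN)) := uA.
  rewrite !mxE/= => H; apply/eqP; rewrite addrC addr_eq0 -H.
  by apply/eqP; apply: eq_bigr => k _; rewrite /A mxE.
have := picone Cw wz.
rewrite (quad_expand b (fun k : 'I_N => @ce k) cv cW).
rewrite (quad_expand b (fun k : 'I_N => @cd k) cdv cW).
have E1 : \sum_(i < N) b i * cint 0 1 (fun x => v x * e i x * W x) = 0.
  by rewrite big1// => i _; rewrite vo ?mulr0.
have E2 : \sum_(i < N) b i * cint 0 1 (fun x => dv x * d i x * W x) = 0.
  rewrite big1// => i _.
  rewrite (@eq_cint _ _ _ _ (fun x => d i x * dv x * W x)); last by move=> x _; ring.
  rewrite (ef_ibp i Cv).
  rewrite (@eq_cint _ _ _ _ (fun x => v x * e i x * W x)); last by move=> x _; ring.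
  by rewrite vo// !mulr0.
rewrite E1 E2 mulr0 !addr0.
under eq_bigr do under eq_bigr do rewrite ef_orth -[(_ == _)%:R]mul1r.
under [X in _ <= _ + X]eq_bigr do under eq_bigr do rewrite de_orth.
rewrite (sum_diag b (fun=> 1)) (sum_diag b (fun i : 'I_N => s i ^+ 2)).
suff : \sum_(i < N) s i ^+ 2 * b i ^+ 2 <= s N ^+ 2 * \sum_(i < N) 1 * b i ^+ 2.
  by rewrite mulrDr; lra.
rewrite mulr_sumr; apply: ler_sum => i _; rewrite mul1r ler_wpM2r ?sqr_ge0//.
by rewrite lerXn2r ?nnegrE ?(ltW (s_gt0 zs _))//; apply: (s_le zs); exact: ltnW.
Qed.

Definition fcoef j v : R := cint 0 1 (fun x => v x * e j x * W x).

Lemma bessel_id N v : continuous v ->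
  cint 0 1 (fun x => (v x - \sum_(j < N) fcoef j v * e j x) ^+ 2 * W x) =
  cint 0 1 (fun x => v x ^+ 2 * W x) - \sum_(j < N) fcoef j v ^+ 2.
Proof.
move=> cv; pose b (j : 'I_N) := - fcoef j v.
rewrite (@eq_cint _ _ _ _ (fun x => (v x + \sum_(j < N) b j * e j x) ^+ 2 * W x)); last first.
  move=> x _; congr ((_ + _) ^+ 2 * _); rewrite -sumrN.
  by apply: eq_bigr => j _; rewrite mulNr.
rewrite (quad_expand b (fun k : 'I_N => @ce k) cv cW).
under [X in _ + _ + X]eq_bigr do under eq_bigr do rewrite ef_orth -[(_ == _)%:R]mul1r.
rewrite (sum_diag b (fun=> 1)) -addrA; congr (_ + _).
rewrite mulr_sumr -big_split/= -sumrN; apply: eq_bigr => j _.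
by rewrite /b -/(fcoef j v); ring.
Qed.

Lemma bessel_ineq N v : continuous v ->
  \sum_(j < N) fcoef j v ^+ 2 <= cint 0 1 (fun x => v x ^+ 2 * W x).
Proof.
move=> cv; rewrite -subr_ge0 -bessel_id//; apply: cint_ge0 => x _.
by rewrite mulr_ge0 ?sqr_ge0 ?Wt_ge0.
Qed.

(** The remainder of the expansion is orthogonal to the first N eigenfunctions, and removing the
    expansion does not increase the Dirichlet integral. Since s_N tends to infinity, this is
    completeness with a rate. *)
Lemma completeness N v dv : C1 v dv ->
  s N ^+ 2 * cint 0 1 (fun x => (v x - \sum_(j < N) fcoef j v * e j x) ^+ 2 * W x)
   <= cint 0 1 (fun x => dv x ^+ 2 * W x).
Proof.
move=> Cv; have cv := C1_cont Cv; have cdv : continuous dv by case: Cv.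
pose b (j : 'I_N) := - fcoef j v.
have Cr := @C1_sum _ (@nat_of_ord N) b _ _ Cv.
rewrite (@eq_cint _ _ _ _ (fun x => (v x + \sum_(j < N) b j * e j x) ^+ 2 * W x)); last first.
  move=> x _; congr ((_ + _) ^+ 2 * _); rewrite -sumrN.
  by apply: eq_bigr => j _; rewrite mulNr.
apply: (le_trans (rayleigh Cr _)).
  move=> i iN.
  rewrite (@eq_cint _ _ _ _ (fun x => v x * e i x * W x + \sum_(j < N) b j * (e j x * e i x * W x))); last first.
    by move=> x _; rewrite !mulrDl !mulr_suml; congr (_ + _); apply: eq_bigr => j _; ring.
  rewrite cintD; [|by cont..].
  rewrite cint_sum; last by move=> j; cont.
  rewrite (bigD1 (Ordinal iN))//= big1 ?addr0.
    rewrite cintZ; last by cont.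
    by rewrite ef_orth eqxx mulr1 /b/= -/(fcoef i v) subrr.
  move=> j ji; rewrite cintZ; last by cont.
  rewrite ef_orth; case: eqP => [E|_]; last by rewrite mulr0.
  by move: ji; rewrite -(inj_eq val_inj)/= E eqxx.
rewrite (quad_expand b (fun k : 'I_N => @cd k) cdv cW).
under [X in _ + _ + X <= _]eq_bigr do under eq_bigr do rewrite de_orth.
rewrite (sum_diag b (fun i : 'I_N => s i ^+ 2)) -addrA gerDl.
rewrite mulr_sumr -big_split/=; apply: sumr_le0 => j _.
rewrite (@eq_cint _ _ _ _ (fun x => d j x * dv x * W x)); last by move=> x _; ring.
rewrite (ef_ibp j Cv).
rewrite (@eq_cint _ _ _ _ (fun x => v x * e j x * W x)); last by move=> x _; ring.
rewrite -/(fcoef j v) /b.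
have := sqr_ge0 (s j * fcoef j v); rewrite exprMn; lra.
Qed.

End Completeness.

(** * Finite propagation speed *)

Section FiniteSpeed.
Variable R : realType.
Variables (nu : R) (s : nat -> R).
Hypothesis nu_gt : - (1 / 2) < nu.
Hypothesis zs : bessel_zeros nu s.
Implicit Types (x y t k : R) (i j N : nat).

Local Notation W := (Wt nu).
Local Notation e := (ef nu s).
Local Notation d := (de nu s).
Local Notation a := (fcoef nu s).

Let ce j : continuous (e j). Proof. exact: cont_ef. Qed.
Let cd j : continuous (d j). Proof. exact: cont_de. Qed.
Let cW : continuous W. Proof. exact: cont_Wt. Qed.
#[local] Hint Resolve ce cd cW : cont.

Section Energy.
Variables (k : R) (N : nat) (c : nat -> R).
Hypothesis k0 : 0 < k.

Let ph x := expR (2 * k * x).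
Let cph : continuous ph.
Proof. by rewrite -[ph]/(fun x => expR (2 * k * x)); cont. Qed.
#[local] Hint Resolve cph : cont.

Let Aij i j := cint 0 1 (fun x => e i x * e j x * (ph x * W x)).
Let Bij i j := cint 0 1 (fun x => d i x * d j x * (ph x * W x)).
Let Dij i j := cint 0 1 (fun x => d i x * e j x * (ph x * W x)).

Let isd_ph x : isd ph x (2 * k * ph x).
Proof.
apply: isd_eq.
  by apply: (@isd_comp _ (@expR R) (fun x => 2 * k * x)); [exact: isd_exp|apply: isdZ; exact: isdI].
by rewrite /= mulr1 mulrC.
Qed.

(** The equation for [e i] tested against [ph * e j]; the term with [Dij] comes from differentiating
    the exponential weight. *)
Let BAD i j : Bij i j = s i ^+ 2 * Aij i j - 2 * k * Dij i j.
Proof.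
have C : C1 (fun x => ph x * e j x) (fun x => 2 * k * ph x * e j x + ph x * d j x).
  split.
  - by move=> x; apply: isdM; [exact: isd_ph|exact: isd_ef].
  - by cont.
  - by rewrite ef1// mulr0.
have := ef_ibp s nu_gt i C.
rewrite /Aij /Bij /Dij => H.
have -> : cint 0 1 (fun x => e i x * e j x * (ph x * W x)) =
    cint 0 1 (fun x => e i x * (ph x * e j x) * W x).
  by apply: eq_cint => x _; ring.
rewrite -H; apply/eqP; rewrite eq_sym subr_eq; apply/eqP.
rewrite -cintZ; last by cont.
rewrite -cintD; [|by cont..].
by apply: eq_cint => x _; ring.
Qed.

Let Bsym i j : Bij i j = Bij j i.
Proof. by apply: eq_cint => x _; ring. Qed.

Let Asym i j : Aij i j = Aij j i.
Proof. by apply: eq_cint => x _; ring. Qed.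

Let C t j := c j * cos (t * s j).
Let S t j := c j * (sin (t * s j) / s j).

Let isd_C t j : isd (fun t => C t j) t (- (s j ^+ 2 * S t j)).
Proof.
apply: isd_eq.
  apply: isdZ; apply: (@isd_comp _ (@cos R) (fun t => t * s j)); first exact: isd_cos.
  by apply: isdM; [exact: isdI|exact: isdC].
rewrite /= /S; move: (s_neq0 zs j) (sin _) => s0 w.
by field.
Qed.

Let isd_S t j : isd (fun t => S t j) t (C t j).
Proof.
apply: isd_eq.
  apply: isdZ; apply: isdM; last exact: isdC.
  apply: (@isd_comp _ (@sin R) (fun t => t * s j)); first exact: isd_sin.
  by apply: isdM; [exact: isdI|exact: isdC].
rewrite /= /C; move: (s_neq0 zs j) (cos _) => s0 w.
by field.
Qed.

(** The weighted energy of z(t) = sum of [S t j] e_j, a solution of the wave equation with z(0) = 0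
    whose time derivative is the cosine sum: the terms with [Aij] form z_t^2 and those with [Bij]
    form z_x^2. *)
Let En t := \sum_(i < N) \sum_(j < N) (C t i * C t j * Aij i j + S t i * S t j * Bij i j).
Let dEn t := \sum_(i < N) \sum_(j < N)
  ((- (s i ^+ 2 * S t i) * C t j + C t i * - (s j ^+ 2 * S t j)) * Aij i j +
   (C t i * S t j + S t i * C t j) * Bij i j).

Let isd_En t : isd En t (dEn t).
Proof.
apply: isd_sum => i; apply: isd_sum => j.
have sM p (f g : R -> R) (f' g' : R) : isd f t f' -> isd g t g' ->
    isd (fun t => f t * g t * p) t ((f' * g t + f t * g') * p).
  move=> hf hg; apply: isd_eq.
    by apply: isdM; [apply: isdM; [exact: hf|exact: hg]|exact: isdC].
  by rewrite /= mulr0 addr0.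
by apply: isdD; apply: sM; do ?exact: isd_C; exact: isd_S.
Qed.

Let sq_id t (u : R -> nat -> R) (f1 : nat -> R -> R) :
  (forall j, continuous (f1 j)) ->
  \sum_(i < N) \sum_(j < N) u t i * u t j * cint 0 1 (fun x => f1 i x * f1 j x * (ph x * W x)) =
  cint 0 1 (fun x => (\sum_(i < N) u t i * f1 i x) ^+ 2 * (ph x * W x)).
Proof.
move=> cf; have cPW : continuous (fun x => ph x * W x) by cont.
have := quad_expand (fun i : 'I_N => u t i) (fun i : 'I_N => cf i) (@contC _ 0) cPW.
rewrite [in X in _ = X]big1 ?mulr0; last first.
  move=> i _; rewrite (@eq_cint _ _ _ _ (fun=> 0 * 0)) ?cintZ ?mul0r ?mulr0//.
    exact: contC.
  by move=> x _; rewrite !mul0r.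
rewrite (@eq_cint _ _ _ (fun x => 0 ^+ 2 * _) (fun=> 0 * 0)); last first.
  by move=> x _; rewrite expr0n/= !mul0r.
rewrite cintZ ?mul0r ?add0r; last exact: contC.
move=> <-; apply: eq_cint => x _; by rewrite add0r.
Qed.

Let dEn_le t : dEn t <= 2 * k * En t.
Proof.
rewrite -subr_ge0.
have cf i : continuous (fun x => C t i * e i x + S t i * d i x) by cont.
(* By [BAD] this difference is 2 k times the weighted integral of (z_t + z_x)^2. Its sign expresses
   that the speed is at most 1. *)
have -> : 2 * k * En t - dEn t = 2 * k * \sum_(i < N) \sum_(j < N)
  1 * 1 * cint 0 1 (fun x => (C t i * e i x + S t i * d i x) *
       (C t j * e j x + S t j * d j x) * (ph x * W x)).
  rewrite /En /dEn !mulr_sumr -sumrB; apply: eq_bigr => i _.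
  rewrite !mulr_sumr -sumrB; apply: eq_bigr => j _.
  rewrite (@eq_cint _ _ _ _ (fun x =>
     C t i * C t j * (e i x * e j x * (ph x * W x)) +
     C t i * S t j * (d j x * e i x * (ph x * W x)) +
     S t i * C t j * (d i x * e j x * (ph x * W x)) +
     S t i * S t j * (d i x * d j x * (ph x * W x)))); last by move=> x _; ring.
  rewrite !cintD; [|by cont..].
  rewrite !cintZ; [|by cont..].
  rewrite -/(Aij i j) -/(Bij i j) -/(Dij i j) -/(Dij j i).
  have E1 := BAD i j; have E2 := BAD j i; rewrite -Bsym -Asym in E2.
  move: E1 E2; move: (Aij i j) (Bij i j) (Dij i j) (Dij j i) => A B D1 D2 E1 E2.
  move: (C t i) (C t j) (S t i) (S t j) (s i) (s j) E1 E2 => p q r w m n E1 E2.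
  have D1E : 2 * k * D1 = m ^+ 2 * A - B by rewrite E1; ring.
  have D2E : 2 * k * D2 = n ^+ 2 * A - B by rewrite E2; ring.
  rewrite !mul1r !mulrDr.
  have -> : 2 * k * (p * w * D2) = p * w * (2 * k * D2) by ring.
  have -> : 2 * k * (r * q * D1) = r * q * (2 * k * D1) by ring.
  by rewrite D1E D2E; ring.
rewrite (@sq_id t (fun _ _ => 1) (fun i x => C t i * e i x + S t i * d i x) cf).
rewrite mulr_ge0//; first by rewrite mulr_ge0// ltW.
by apply: cint_ge0 => x _; rewrite mulr_ge0 ?sqr_ge0// mulr_ge0 ?expR_ge0 ?Wt_ge0.
Qed.

(** Gronwall's inequality for [En]. The sine part vanishes at time 0, so the initial energy is the
    norm on the right; at time t the nonnegative gradient part is dropped. *)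
Lemma wave_energy t : 0 <= t ->
  cint 0 1 (fun x => (\sum_(i < N) c i * cos (t * s i) * e i x) ^+ 2 * (expR (2 * k * x) * W x))
  <= expR (2 * k * t) *
  cint 0 1 (fun x => (\sum_(i < N) c i * e i x) ^+ 2 * (expR (2 * k * x) * W x)).
Proof.
move=> t0.
have H : En t * expR (- (2 * k * t)) <= En 0 * expR (- (2 * k * 0)).
  apply: (@isd_ge _ (fun t => En t * expR (- (2 * k * t)))
    (fun t => (dEn t - 2 * k * En t) * expR (- (2 * k * t))) _ _ t0).
    move=> x _; apply: isd_eq.
      apply: isdM; first exact: isd_En.
      apply: (@isd_comp _ (@expR R) (fun t => - (2 * k * t))); first exact: isd_exp.
      by apply: isdN; apply: isdZ; exact: isdI.
    by rewrite /=; ring.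
  by move=> x _; rewrite pmulr_lle0 ?expR_gt0// subr_le0 dEn_le.
rewrite mulr0 oppr0 expR0 mulr1 expRN ler_pdivrMr ?expR_gt0// mulrC in H.
have E0 : En 0 = cint 0 1 (fun x => (\sum_(i < N) c i * e i x) ^+ 2 * (ph x * W x)).
  rewrite -(@sq_id 0 (fun _ => c) e ce); apply: eq_bigr => i _.
  by apply: eq_bigr => j _; rewrite /C /S !mul0r sin0 cos0 !mul0r !mulr0 !mulr1 !mul0r addr0.
rewrite E0 in H; apply: le_trans H.
have -> : En t = (\sum_(i < N) \sum_(j < N) C t i * C t j * Aij i j) +
   (\sum_(i < N) \sum_(j < N) S t i * S t j * Bij i j).
  by rewrite -big_split/=; apply: eq_bigr => i _; rewrite -big_split.
rewrite (@sq_id t C e ce) (@sq_id t S d cd) lerDl.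
by apply: cint_ge0 => x _; rewrite mulr_ge0 ?sqr_ge0// mulr_ge0 ?expR_ge0 ?Wt_ge0.
Qed.

End Energy.

(** Cauchy-Schwarz with the weight [ph] on one factor and its inverse on the other, in Young's form:
    the free parameter [l] is chosen later to balance the two terms. *)
Lemma pairing_le (V g ph : R -> R) l : continuous V -> continuous g -> continuous ph ->
  (forall x, 0 < ph x) -> 0 < l ->
  2 * `|cint 0 1 (fun x => V x * g x * W x)| <=
   l * cint 0 1 (fun x => V x ^+ 2 * (ph x * W x)) +
   l^-1 * cint 0 1 (fun x => g x ^+ 2 * ((ph x)^-1 * W x)).
Proof.
move=> cV cg cp p0 l0.
have cpi : continuous (fun x => (ph x)^-1).
  by move=> x; apply: cvgV; [rewrite gt_eqF|exact: cp].
have c1 : continuous (fun x => V x ^+ 2 * (ph x * W x)) by cont.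
have c2 : continuous (fun x => g x ^+ 2 * ((ph x)^-1 * W x)) by cont.
have c3 : continuous (fun x => V x * g x * W x) by cont.
rewrite -cintZ// -(cintZ _ _ _ c2) -cintD; [|by cont..].
have key (sg : R) x : sg ^+ 2 = 1 ->
   2 * (sg * (V x * g x * W x)) <=
   l * (V x ^+ 2 * (ph x * W x)) + l^-1 * (g x ^+ 2 * ((ph x)^-1 * W x)).
  move=> sg2; rewrite -subr_ge0.
  have -> : l * (V x ^+ 2 * (ph x * W x)) + l^-1 * (g x ^+ 2 * ((ph x)^-1 * W x)) -
    2 * (sg * (V x * g x * W x)) = (V x * sg * l * ph x - g x) ^+ 2 * (l^-1 * (ph x)^-1 * W x)
     + (1 - sg ^+ 2) * (l * V x ^+ 2 * ph x * W x).
    by have := p0 x; move: (ph x) (V x) (g x) (W x) => p v q w pp; field; rewrite !gt_eqF.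
  rewrite sg2 subrr mul0r addr0; apply: mulr_ge0; first exact: sqr_ge0.
  apply: mulr_ge0; last exact: Wt_ge0.
  by apply: mulr_ge0; rewrite invr_ge0 ltW.
have [i0|i0] := leP 0 (cint 0 1 (fun x => V x * g x * W x)).
  rewrite ger0_norm// -cintZ//; apply: le_cint; [by cont..|].
  by move=> x _; have := key 1 x; rewrite mul1r expr1n => /(_ erefl).
rewrite ltr0_norm// -cintN// -cintZ; last by cont.
apply: le_cint; [by cont..|].
by move=> x _; have := key (-1) x; rewrite mulN1r sqrrN expr1n => /(_ erefl).
Qed.

Lemma s_ge_linear : exists2 g : R, 0 < g & forall i j, (i <= j)%N -> (j - i)%:R * g <= s j - s i.
Proof.
have [g g0 sg] := s_spacing nu_gt zs; exists g => // i j; move=> /subnK => <-.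
elim: (j - i)%N => [|n ih]; first by rewrite add0n subnn mul0r subrr.
rewrite addSn; move: ih; rewrite -addSn !addnK -natr1 addSn => ih.
by have := sg (n + i)%N; rewrite mulrDl mul1r; lra.
Qed.

Lemma inv_s_sq_cvg0 : (s N ^+ 2)^-1 @[N --> \oo] --> (0 : R).
Proof.
have [g g0 sg] := s_ge_linear.
apply: (@squeeze_cvgr _ _ _ _ (fun=> 0) (fun N => (g ^+ 2)^-1 * (harmonic N * (N.+1%:R / N%:R) ^+ 2))).
- near=> N; rewrite invr_ge0 sqr_ge0/=.
  have N0 : (0 < N)%N by near: N; exists 1%N.
  have Nr : 0 < N%:R :> R by rewrite ltr0n.
  have sN : N%:R * g <= s N.
    by have := sg 0%N N (leq0n N); rewrite subn0; have := s_gt0 zs 0; lra.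
  apply: (@le_trans _ _ (((N%:R * g) ^+ 2)^-1)).
    rewrite lef_pV2 ?posrE ?exprn_gt0 ?mulr_gt0 ?s_gt0 ?(s_gt0 zs)//.
    by rewrite lerXn2r ?nnegrE ?mulr_ge0 ?(ltW g0) ?(ltW Nr) ?(ltW (s_gt0 zs _)).
  rewrite exprMn invfM [leLHS]mulrC ler_pM2l ?invr_gt0 ?exprn_gt0//=.
  have -> : N.+1%:R^-1 * (N.+1%:R / N%:R) ^+ 2 = N.+1%:R * (N%:R ^+ 2)^-1 :> R.
    by field; rewrite gt_eqF//=; rewrite -natr1 gt_eqF// addr_gt0.
  by rewrite ler_peMl ?invr_ge0 ?sqr_ge0// ler1n.
- exact: cvg_cst.
- rewrite -[X in _ --> X](mulr0 (g ^+ 2)^-1); apply: cvgMr.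
  apply: (@squeeze_cvgr _ _ _ _ (fun=> 0) (fun N => 4 * harmonic N)).
  + near=> N; have N0 : (0 < N)%N by near: N; exists 1%N.
    have Nr : 0 < N%:R :> R by rewrite ltr0n.
    rewrite mulr_ge0 ?sqr_ge0 ?invr_ge0//= [leLHS]mulrC.
    rewrite ler_wpM2r ?invr_ge0//.
    have -> : 4 = 2 ^+ 2 :> R by rewrite expr2 -natrM.
    rewrite lerXn2r ?nnegrE ?divr_ge0// ler_pdivrMr// -natr1.
    by have : 1 <= N%:R :> R by [rewrite ler1n]; lra.
  + exact: cvg_cst.
  + by rewrite -[X in _ --> X](mulr0 4); apply: cvgMr; exact: cvg_harmonic.
Unshelve. all: by end_near. Qed.

(* The weight exp(2kx) amplifies g by exp(k xg) but h only by exp(k (xh + |t|));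
   let N and then k tend to infinity. *)
Lemma finite_speed (h dh g : R -> R) (xh xg t : R) : C1 h dh -> continuous g ->
  (forall x, 0 <= x <= 1 -> xh < x -> h x = 0) ->
  (forall x, 0 <= x <= 1 -> x < xg -> g x = 0) ->
  `|t| < xg - xh ->
  \sum_(j < N) cos (t * s j) * (a j h * a j g) @[N --> \oo] --> (0 : R).
Proof.
wlog t0 : t / 0 <= t.
  move=> H; have [t0|t0] := leP 0 t; first exact: H.
  move=> Ch cg hx gx tx.
  have tn : 0 <= - t by rewrite oppr_ge0 ltW.
  have := H (- t) tn Ch cg hx gx; rewrite normrN => /(_ tx).
  apply: cvg_trans; apply: near_eq_cvg; apply: nearW => N.
  by apply: eq_bigr => j _; rewrite mulNr cosN.
move=> Ch cg hx gx; rewrite (ger0_norm t0) => tx.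
have ch := C1_cont Ch; have cdh : continuous dh by case: Ch.
set eta := xg - xh - t; have eta0 : 0 < eta by rewrite /eta; lra.
pose H := cint 0 1 (fun x => h x ^+ 2 * W x).
pose G := cint 0 1 (fun x => g x ^+ 2 * W x).
pose dH := cint 0 1 (fun x => dh x ^+ 2 * W x).
have H0 : 0 <= H by apply: cint_ge0 => x _; rewrite mulr_ge0 ?sqr_ge0 ?Wt_ge0.
have G0 : 0 <= G by apply: cint_ge0 => x _; rewrite mulr_ge0 ?sqr_ge0 ?Wt_ge0.
have main k N : 0 < k ->
   `|\sum_(j < N) cos (t * s j) * (a j h * a j g)| <=
   expR (- (k * eta)) * (H + G) + expR (k * (2 + t - xg - xh)) * (dH * (s N ^+ 2)^-1).
  move=> k0.
  pose V x := \sum_(i < N) a i h * cos (t * s i) * e i x.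
  have cV : continuous V by rewrite -[V]/(fun x => \sum_(i < N) a i h * cos (t * s i) * e i x); cont.
  have -> : \sum_(j < N) cos (t * s j) * (a j h * a j g) = cint 0 1 (fun x => V x * g x * W x).
    rewrite (@eq_cint _ _ _ _ (fun x => \sum_(i < N) a i h * cos (t * s i) * (g x * e i x * W x))); last first.
      by move=> x _; rewrite /V !mulr_suml; apply: eq_bigr => i _; ring.
    rewrite cint_sum; last by move=> i; cont.
    apply: eq_bigr => i _; rewrite cintZ; last by cont.
    by rewrite -/(fcoef nu s i g); ring.
  pose ph x := expR (2 * k * x).
  have cph : continuous ph by rewrite -[ph]/(fun x => expR (2 * k * x)); cont.
  (* This choice gives the contribution of [h] itself and that of [g] the same factor exp(-k
     eta). *)
  pose l := expR (- (k * (xg + xh + t))).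
  have l0 : 0 < l by exact: expR_gt0.
  have := pairing_le cV cg cph (fun x => expR_gt0 _) l0.
  have We := wave_energy N (fun j => a j h) k0 t0; rewrite -/(V) in We.
  have gphi : cint 0 1 (fun x => g x ^+ 2 * ((ph x)^-1 * W x)) <= expR (- (2 * k * xg)) * G.
    have cpi : continuous (fun x => (ph x)^-1).
      by move=> x; apply: cvgV; [rewrite gt_eqF// expR_gt0|exact: cph].
    rewrite /G -cintZ; last by cont.
    apply: le_cint; [by cont..|] => x x01.
    have [xx|xx] := ltP x xg; first by rewrite gx// expr0n/= !mul0r mulr0.
    have gw : 0 <= g x ^+ 2 * W x by apply: mulr_ge0; [exact: sqr_ge0|exact: Wt_ge0].
    rewrite mulrCA ler_wpM2r//.
    by rewrite /ph -expRN ler_expR lerN2 ler_wpM2l// mulr_ge0// ltW.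
  (* The truncated expansion is [h], where the weight is at most exp(2 k xh) on the support, plus an
     error spread over all of [0, 1], where only exp(2 k) is available but [completeness] gives
     smallness in N. *)
  have hphi : cint 0 1 (fun x => (\sum_(i < N) a i h * e i x) ^+ 2 * (expR (2 * k * x) * W x))
     <= 2 * (expR (2 * k * xh) * H) + 2 * (expR (2 * k) * (dH * (s N ^+ 2)^-1)).
    have cmp := completeness nu_gt zs N Ch; rewrite -/dH in cmp.
    set eps := cint 0 1 _ in cmp.
    have epsle : eps <= dH * (s N ^+ 2)^-1.
      by rewrite ler_pdivlMr ?exprn_gt0 ?(s_gt0 zs)// mulrC.
    apply: (@le_trans _ _ (2 * (expR (2 * k * xh) * H) + 2 * (expR (2 * k) * eps))); last first.
      by rewrite lerD2l ler_pM2l// ler_pM2l ?expR_gt0.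
    rewrite /H /eps -!cintZ; [|by cont..].
    rewrite -cintD; [|by cont..].
    apply: le_cint; [by cont..|] => x x01.
    move: (\sum_(i < N) _) => P.
    have e1 : expR (2 * k * x) <= expR (2 * k).
      by rewrite ler_expR; case/andP: x01 => ? ?; rewrite ler_piMr// mulr_ge0// ltW.
    have hE : expR (2 * k * x) * h x ^+ 2 <= expR (2 * k * xh) * h x ^+ 2.
      have [xx|xx] := ltP xh x; first by rewrite hx// expr0n/= !mulr0.
      by rewrite ler_wpM2r ?sqr_ge0// ler_expR ler_wpM2l// mulr_ge0// ltW.
    have dE : expR (2 * k * x) * (h x - P) ^+ 2 <= expR (2 * k) * (h x - P) ^+ 2.
      by rewrite ler_wpM2r ?sqr_ge0.
    have PP : P ^+ 2 <= 2 * h x ^+ 2 + 2 * (h x - P) ^+ 2.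
      by rewrite -subr_ge0 [leRHS](_ : _ = (2 * h x - P) ^+ 2) ?sqr_ge0//; ring.
    rewrite [leLHS]mulrA [leRHS](_ : _ = (2 * (expR (2 * k * xh) * h x ^+ 2) +
       2 * (expR (2 * k) * (h x - P) ^+ 2)) * W x); last by ring.
    rewrite ler_wpM2r ?Wt_ge0// mulrC.
    have := ler_wpM2l (expR_ge0 (2 * k * x)) PP; rewrite mulrDr; lra.
  move=> pl.
  have p1 : cint 0 1 (fun x => V x ^+ 2 * (ph x * W x)) <= expR (2 * k * t) *
      (2 * (expR (2 * k * xh) * H) + 2 * (expR (2 * k) * (dH * (s N ^+ 2)^-1))).
    by apply: (le_trans We); rewrite ler_pM2l ?expR_gt0.
  have lV : l^-1 = expR (k * (xg + xh + t)) by rewrite /l expRN invrK.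
  have li0 : 0 <= l^-1 by rewrite invr_ge0 ltW.
  have := le_trans pl (lerD (ler_wpM2l (ltW l0) p1) (ler_wpM2l li0 gphi)).
  set q := dH * _.
  have -> : l * (expR (2 * k * t) * (2 * (expR (2 * k * xh) * H) + 2 * (expR (2 * k) * q)))
    = 2 * (l * expR (2 * k * t) * expR (2 * k * xh)) * H +
      2 * (l * expR (2 * k * t) * expR (2 * k)) * q by ring.
  rewrite [l^-1 * (_ * G)]mulrA lV /l -!expRD.
  have -> : - (k * (xg + xh + t)) + 2 * k * t + 2 * k * xh = - (k * eta) by rewrite /eta; ring.
  have -> : k * (xg + xh + t) + - (2 * k * xg) = - (k * eta) by rewrite /eta; ring.
  have -> : - (k * (xg + xh + t)) + 2 * k * t + 2 * k = k * (2 + t - xg - xh) by ring.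
  have := mulr_ge0 (expR_ge0 (- (k * eta))) G0.
  move: (expR _) (expR _) => A B.
  move: `|cint 0 1 _| => w; rewrite mulrDr; lra.
apply/cvgrPdist_le => ep ep0.
(* Large enough that exp(x) >= 1 + x already puts the first term of [main] below ep / 2. *)
pose k := (2 * (H + G) / ep + 1) / eta.
have HG : 0 <= H + G by rewrite addr_ge0.
have k0 : 0 < k by rewrite /k divr_gt0// ltr_wpDl// divr_ge0 ?(ltW ep0)// mulr_ge0.
have kE : k * eta = 2 * (H + G) / ep + 1 by rewrite /k divfK// gt_eqF.
have small : expR (- (k * eta)) * (H + G) <= ep / 2.
  rewrite expRN mulrC ler_pdivrMr ?expR_gt0//.
  apply: (@le_trans _ _ (ep / 2 * (1 + k * eta))).
    rewrite kE.
    have -> : ep / 2 * (1 + (2 * (H + G) / ep + 1)) = (H + G) + ep by field; rewrite gt_eqF.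
    by rewrite lerDl ltW.
  by rewrite ler_pM2l ?divr_gt0// expR_ge1Dx.
have lim : expR (k * (2 + t - xg - xh)) * (dH * (s N ^+ 2)^-1) @[N --> \oo] --> (0 : R).
  rewrite -[X in _ --> X](mulr0 (expR (k * (2 + t - xg - xh)))); apply: cvgMr.
  by rewrite -[X in _ --> X](mulr0 dH); apply: cvgMr; exact: inv_s_sq_cvg0.
have ep2 : 0 < ep / 2 by rewrite divr_gt0.
move/cvgrPdist_le : lim => /(_ _ ep2) lim.
near=> N; rewrite sub0r normrN.
have h1 : `|0 - expR (k * (2 + t - xg - xh)) * (dH * (s N ^+ 2)^-1)| <= ep / 2 by near: N.
rewrite sub0r normrN in h1; have := ler_norm (expR (k * (2 + t - xg - xh)) * (dH * (s N ^+ 2)^-1)).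
have := main k N k0; lra.
Unshelve. all: by end_near. Qed.

End FiniteSpeed.

(** * Band-limited approximation of the multiplier *)

Section Sinc.
Variable R : realType.
Implicit Types (x y u v t : R).

Lemma isd_lip (F f : R -> R) a b B : (forall x, a <= x <= b -> isd F x (f x)) ->
  (forall x, a <= x <= b -> `|f x| <= B) ->
  forall x y, a <= x <= b -> a <= y <= b -> `|F x - F y| <= B * `|x - y|.
Proof.
move=> dF fB.
have H x y : a <= x <= b -> a <= y <= b -> x < y -> `|F x - F y| <= B * `|x - y|.
  move=> /andP[ax xb] /andP[ay yb] xy.
  have [|c /andP[xc cy] E] := @isd_MVT _ F f x y xy.
    by move=> z /andP[xz zy]; apply: dF; rewrite (le_trans ax xz) (le_trans zy yb).
  rewrite distrC [X in _ * X]distrC E normrM ler_wpM2r//.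
  by apply: fB; rewrite (le_trans ax (ltW xc)) (le_trans (ltW cy) yb).
move=> x y xab yab; case: (ltgtP x y) => [xy|yx|->].
- exact: H.
- by rewrite distrC [X in _ * X]distrC; exact: H.
- by rewrite !subrr normr0 mulr0.
Qed.

Lemma cos_lip x y : `|cos x - cos y| <= `|x - y|.
Proof.
rewrite -[leRHS]mul1r.
apply: (@isd_lip _ (fun x => - sin x) (Num.min x y) (Num.max x y) 1).
- by move=> z _; exact: isd_cos.
- by move=> z _; rewrite normrN; exact: sin_max.
- by rewrite ge_min le_max !lexx.
- by rewrite ge_min le_max !lexx !orbT.
Qed.

(* Equal to sin u / u for u <> 0; the integral form needs no special case at 0. *)
Definition sinc u : R := cint 0 1 (fun t => cos (t * u)).

Let cc u : continuous (fun t : R => cos (t * u)).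
Proof. by cont. Qed.

Lemma sinc_lip u v : `|sinc u - sinc v| <= `|u - v|.
Proof.
rewrite /sinc -cintB//; apply: (le_trans (cint_norm _ _ _)); first by cont.
have -> : `|u - v| = cint 0 1 (fun=> `|u - v|) by rewrite cint_cst// subr0 mulr1.
apply: le_cint; [by cont|by cont|] => t /andP[t0 t1].
apply: (le_trans (cos_lip _ _)); rewrite -mulrBr normrM ger0_norm//.
by rewrite ler_piMl.
Qed.

Lemma cont_sinc : continuous sinc.
Proof.
move=> u; apply/cvgrPdist_le => e e0; near=> v.
apply: (le_trans (sinc_lip _ _)); near: v.
exact: cvgr_dist_le.
Unshelve. all: by end_near. Qed.

Lemma sinc_le1 u : `|sinc u| <= 1.
Proof.
apply: (le_trans (cint_norm _ _ (@cc u))).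
rewrite [leRHS](_ : 1 = cint 0 1 (fun=> 1 : R)); last by rewrite cint_cst// subr0 mulr1.
by apply: le_cint; [by cont|by cont|move=> t _; exact: cos_max].
Qed.

Lemma sincM u : u * sinc u = sin u.
Proof.
rewrite /sinc -cintZ//.
rewrite (@cint_primitive _ 0 1 _ (fun t => sin (t * u)) ler01); first by rewrite mul1r mul0r sin0 subr0.
  by cont.
move=> t _; apply: isd_eq.
  apply: (@isd_comp _ (@sin R) (fun t => t * u)); first exact: isd_sin.
  by apply: isdM; [exact: isdI|exact: isdC].
by rewrite /= mulr0 addr0 mul1r mulrC.
Qed.

Lemma sinc_decay u : `|sinc u| * (1 + `|u|) <= 2.
Proof.
rewrite mulrDr mulr1 -normrM mulrC sincM.
by have := sinc_le1 u; have := sin_max u; lra.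
Qed.

Lemma sinc_ge u : `|u| <= 2^-1 -> 2^-1 <= sinc u.
Proof.
move=> u2; have -> : 2^-1 = cint 0 1 (fun=> 2^-1 : R) by rewrite cint_cst// subr0 mulr1.
apply: le_cint; [by cont|by cont|] => t /andP[t0 t1].
have := cos_lip (t * u) 0; rewrite cos0 subr0 normrM ger0_norm// => h.
have := ler_piMl (normr_ge0 u) t1; move: h; rewrite ler_norml => /andP[h _]; lra.
Qed.

(** M + 2 of the m factors are used: M cancel the growth and two leave an integrable decay; the
    others are bounded by 1. *)
Lemma sinc_pow_bound (m M : nat) v : (M + 2 <= m)%N ->
  `|sinc v| ^+ m * (1 + `|v|) ^+ M <= 2 ^+ m * (1 + v ^+ 2)^-1.
Proof.
move=> Mm; have p0 : 0 < 1 + `|v| by rewrite ltr_pwDl.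
have p1 : 1 <= 1 + `|v| by rewrite lerDl.
rewrite ler_pdivlMr; last by rewrite ltr_pwDl// sqr_ge0.
apply: (@le_trans _ _ (`|sinc v| ^+ m * (1 + `|v|) ^+ M * (1 + `|v|) ^+ 2)).
  have h0 : 0 <= `|sinc v| ^+ m * (1 + `|v|) ^+ M.
    by apply: mulr_ge0; [exact: exprn_ge0|apply: exprn_ge0; exact: ltW].
  apply: ler_wpM2l => //.
  by rewrite -[v ^+ 2]real_normK ?num_real// sqrrD expr1n; have := normr_ge0 v; lra.
rewrite -mulrA -exprD -[in X in X <= _](subnK Mm) addnC exprD.
rewrite [X in X <= _](_ : _ = (`|sinc v| * (1 + `|v|)) ^+ (M + 2) * `|sinc v| ^+ (m - (M + 2))); last first.
  by rewrite exprMn; ring.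
have -> : 2 ^+ m = 2 ^+ (M + 2) * 2 ^+ (m - (M + 2)) :> R by rewrite -exprD subnKC.
apply: ler_pM.
- by rewrite exprn_ge0// mulr_ge0// ltW.
- by rewrite exprn_ge0.
- by rewrite lerXn2r ?nnegrE ?mulr_ge0 ?(ltW p0)// sinc_decay.
- apply: (@le_trans _ _ 1); first by rewrite exprn_ile1// sinc_le1.
  by rewrite exprn_ege1// ler1n.
Qed.

End Sinc.

(** * Vanishing of spectral sums for band-limited functions *)

Section BandLimited.
Variable R : realType.
Variables (T : R) (s c : nat -> R).
Implicit Types (a b w th : R).

Definition LE N (F : R -> R) : R := \sum_(j < N) c j * (F (s j) + F (- s j)).

Hypothesis small : forall t, `|t| < T -> \sum_(j < N) cos (t * s j) * c j @[N --> \oo] --> (0 : R).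
Variable B : R.
Hypothesis cB : forall N, \sum_(j < N) `|c j| <= B.

Lemma LE_bound N F M : (forall x, `|F x| <= M) -> `|LE N F| <= 2 * M * B.
Proof.
move=> FM; have M0 : 0 <= M by apply: le_trans (FM 0).
apply: (le_trans (ler_norm_sum _ _ _)).
apply: (@le_trans _ _ (2 * M * \sum_(j < N) `|c j|)); last by rewrite ler_wpM2l// mulr_ge0.
rewrite mulr_sumr; apply: ler_sum => j _; rewrite normrM mulrC ler_wpM2r//.
by apply: (le_trans (ler_normD _ _)); have := FM (s j); have := FM (- s j); lra.
Qed.

(* Multiplication by F enlarges the frequency support by at most d. *)
Definition band d (F : R -> R) := (forall x, `|F x| <= 1) /\
  forall a th, `|a| + d < T -> LE N (fun x => F x * cos (a * x + th)) @[N --> \oo] --> (0 : R).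

Lemma band1 : band 0 (fun=> 1).
Proof.
split=> [x|a th]; first by rewrite normr1.
rewrite addr0 => aT.
have H : 2 * cos th * \sum_(j < N) cos (a * s j) * c j @[N --> \oo] --> (0 : R).
  by rewrite -[X in _ --> X](mulr0 (2 * cos th)); apply: cvgMr; exact: small.
apply: cvg_trans H; apply: near_eq_cvg; apply: nearW => N.
rewrite /LE mulr_sumr; apply: eq_bigr => j _.
by rewrite mulrN !cosD cosN sinN; ring.
Qed.

(** By definition [sinc (b * (x - w))] is an average over t in [0, 1] of cosines of frequency t b.
    The product formula shifts the frequency [a] by at most b either way, and dominated convergence
    moves the limit inside the average. *)
Lemma band_sinc d b w F : 0 <= b -> band d F -> band (b + d) (fun x => F x * sinc (b * (x - w))).
Proof.
move=> b0 [F1 bF]; split=> [x|a th aT].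
  by rewrite normrM mulr_ile1// ?F1// sinc_le1.
pose G t x := F x * cos (t * (b * (x - w))) * cos (a * x + th).
have cG x : continuous (fun t => G t x) by rewrite /G; cont.
have K x : cint 0 1 (fun t => G t x) = F x * sinc (b * (x - w)) * cos (a * x + th).
  transitivity (cint 0 1 (fun t => F x * cos (a * x + th) * cos (t * (b * (x - w))))).
    by apply: eq_cint => t _; rewrite /G; ring.
  by rewrite cintZ /sinc; [ring|cont].
have cGG j : continuous (fun t => c j * (G t (s j) + G t (- s j))).
  by apply: contM; [exact: contC|apply: contD; exact: cG].
have E N : LE N (fun x => F x * sinc (b * (x - w)) * cos (a * x + th)) = cint 0 1 (fun t => LE N (G t)).
  rewrite /LE cint_sum; last exact: cGG.
  apply: eq_bigr => j _; rewrite cintZ; last by apply: contD; exact: cG.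
  by rewrite cintD ?K//; exact: cG.
under eq_fun do rewrite E.
apply: (@cint_cvg0 _ 0 1 (fun N t => LE N (G t)) (2 * 1 * B)).
- by move=> N; apply: cont_sum => j; exact: cGG.
- move=> N t _; apply: LE_bound => x; rewrite /G !normrM.
  by rewrite mulr_ile1// ?mulr_ile1// ?F1 ?cos_max// mulr_ge0.
- move=> t /andP[t0 t1].
  have tb : `|t * b| <= b by rewrite ger0_norm ?mulr_ge0// ler_piMl.
  have H1 := bF (a + t * b) (th - t * b * w).
  have H2 := bF (a - t * b) (th + t * b * w).
  have {}H1 : LE N (fun x => F x * cos ((a + t * b) * x + (th - t * b * w))) @[N --> \oo] --> (0 : R).
    by apply: H1; have := ler_normD a (t * b); lra.
  have {}H2 : LE N (fun x => F x * cos ((a - t * b) * x + (th + t * b * w))) @[N --> \oo] --> (0 : R).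
    by apply: H2; have := ler_normB a (t * b); lra.
  have H3 := cvgD H1 H2; rewrite addr0 in H3.
  have H4 : 2^-1 * (LE N (fun x => F x * cos ((a + t * b) * x + (th - t * b * w))) +
     LE N (fun x => F x * cos ((a - t * b) * x + (th + t * b * w)))) @[N --> \oo] --> (0 : R).
    by rewrite -[X in _ --> X](mulr0 2^-1); apply: cvgMr; exact: H3.
  apply: cvg_trans H4; apply: near_eq_cvg; apply: nearW => N.
  rewrite /LE -big_split mulr_sumr; apply: eq_bigr => j _ /=; rewrite /G.
  have key x : cos (t * (b * (x - w))) * cos (a * x + th) =
     2^-1 * (cos ((a + t * b) * x + (th - t * b * w)) + cos ((a - t * b) * x + (th + t * b * w))).
    have -> : (a + t * b) * x + (th - t * b * w) = (a * x + th) + t * (b * (x - w)) by ring.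
    have -> : (a - t * b) * x + (th + t * b * w) = (a * x + th) - t * (b * (x - w)) by ring.
    by move: (a * x + th) (t * (b * (x - w))) => p q; rewrite cosB cosD; field.
  have key2 x : F x * cos (t * (b * (x - w))) * cos (a * x + th) =
     2^-1 * (F x * cos ((a + t * b) * x + (th - t * b * w)) + F x * cos ((a - t * b) * x + (th + t * b * w))).
    by rewrite -[LHS]mulrA key; ring.
  by rewrite !key2; ring.
Qed.

Lemma band_sinc_pow b w m : 0 <= b -> band (m%:R * b) (fun x => sinc (b * (x - w)) ^+ m).
Proof.
move=> b0; elim: m => [|m ih].
  by rewrite mul0r; under eq_fun do rewrite expr0; exact: band1.
have := band_sinc w b0 ih; rewrite -natr1 mulrDl mul1r addrC.
by under eq_fun do rewrite -exprSr.
Qed.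

(** A superposition in w of the functions of [band_sinc_pow], each tested at frequency [a = 0]. The
    range [-1, 1] is the support of the multiplier this is meant for. *)
Lemma band_conv (f : R -> R) b m : 0 <= b -> m%:R * b < T -> continuous f ->
  LE N (fun x => cint (-1) 1 (fun w => f w * sinc (b * (x - w)) ^+ m)) @[N --> \oo] --> (0 : R).
Proof.
move=> b0 mT cf; have [M M0 fM] := continuous_le_bound (-1) 1 cf.
have cs x : continuous (fun w => sinc (b * (x - w)) ^+ m).
  apply: contX; apply: (@cont_comp _ (@sinc R) (fun w => b * (x - w))); first exact: cont_sinc.
  by cont.
have cfs x : continuous (fun w => f w * sinc (b * (x - w)) ^+ m).
  by apply: contM; [exact: cf|exact: cs].
have cS j : continuous (fun w => c j * (f w * sinc (b * (s j - w)) ^+ m + f w * sinc (b * (- s j - w)) ^+ m)).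
  by apply: contM; [exact: contC|apply: contD; exact: cfs].
have E N : LE N (fun x => cint (-1) 1 (fun w => f w * sinc (b * (x - w)) ^+ m)) =
  cint (-1) 1 (fun w => f w * LE N (fun x => sinc (b * (x - w)) ^+ m)).
  rewrite (@eq_cint _ _ _ _ (fun w => \sum_(j < N) c j * (f w * sinc (b * (s j - w)) ^+ m + f w * sinc (b * (- s j - w)) ^+ m))); last first.
    by move=> w _; rewrite /LE mulr_sumr; apply: eq_bigr => j _; ring.
  rewrite cint_sum; last exact: cS.
  apply: eq_bigr => j _; rewrite cintZ; last by apply: contD; exact: cfs.
  by rewrite cintD//; exact: cfs.
under eq_fun do rewrite E.
apply: (@cint_cvg0 _ (-1) 1 (fun N w => f w * LE N (fun x => sinc (b * (x - w)) ^+ m)) (M * (2 * 1 * B))).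
- move=> N; apply: contM; first exact: cf.
  by apply: cont_sum => j; apply: contM; [exact: contC|apply: contD; exact: cs].
- move=> N w w1; rewrite normrM; apply: ler_pM => //; first exact: fM.
  by apply: LE_bound => x; rewrite normrX exprn_ile1// sinc_le1.
- move=> w _; rewrite -[X in _ --> X](mulr0 (f w)); apply: cvgMr.
  have [_ /(_ 0 0)] := band_sinc_pow w m b0; rewrite normr0 add0r => /(_ mT).
  apply: cvg_trans; apply: near_eq_cvg; apply: nearW => N.
  by rewrite /LE; apply: eq_bigr => j _; rewrite !mul0r addr0 cos0 !mulr1.
Qed.

End BandLimited.

(** * Iterated backward differences *)

Section FiniteDifferences.
Variable R : realType.
Implicit Types (u v y : R) (f g : R -> R) (n M : nat).

Fixpoint fdiff M y f u : R :=
  if M is n.+1 then fdiff n y f u - fdiff n y f (u - y) else f u.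

Lemma fdiff_shift M y f u : fdiff M y (fun v => f v - f (v - y)) u = fdiff M.+1 y f u.
Proof.
elim: M u => // M ih u; rewrite [LHS]/= !ih /=; lra.
Qed.

Lemma fdiff_coef M : exists c : nat -> R, forall f u y,
  fdiff M y f u = f u + \sum_(k < M) c k * f (u - k.+1%:R * y).
Proof.
elim: M => [|M [c ih]]; first by exists (fun=> 0) => f u y; rewrite big_ord0 addr0.
exists (fun k => (if (k < M)%N then c k else 0) - (if k is k'.+1 then c k' else 1)) => f u y.
rewrite /= !ih; under [in RHS]eq_bigr do rewrite mulrBl.
rewrite sumrB big_ord_recr/= ltnn mul0r addr0.
rewrite [X in _ = _ + (_ - X)]big_ord_recl/= mul1r mul1r.
have -> : \sum_(k < M) (if (k < M)%N then c k else 0) * f (u - k.+1%:R * y) =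
   \sum_(k < M) c k * f (u - k.+1%:R * y) by apply: eq_bigr => k _; rewrite ltn_ord.
have -> : \sum_(k < M) c k * f (u - y - k.+1%:R * y) =
   \sum_(i < M) c i * f (u - (bump 0 i).+1%:R * y).
  by apply: eq_bigr => k _; congr (_ * f _); rewrite /bump/= add1n -(natr1 k.+1); ring.
by lra.
Qed.

(** [fs] lists a function and its successive derivatives. Each difference is traded for one
    derivative by the mean value theorem, and the radius of the admissible interval shrinks by |y|
    every time. *)
Lemma fdiff_bound M (fs : nat -> R -> R) u y rho B :
  (forall i v, (i < M)%N -> `|v| <= rho -> isd (fs i) v (fs i.+1 v)) ->
  (forall v, `|v| <= rho -> `|fs M v| <= B) ->
  `|u| + M%:R * `|y| <= rho -> `|fdiff M y (fs 0%N) u| <= `|y| ^+ M * B.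
Proof.
elim: M fs u rho B => [|M ih] fs u rho B dfs fB ur.
  by rewrite expr0 mul1r/=; apply: fB; move: ur; rewrite mul0r addr0.
rewrite -fdiff_shift.
have y0 := normr_ge0 y.
have sh v : `|v| <= rho - `|y| -> `|v| <= rho /\ `|v - y| <= rho.
  by move=> h; have := ler_normB v y; split; lra.
have := @ih (fun i v => fs i v - fs i (v - y)) u (rho - `|y|) (`|y| * B).
rewrite exprSr -mulrA; apply.
- move=> i v iM /sh[v1 v2]; apply: isdB; first by apply: dfs => //; exact: ltnW.
  apply: isd_eq.
    apply: (@isd_comp _ (fs i) (fun v => v - y)); first by apply: dfs => //; exact: ltnW.
    by apply: isdB; [exact: isdI|exact: isdC].
  by rewrite /= subr0 mulr1.
- move=> v /sh[v1 v2].
  have d1 x : - rho <= x <= rho -> isd (fs M) x (fs M.+1 x).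
    by rewrite -ler_norml; exact: dfs.
  have d2 x : - rho <= x <= rho -> `|fs M.+1 x| <= B.
    by rewrite -ler_norml; exact: fB.
  rewrite !ler_norml in v1 v2; have := isd_lip d1 d2 v1 v2.
  by rewrite (_ : v - (v - y) = y) ?[_ * B]mulrC//; ring.
- by move: ur; rewrite -natr1 mulrDl mul1r; lra.
Qed.

End FiniteDifferences.

(** * Smoothness of the Bochner-Riesz multiplier away from its singularity *)

Section BochnerRieszMultiplier.
Variable R : realType.
Variable delta : R.
Hypothesis d0 : 0 < delta.
Implicit Types (u v y r b : R) (n M p m : nat).

Definition brm u : R := (Num.max (1 - u ^+ 2) 0) `^ delta.

Lemma brm_out u : 1 <= `|u| -> brm u = 0.
Proof.
move=> u1; rewrite /brm max_r ?powR0 ?gt_eqF//.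
by rewrite subr_le0 -[u ^+ 2]real_normK ?num_real// expr_ge1.
Qed.

Lemma brm_in u : `|u| < 1 -> brm u = (1 - u ^+ 2) `^ delta.
Proof.
move=> u1; rewrite /brm max_l// subr_ge0 -[u ^+ 2]real_normK ?num_real//.
by rewrite expr_le1// ltW.
Qed.

Lemma brm_ge0 u : 0 <= brm u.
Proof. exact: powR_ge0. Qed.

Lemma cont_brm : continuous brm.
Proof.
have -> : brm = (fun u => `| (1 - u ^+ 2 + `|1 - u ^+ 2|) / 2 | `^ delta).
  apply/funext => u; rewrite /brm maxr_absE subr0 addr0.
  have h : 0 <= (1 - u ^+ 2 + `|1 - u ^+ 2|) / 2.
    by have := ler_norm (- (1 - u ^+ 2)); rewrite normrN; lra.
  by rewrite (ger0_norm h).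
apply: (@cont_comp _ (fun x => `|x| `^ delta) (fun u => (1 - u ^+ 2 + `|1 - u ^+ 2|) / 2)).
  exact: cont_powR.
by cont.
Qed.

Lemma brm_le u : brm u <= (2 * `|1 - `|u| |) `^ delta.
Proof.
have [u1|u1] := leP 1 `|u|; first by rewrite brm_out ?powR_ge0.
rewrite brm_in//; apply: ge0_ler_powR; first exact: ltW.
- by rewrite nnegrE subr_ge0 -[u ^+ 2]real_normK ?num_real// expr_le1// ltW.
- by rewrite nnegrE mulr_ge0.
rewrite gtr0_norm ?subr_gt0//.
have -> : 1 - u ^+ 2 = (1 + `|u|) * (1 - `|u|).
  by rewrite -[u ^+ 2]real_normK ?num_real//; ring.
by rewrite ler_wpM2r ?subr_ge0 ?(ltW u1)//; lra.
Qed.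

Lemma isd_horner (q : {poly R}) u : isd (horner q) u (q^`()).[u].
Proof.
elim/poly_ind: q => [|q c ih].
  rewrite deriv0 horner0; have -> : horner (0 : {poly R}) = (fun=> 0).
    by apply/funext => x; rewrite horner0.
  exact: isdC.
have -> : horner (q * 'X + c%:P) = (fun x => q.[x] * x + c).
  by apply/funext => x; rewrite !hornerE.
rewrite derivD derivM derivX derivC addr0 mulr1 hornerD hornerM hornerX.
apply: isd_eq.
  by apply: isdD; [apply: isdM; [exact: ih|exact: isdI]|exact: isdC].
by rewrite /=; ring.
Qed.

(** The n-th derivative of (1 - u^2)^delta is this polynomial times (1 - u^2)^(delta - n); the
    recursion is the product rule. *)
Fixpoint brp n : {poly R} :=
  if n is k.+1 then (brp k)^`() * (1%:P - 'X^2) - (2 * (delta - k%:R)) *: ('X * brp k) else 1%:P.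

Definition brd n u : R := (brp n).[u] * (1 - u ^+ 2) `^ (delta - n%:R).

Lemma isd_brd n u : `|u| < 1 -> isd (brd n) u (brd n.+1 u).
Proof.
move=> u1; have q0 : 0 < 1 - u ^+ 2.
  by rewrite subr_gt0 -[u ^+ 2]real_normK ?num_real// expr_lt1.
apply: isd_eq.
  apply: isdM; first exact: isd_horner.
  apply: (@isd_comp _ (fun z => z `^ (delta - n%:R)) (fun z => 1 - z ^+ 2)).
    exact: isd_powR'.
  by apply: isdB; [exact: isdC|apply: isdX; exact: isdI].
rewrite /brd /= hornerD hornerN hornerM hornerZ hornerM hornerX hornerD hornerN hornerXn hornerC.
have -> : delta - n.+1%:R = delta - n%:R - 1 by rewrite -natr1; ring.
rewrite (@powRB _ (1 - u ^+ 2) (delta - n%:R)) ?(gt_eqF q0) ?implybT// (powRr1 (ltW q0)).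
move: (_ `^ _) => P; move: (brp n)^`().[u] (brp n).[u] => A A'.
by field; rewrite gt_eqF.
Qed.

Lemma brd0 u : brd 0 u = (1 - u ^+ 2) `^ delta.
Proof. by rewrite /brd hornerC mul1r subr0. Qed.

Lemma brd_bound n : delta <= n%:R -> exists2 C : R, 0 < C & forall u, `|u| < 1 ->
  `|brd n u| <= C * (1 - `|u|) `^ (delta - n%:R).
Proof.
move=> dn; have cq : continuous (horner (brp n)).
  by move=> x; exact: isd_continuous (isd_horner _ x).
have [C C0 HC] := continuous_le_bound (-1) 1 cq; exists C => // u u1.
have v0 : 0 < 1 - `|u| by rewrite subr_gt0.
rewrite /brd normrM; apply: ler_pM => //.
  by apply: HC; rewrite -ler_norml ltW.
rewrite ger0_norm ?powR_ge0//.
have -> : 1 - u ^+ 2 = (1 + `|u|) * (1 - `|u|).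
  by rewrite -[u ^+ 2]real_normK ?num_real//; ring.
have u10 : 0 <= 1 + `|u| by rewrite addr_ge0.
rewrite (powRM _ u10 (ltW v0)).
rewrite ler_piMl ?powR_ge0//.
have -> : delta - n%:R = - (n%:R - delta) by ring.
rewrite powRN invf_le1 ?powR_gt0 ?ltr_pwDl//.
have nd0 : 0 <= n%:R - delta by rewrite subr_ge0.
have u11 : 1 <= 1 + `|u| by rewrite lerDl.
by have := ge0_ler_powR nd0 (ler01 : 1 \is Num.nneg) (u10 : _ \is Num.nneg) u11; rewrite powR1.
Qed.

(** With r the distance from |u| to 1: if r <= 2 M |y|, every sampled value is O(|y|^delta) by
    [brm_le]. Otherwise all samples lie on the same side of the singularity; outside they vanish,
    and inside the M-th derivative gives |y|^M r^(delta - M), which M >= p + delta converts into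
    both bounds. *)
Lemma fdiff_brm M p : p%:R + delta <= M%:R -> exists2 C : R, 0 < C & forall u y,
  `|fdiff M y brm u| <= C * `|y| `^ delta /\ `|1 - `|u| | ^+ p * `|fdiff M y brm u| <= C * (`|y| ^+ p * `|y| `^ delta).
Proof.
move=> pM.
have dM : delta <= M%:R by have : 0 <= p%:R :> R by []; lra.
have M0 : 0 < M%:R :> R by move: d0; lra.
have M1 : 1 <= M%:R :> R by rewrite ler1n -(ltr0n R).
have [C1 C10 HC1] := brd_bound dM.
pose C2 : R := 2 ^+ M * (2 * (3 * M%:R)) `^ delta.
pose C3 : R := C1 * 2^-1 `^ (delta - M%:R).
have C20 : 0 < C2 by rewrite mulr_gt0 ?exprn_gt0 ?powR_gt0 ?mulr_gt0.
have C30 : 0 < C3 by rewrite mulr_gt0 ?powR_gt0.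
have triv N y u B : (forall k, (k <= N)%N -> `|brm (u - k%:R * y)| <= B) ->
    `|fdiff N y brm u| <= 2 ^+ N * B.
  elim: N u => [|N ih] u HB; first by have := HB 0%N isT; rewrite mul0r subr0 mul1r.
  rewrite /= exprS mulrAC -mulrA mulr2n mulrDl mul1r mulrC.
  apply: (le_trans (ler_normB _ _)); apply: lerD.
    by apply: ih => k kN; apply: HB; exact: leqW.
  apply: ih => k kN; have := HB k.+1 kN; rewrite -natr1 mulrDl mul1r opprD addrA.
  by rewrite addrAC.
exists (C2 * (2 * M%:R) ^+ p + C2 + C3).
  by rewrite !addr_gt0// mulr_gt0// exprn_gt0// mulr_gt0.
move=> u y; set r := `|1 - `|u| |; have r0 : 0 <= r by exact: normr_ge0.
have yd0 : 0 <= `|y| `^ delta by exact: powR_ge0.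
have [rM|Mr] := leP r (2 * M%:R * `|y|).
  have D : `|fdiff M y brm u| <= C2 * `|y| `^ delta.
    have M60 : 0 <= 2 * (3 * M%:R) :> R by rewrite !mulr_ge0.
    rewrite /C2 -mulrA -(powRM _ M60 (normr_ge0 y)).
    apply: triv => k kM; rewrite ger0_norm ?brm_ge0//.
    apply: (le_trans (brm_le _)); apply: ge0_ler_powR.
    - exact: ltW.
    - by rewrite nnegrE mulr_ge0.
    - by rewrite nnegrE !mulr_ge0.
    rewrite -[X in _ <= X]mulrA ler_pM2l//.
    have kM' : k%:R * `|y| <= M%:R * `|y| by rewrite ler_wpM2r// ler_nat.
    have : `|1 - `|u - k%:R * y| | <= r + k%:R * `|y|.
      have -> : 1 - `|u - k%:R * y| = (1 - `|u|) + (`|u| - `|u - k%:R * y|) by ring.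
      apply: (le_trans (ler_normD _ _)); rewrite lerD2l.
      apply: (le_trans (ler_dist_dist _ _)).
      by rewrite opprB addrC subrK normrM ger0_norm.
    by lra.
  split.
    apply: (le_trans D); rewrite ler_wpM2r//.
    have : 0 <= C2 * (2 * M%:R) ^+ p by rewrite mulr_ge0 ?exprn_ge0 ?mulr_ge0 ?(ltW C20) ?(ltW M0).
    lra.
  apply: (@le_trans _ _ ((2 * M%:R * `|y|) ^+ p * (C2 * `|y| `^ delta))).
    apply: ler_pM => //; first exact: exprn_ge0.
    by rewrite lerXn2r ?nnegrE// !mulr_ge0.
  rewrite exprMn [leLHS](_ : _ = C2 * (2 * M%:R) ^+ p * (`|y| ^+ p * `|y| `^ delta)); last by ring.
  rewrite ler_wpM2r ?mulr_ge0 ?exprn_ge0//; lra.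
have r1 : 0 < r by apply: le_lt_trans Mr; rewrite !mulr_ge0.
have yr : `|y| * M%:R < r / 2 by rewrite ltr_pdivlMr//; lra.
have D : `|fdiff M y brm u| <= `|y| ^+ M * (C3 * r `^ (delta - M%:R)).
  have [u1|u1] := leP 1 `|u|.
    have rE : r = `|u| - 1 by rewrite /r distrC ger0_norm// subr_ge0.
    have -> : fdiff M y brm u = 0.
      apply/eqP; rewrite -normr_le0 -(mulr0 (2 ^+ M)); apply: triv => k kM.
      rewrite brm_out ?normr0//.
      have kM' : k%:R * `|y| <= M%:R * `|y| by rewrite ler_wpM2r// ler_nat.
      have := ler_normB u (k%:R * y); have := ler_normD (u - k%:R * y) (k%:R * y).
      rewrite subrK normrM [`|k%:R|]ger0_norm//; lra.
    by rewrite normr0 mulr_ge0 ?exprn_ge0// mulr_ge0 ?powR_ge0// ltW.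
  have rE : r = 1 - `|u| by rewrite /r ger0_norm// subr_ge0 ltW.
  have small v : `|v| <= 1 - r / 2 -> `|v| < 1 by lra.
  have -> : fdiff M y brm u = fdiff M y (brd 0) u.
    have [c Hc] := fdiff_coef R M; rewrite !Hc.
    have ub : `|u| <= 1 - r / 2 by lra.
    rewrite brm_in ?brd0; last exact: small.
    congr (_ + _); apply: eq_bigr => k _; congr (_ * _).
    have kM' : k.+1%:R * `|y| <= M%:R * `|y| by rewrite ler_wpM2r// ler_nat.
    rewrite brm_in ?brd0//; apply: small.
    by have := ler_normB u (k.+1%:R * y); rewrite normrM [`|k.+1%:R|]ger0_norm//; lra.
  apply: (@fdiff_bound _ M brd u y (1 - r / 2)).
  - by move=> i v _ /small; exact: isd_brd.
  - move=> v vr; apply: (le_trans (HC1 v (small _ vr))).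
    rewrite /C3 -mulrA ler_pM2l// -powRM//.
    have -> : delta - M%:R = - (M%:R - delta) by ring.
    have v1 : 2^-1 * r <= 1 - `|v| by lra.
    have r20 : 0 < 2^-1 * r by rewrite mulr_gt0.
    rewrite !powRN lef_pV2 ?posrE ?powR_gt0//; last exact: lt_le_trans v1.
    by apply: ge0_ler_powR => //; rewrite ?subr_ge0// ?nnegrE ?(ltW r20)// (le_trans (ltW r20)).
  - lra.
have [y0|y0] := eqVneq y 0.
  move: D; rewrite y0 normr0 expr0n; have -> : (M == 0)%N = false by apply: gtn_eqF; rewrite -(ltr0n R).
  rewrite mul0r normr_le0 => /eqP ->; rewrite normr0 powR0 ?gt_eqF// !mulr0.
  by split.
have yp : 0 < `|y| by rewrite normr_gt0.
have yr1 : `|y| <= r.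
  apply: le_trans (_ : `|y| * M%:R <= _); first by rewrite ler_peMr.
  lra.
(* The surplus is a nonnegative power of |y| / r <= 1. Used with e0 = 0 and with e0 = p, one for
   each bound. *)
have E e0 : 0 <= e0 -> e0 + delta <= M%:R ->
    r `^ e0 * (`|y| ^+ M * r `^ (delta - M%:R)) <= `|y| `^ e0 * `|y| `^ delta.
  move=> e00 e0M; rewrite -powR_mulrn//.
  have -> : M%:R = (e0 + delta) + (M%:R - delta - e0) by ring.
  rewrite (@powRD _ `|y|) ?(gt_eqF yp) ?implybT// (@powRD _ `|y| e0) ?(gt_eqF yp) ?implybT//.
  have -> : delta - (e0 + delta + (M%:R - delta - e0)) = - e0 + - (M%:R - delta - e0) by ring.
  rewrite (@powRD _ r) ?(gt_eqF r1) ?implybT// !powRN.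
  have re : 0 < r `^ e0 by rewrite powR_gt0.
  have re' : 0 < r `^ (M%:R - delta - e0) by rewrite powR_gt0.
  rewrite [leLHS](_ : _ = `|y| `^ e0 * `|y| `^ delta * (`|y| `^ (M%:R - delta - e0) / r `^ (M%:R - delta - e0))); last first.
    by field; rewrite !gt_eqF.
  rewrite ler_piMr ?mulr_ge0 ?powR_ge0// ler_pdivrMr// mul1r.
  by apply: ge0_ler_powR => //; rewrite ?nnegrE//; lra.
split.
  apply: (le_trans D); rewrite mulrCA.
  have := E 0 (lexx 0); rewrite !powRr0 !mul1r add0r => /(_ dM) h.
  have := ler_wpM2l (ltW C30) h => h2; apply: (le_trans h2).
  rewrite ler_wpM2r//.
  have : 0 <= C2 * (2 * M%:R) ^+ p by rewrite mulr_ge0 ?exprn_ge0 ?mulr_ge0 ?(ltW C20) ?(ltW M0).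
  lra.
apply: (@le_trans _ _ (r ^+ p * (`|y| ^+ M * (C3 * r `^ (delta - M%:R))))).
  by rewrite ler_wpM2l// exprn_ge0.
rewrite [leLHS](_ : _ = C3 * (r ^+ p * (`|y| ^+ M * r `^ (delta - M%:R)))); last by ring.
have := E p%:R (ler0n _ _) pM; rewrite !powR_mulrn// => h.
have := ler_wpM2l (ltW C30) h => h2; apply: (le_trans h2).
rewrite ler_wpM2r ?mulr_ge0 ?exprn_ge0//.
have : 0 <= C2 * (2 * M%:R) ^+ p by rewrite mulr_ge0 ?exprn_ge0 ?mulr_ge0 ?(ltW C20) ?(ltW M0).
lra.
Qed.

End BochnerRieszMultiplier.

(** * Jackson-type approximation of the multiplier *)

Section Approximation.
Variable R : realType.

Let cont_abs : continuous (fun y : R => `|y|).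
Proof. exact: (cont_norm (@contI R)). Qed.
Local Hint Resolve cont_abs : cont.

Variable delta : R.
Hypothesis d0 : 0 < delta.
Implicit Types (u v y r b w : R) (n M p m : nat).

Local Notation f := (brm delta).

Lemma cvg0Z k (h : nat -> R) : h n @[n --> \oo] --> (0 : R) ->
  k * h n @[n --> \oo] --> (0 : R).
Proof. by move=> h0; rewrite -[X in _ --> X](mulr0 k); exact: cvgMr. Qed.

Lemma cvg0_sum (I : Type) (r : seq I) (h : I -> nat -> R) :
  (forall i, h i n @[n --> \oo] --> (0 : R)) ->
  \sum_(i <- r) h i n @[n --> \oo] --> (0 : R).
Proof.
move=> h0; elim: r => [|i r ih].
  by under eq_fun do rewrite big_nil; exact: cvg_cst.
rewrite [X in X @ _ --> _](_ : _ = h i \+ (fun n => \sum_(i <- r) h i n)); last first.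
  by apply/funext => n; rewrite big_cons.
by rewrite -[X in _ --> X]addr0; apply: cvgD; [exact: h0|exact: ih].
Qed.

Lemma brm_le1 u : f u <= 1.
Proof.
have [u1|u1] := leP 1 `|u|; first by rewrite brm_out.
rewrite brm_in//.
have q0 : 0 <= 1 - u ^+ 2.
  by rewrite subr_ge0 -[u ^+ 2]real_normK ?num_real// expr_le1// ltW.
have q1 : 1 - u ^+ 2 <= 1 by rewrite gerBl sqr_ge0.
by have := ge0_ler_powR (ltW d0) (q0 : _ \is Num.nneg) (ler01 : 1 \is Num.nneg) q1; rewrite powR1.
Qed.

Lemma cint_arctan b : 0 < b -> cint (-3) 3 (fun y => (1 + (b * y) ^+ 2)^-1) <= pi / b.
Proof.
move=> b0.
have p0 y : 0 < 1 + (b * y) ^+ 2 by rewrite ltr_pwDl// sqr_ge0.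
have m33 : -3 <= 3 :> R by lra.
rewrite (@cint_primitive _ (-3) 3 _ (fun y => b^-1 * atan (b * y)) m33).
- rewrite -mulrBr mulrC ler_pM2r ?invr_gt0//.
  by have := atan_ltpi2 (b * 3); have := atan_gtNpi2 (b * -3); lra.
- move=> y; apply: cvgV; first by rewrite gt_eqF.
  have ct : continuous (fun y => 1 + (b * y) ^+ 2) by cont.
  exact: ct.
- move=> y _; apply: isd_eq.
    apply: isdZ; apply: (@isd_comp _ (@atan R) (fun y => b * y)).
      exact: is_derive1_atan.
    by apply: isdZ; exact: isdI.
  by rewrite /=; field; rewrite !gt_eqF.
Qed.

Section Kernel.
Variables (M m : nat) (b : R).
Hypothesis b1 : 1 <= b.
Hypothesis mM : (M + 2 <= m)%N.
Hypothesis me : ~~ odd m.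

Let b0 : 0 < b. Proof. exact: lt_le_trans b1. Qed.
Let S y := sinc (b * y) ^+ m.

Let cS : continuous S.
Proof.
apply: contX; apply: (@cont_comp _ (@sinc R) (fun y => b * y)); first exact: cont_sinc.
by cont.
Qed.

Let S_norm y : S y = `|sinc (b * y)| ^+ m.
Proof. by rewrite /S -normrX ger0_norm// exprn_even_ge0. Qed.

Let S_ge0 y : 0 <= S y.
Proof. by rewrite S_norm exprn_ge0. Qed.

Let Z := cint (-3) 3 S.

Let Z_lower : (2 ^+ m)^-1 / b <= Z.
Proof.
(* On |y| <= e the argument b y is at most 1/2, where [sinc_ge] keeps sinc above 1/2. *)
pose e := (2 * b)^-1 : R.
have e0 : 0 < e by rewrite invr_gt0 mulr_gt0.
have e1 : e <= 1 by rewrite invf_le1 ?mulr_gt0//; have := b1; lra.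
have i1 : -3 <= - e <= 3 by apply/andP; split; lra.
have i2 : - e <= e <= 3 by apply/andP; split; lra.
rewrite /Z (cint_split i1 cS) (cint_split i2 cS).
have c1 : 0 <= cint (-3) (- e) S by apply: cint_ge0.
have c2 : 0 <= cint e 3 S by apply: cint_ge0.
suff : (2 ^+ m)^-1 / b <= cint (- e) e S by lra.
have ee : - e <= e by lra.
have -> : (2 ^+ m)^-1 / b = cint (- e) e (fun=> (2 ^+ m)^-1).
  by rewrite cint_cst// /e; congr (_ * _); field; rewrite gt_eqF.
apply: le_cint => //; first exact: contC.
move=> y ye; rewrite /S -exprVn lerXn2r ?nnegrE//.
  apply: le_trans (sinc_ge _); first by rewrite invr_ge0.
  rewrite normrM gtr0_norm// -ler_pdivlMl//.
  by rewrite ler_norml; move: ye; rewrite /e invfM mulrC.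
apply: sinc_ge; rewrite normrM gtr0_norm// -ler_pdivlMl//.
by rewrite ler_norml; move: ye; rewrite /e invfM mulrC.
Qed.

Let Z0 : 0 < Z.
Proof. by apply: lt_le_trans Z_lower; rewrite divr_gt0// invr_gt0 exprn_gt0. Qed.

Let S_moment : cint (-3) 3 (fun y => S y * (1 + b * `|y|) ^+ M) <= 2 ^+ m * (pi / b).
Proof.
apply: (@le_trans _ _ (2 ^+ m * cint (-3) 3 (fun y => (1 + (b * y) ^+ 2)^-1))).
  have p0 y : 0 < 1 + (b * y) ^+ 2 by rewrite ltr_pwDl// sqr_ge0.
  have cI : continuous (fun y => (1 + (b * y) ^+ 2)^-1).
    move=> y; apply: cvgV; first by rewrite gt_eqF.
    have ct : continuous (fun y => 1 + (b * y) ^+ 2) by cont.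
    exact: ct.
  rewrite -cintZ//; apply: le_cint.
  - by apply: contM; [exact: cS|cont].
  - by apply: contM; [exact: contC|exact: cI].
  move=> y _; rewrite S_norm.
  have -> : b * `|y| = `|b * y| by rewrite normrM gtr0_norm.
  exact: sinc_pow_bound.
by rewrite ler_pM2l ?exprn_gt0//; exact: cint_arctan.
Qed.

Definition conv (k : nat) u := cint (-1) 1 (fun w => f w * sinc (b / k.+1%:R * (u - w)) ^+ m).

Let shifted (k : nat) u : `|u| <= 2 ->
  cint (-3) 3 (fun y => S y * f (u - k.+1%:R * y)) = k.+1%:R^-1 * conv k u.
Proof.
move=> u2; have k0 : 0 < k.+1%:R :> R by [].
pose g w := f w * sinc (b / k.+1%:R * (u - w)) ^+ m.
have cg : continuous g.
  apply: contM; first exact: cont_brm.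
  apply: contX; apply: (@cont_comp _ (@sinc R) (fun w => b / k.+1%:R * (u - w))).
    exact: cont_sinc.
  by cont.
have m33 : -3 <= 3 :> R by lra.
transitivity (cint (-3) 3 (fun y => g (u - k.+1%:R * y))).
  apply: eq_cint => y _; rewrite /g /S mulrC; congr (_ * sinc _ ^+ _).
  by field; rewrite gt_eqF.
rewrite (cint_affine u k0 m33 cg); congr (_ * _); rewrite /conv -/g.
have k1 : 1 <= k.+1%:R :> R by rewrite ler1n.
have [u3 u4] : -2 <= u /\ u <= 2 by move: u2; rewrite ler_norml => /andP.
(* The half-width 3 is chosen so that, for |u| <= 2, the image of [-3, 3] under y -> u - (k + 1) y
   contains the support [-1, 1] of [f]. *)
have i1 : u - k.+1%:R * 3 <= -1 <= u - k.+1%:R * -3 by apply/andP; split; lra.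
have i2 : -1 <= (1 : R) <= u - k.+1%:R * -3 by apply/andP; split; lra.
rewrite (cint_split i1 cg) (cint_split i2 cg).
have z a c : (forall x, a <= x <= c -> 1 <= `|x|) -> cint a c g = 0.
  move=> H; rewrite (@eq_cint _ _ _ _ (fun=> 0 * 0)) ?cintZ ?mul0r//; first exact: contC.
  by move=> x /H xx; rewrite /g brm_out// !mul0r.
rewrite z ?add0r; last by move=> x /andP[_ x1]; rewrite ler_normr; apply/orP; right; lra.
rewrite [X in _ + X]z ?addr0//.
by move=> x /andP[x1 _]; rewrite ler_normr; apply/orP; left.
Qed.

Variables (c : nat -> R) (CD : R) (p : nat).
Hypothesis CD0 : 0 < CD.
Hypothesis cE : forall g u y, fdiff M y g u = g u + \sum_(k < M) c k * g (u - k.+1%:R * y).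
Hypothesis CDE : forall u y,
  `|fdiff M y f u| <= CD * `|y| `^ delta /\
  `|1 - `|u| | ^+ p * `|fdiff M y f u| <= CD * (`|y| ^+ p * `|y| `^ delta).
Hypothesis pM : p%:R + delta <= M%:R.

(** Jackson's construction. Averaging the M-th difference of [f] against the kernel [S] gives
    [Z * f u] plus averages of shifted values of [f]; these averages, with the sign changed and
    divided by [Z], form the approximant. After a change of variables each is a convolution with a
    dilated power of sinc, hence band-limited. *)
Definition approx u := - Z^-1 * \sum_(k < M) c k * (k.+1%:R^-1 * conv k u).

Let pow1D (x : R) : 0 <= x -> (1 + x) ^+ p <= 2 ^+ p * (1 + x ^+ p).
Proof.
move=> x0; have [x1|x1] := leP x 1.
  apply: (@le_trans _ _ (2 ^+ p)).
    by rewrite lerXn2r ?nnegrE ?addr_ge0//; lra.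
  by rewrite ler_peMr ?exprn_ge0// lerDl exprn_ge0.
apply: (@le_trans _ _ ((2 * x) ^+ p)).
  by rewrite lerXn2r ?nnegrE ?addr_ge0 ?mulr_ge0//; lra.
by rewrite exprMn ler_pM2l ?exprn_gt0// lerDr.
Qed.

Let cfd u : continuous (fun y => fdiff M y f u).
Proof.
under eq_fun do rewrite cE.
apply: contD; first exact: contC.
apply: cont_sum => k; apply: contM; first exact: contC.
apply: (@cont_comp _ f (fun y => u - k.+1%:R * y)); first exact: cont_brm.
by cont.
Qed.

Let near_id u : `|u| <= 2 -> Z * (f u - approx u) = cint (-3) 3 (fun y => S y * fdiff M y f u).
Proof.
move=> u2.
have cfk k : continuous (fun y => S y * f (u - k.+1%:R * y)).
  apply: contM; first exact: cS.
  apply: (@cont_comp _ f (fun y => u - k.+1%:R * y)); first exact: cont_brm.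
  by cont.
rewrite (@eq_cint _ _ _ _ (fun y => f u * S y + \sum_(k < M) c k * (S y * f (u - k.+1%:R * y)))); last first.
  by move=> y _; rewrite cE mulrDr mulr_sumr mulrC; congr (_ + _); apply: eq_bigr => k _; ring.
rewrite cintD; last 2 first.
- by apply: contM; [exact: contC|exact: cS].
- by apply: cont_sum => k; apply: contM; [exact: contC|exact: cfk].
rewrite cintZ; last exact: cS.
rewrite cint_sum; last by move=> k; apply: contM; [exact: contC|exact: cfk].
rewrite mulrBr mulrC -/Z /approx mulNr mulrN opprK mulrA mulfV ?gt_eqF// mul1r.
congr (_ + _); apply: eq_bigr => k _.
by rewrite cintZ ?shifted.
Qed.

(** Splitting (1 + b r)^p into 1 and (b r)^p matches the two bounds of [CDE]; after scaling by b
    both involve powers of b |y| of exponent at most p + delta <= M. *)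
Let weight u y : (1 + b * `|1 - `|u| |) ^+ p * b `^ delta * `|fdiff M y f u| <=
  CD * 2 ^+ p * 2 * (1 + b * `|y|) ^+ M.
Proof.
set r := `|1 - `|u| |; have [D1 D2] := CDE u y.
have r0 : 0 <= r by exact: normr_ge0.
have br0 : 0 <= b * r by rewrite mulr_ge0// ltW.
have bd0 : 0 <= b `^ delta by exact: powR_ge0.
have F0 := normr_ge0 (fdiff M y f u).
have by0 : 0 <= b * `|y| by rewrite mulr_ge0// ltW.
have p1 : 1 <= 1 + b * `|y| by rewrite lerDl.
have p00 : 0 <= 1 + b * `|y| by rewrite addr_ge0.
have P e : 0 <= e -> e <= M%:R -> (b * `|y|) `^ e <= (1 + b * `|y|) ^+ M.
  move=> e0 eM; apply: (@le_trans _ _ ((1 + b * `|y|) `^ e)).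
    by apply: ge0_ler_powR => //; lra.
  by rewrite -powR_mulrn// ler_powR.
have pr0 : 0 <= p%:R :> R by [].
have q1 : b `^ delta * `|fdiff M y f u| <= CD * (1 + b * `|y|) ^+ M.
  apply: (@le_trans _ _ (CD * (b * `|y|) `^ delta)).
    by rewrite (powRM _ (ltW b0) (normr_ge0 y)) mulrCA ler_wpM2l.
  by rewrite ler_pM2l//; apply: P; [exact: ltW|move: pM pr0; lra].
have q2 : (b * r) ^+ p * (b `^ delta * `|fdiff M y f u|) <= CD * (1 + b * `|y|) ^+ M.
  apply: (@le_trans _ _ (CD * ((b * `|y|) ^+ p * (b * `|y|) `^ delta))).
    rewrite (powRM _ (ltW b0) (normr_ge0 y)) !exprMn.
    have bp0 : 0 <= b ^+ p * b `^ delta by rewrite mulr_ge0// exprn_ge0// ltW.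
    have := ler_wpM2l bp0 D2; move: (b ^+ p) (b `^ delta) (`|y| ^+ p) (`|y| `^ delta) (r ^+ p) => t1 t2 t3 t4 t5.
    by move=> h; rewrite [leLHS](_ : _ = t1 * t2 * (t5 * `|fdiff M y f u|)) ?[leRHS](_ : _ = t1 * t2 * (CD * (t3 * t4)))//; ring.
  rewrite ler_pM2l//.
  apply: (@le_trans _ _ ((1 + b * `|y|) ^+ p * (1 + b * `|y|) `^ delta)).
    apply: ler_pM; [exact: exprn_ge0|exact: powR_ge0| |].
      by rewrite lerXn2r ?nnegrE// lerDr.
    by apply: ge0_ler_powR; [exact: ltW|rewrite nnegrE|rewrite nnegrE|rewrite lerDr].
  rewrite -!(powR_mulrn _ p00) -powRD; first exact: ler_powR.
  by rewrite [1 + _ == 0]gt_eqF ?implybT//; exact: lt_le_trans p1.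
apply: (@le_trans _ _ (2 ^+ p * (1 + (b * r) ^+ p) * (b `^ delta * `|fdiff M y f u|))).
  by rewrite -mulrA ler_wpM2r ?mulr_ge0// pow1D.
rewrite -mulrA mulrDl mul1r.
have : 0 <= 2 ^+ p :> R by rewrite exprn_ge0.
move: (2 ^+ p) => t t0.
rewrite [leRHS](_ : _ = t * (CD * (1 + b * `|y|) ^+ M + CD * (1 + b * `|y|) ^+ M)); last by ring.
by rewrite ler_wpM2l// lerD.
Qed.

(** The identity [near_id] with the moment of order M of the kernel: that moment is of order 1/b and
    so is [Z] from below, so b cancels. *)
Lemma approx_near u : `|u| <= 2 -> `|f u - approx u| <=
  CD * 2 ^+ p * 2 * 2 ^+ m * pi * 2 ^+ m * (b `^ (- delta) * (1 + b * `|1 - `|u| |) ^- p).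
Proof.
move=> u2; have H := near_id u2.
set r := `|1 - `|u| |; set t := (1 + b * r) ^+ p.
have t0 : 0 < t by rewrite exprn_gt0// ltr_pwDl// (mulr_ge0 (ltW b0) (normr_ge0 _)).
have bd0 : 0 < b `^ delta by exact: powR_gt0.
have cSf : continuous (fun y => S y * fdiff M y f u) by apply: contM; [exact: cS|exact: cfd].
have cSn : continuous (fun y => S y * `|fdiff M y f u|).
  by apply: contM; [exact: cS|apply: cont_norm; exact: cfd].
have H1 : t * b `^ delta * (Z * `|f u - approx u|) <= CD * 2 ^+ p * 2 * (2 ^+ m * (pi / b)).
  rewrite -[Z in Z * `|_|](gtr0_norm Z0) -normrM H.
  apply: (@le_trans _ _ (t * b `^ delta * cint (-3) 3 (fun y => S y * `|fdiff M y f u|))).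
    rewrite ler_wpM2l//; first by rewrite mulr_ge0 ?powR_ge0// ltW.
    apply: (le_trans (cint_norm _ _ cSf)); apply: le_cint => //.
      by apply: cont_norm.
    by move=> y _; rewrite normrM (ger0_norm (S_ge0 y)).
  rewrite -cintZ//.
  apply: (@le_trans _ _ (cint (-3) 3 (fun y => CD * 2 ^+ p * 2 * (S y * (1 + b * `|y|) ^+ M)))).
    apply: le_cint.
    - by apply: contM; [exact: contC|].
    - by apply: contM; [exact: contC|apply: contM; [exact: cS|cont]].
    move=> y _; rewrite mulrCA [leRHS]mulrCA ler_wpM2l//; exact: weight.
  rewrite cintZ; last by apply: contM; [exact: cS|cont].
  by rewrite ler_wpM2l ?S_moment// !mulr_ge0 ?exprn_ge0 ?(ltW CD0).
have H2 : t * b `^ delta * ((2 ^+ m)^-1 / b * `|f u - approx u|) <= CD * 2 ^+ p * 2 * (2 ^+ m * (pi / b)).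
  by apply: le_trans H1; rewrite ler_pM2l ?mulr_gt0// ler_wpM2r ?Z_lower.
have m20 : 0 < 2 ^+ m :> R by rewrite exprn_gt0.
rewrite powRN -invfM ler_pdivlMr ?mulr_gt0//.
have k0 : 0 < (2 ^+ m)^-1 / b by rewrite divr_gt0// invr_gt0.
rewrite -(ler_pM2r k0).
rewrite [leLHS](_ : _ = t * b `^ delta * ((2 ^+ m)^-1 / b * `|f u - approx u|)); last by ring.
apply: (le_trans H2); rewrite le_eqVlt; apply/orP; left; apply/eqP.
by field; rewrite !gt_eqF.
Qed.

(** Here [f] vanishes and sinc is evaluated at distance at least r from its centre, so each
    [conv k u] is O((b r)^(-m)). Dividing by [Z] costs a factor b, and m >= M + 1 pays for this
    factor together with the weight b^delta (1 + b r)^p. *)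
Lemma approx_far u : 2 < `|u| -> `|f u - approx u| <=
  2 ^+ m * (\sum_(k < M) `|c k|) * 2 * (2 * M%:R) ^+ m * 2 ^+ p *
   (b `^ (- delta) * (1 + b * `|1 - `|u| |) ^- p).
Proof.
move=> u2; rewrite (brm_out d0) ?sub0r ?normrN; last by lra.
set r := `|1 - `|u| |.
have rE : r = `|u| - 1 by rewrite /r distrC ger0_norm//; lra.
have r1 : 1 < r by lra.
have br : b <= b * r by rewrite ler_peMr ?(ltW b0)// ltW.
have br1 : 1 <= b * r by apply: le_trans br.
have br0 : 0 < b * r by lra.
have m20 : 0 < 2 ^+ m :> R by rewrite exprn_gt0.
have tp : (1 + b * r) ^+ p <= 2 ^+ p * (b * r) ^+ p.
  have h : 1 + b * r <= 2 * (b * r) by move: br1; generalize (b * r) => z; lra.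
  rewrite -exprMn lerXn2r ?nnegrE//; last by rewrite mulr_ge0// ltW.
  by rewrite addr_ge0// ltW.
have Mr0 : 0 < M%:R :> R by have : 0 <= p%:R :> R by []; move: d0 pM; lra.
have cv k : (k < M)%N -> `|conv k u| <= 2 * ((2 * M%:R) ^+ m / (b * r) ^+ m).
  move=> kM; have kk0 : 0 < k.+1%:R :> R by [].
  have cg : continuous (fun w => f w * sinc (b / k.+1%:R * (u - w)) ^+ m).
    apply: contM; first exact: cont_brm.
    apply: contX; apply: (@cont_comp _ (@sinc R) (fun w => b / k.+1%:R * (u - w))).
      exact: cont_sinc.
    by cont.
  apply: (le_trans (cint_norm _ _ cg)).
  have m11 : -1 <= 1 :> R by lra.
  rewrite [leRHS](_ : _ = cint (-1) 1 (fun=> (2 * M%:R) ^+ m / (b * r) ^+ m)); last first.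
    by rewrite cint_cst//; ring.
  apply: le_cint; [exact: cont_norm|exact: contC|] => w w1.
  rewrite normrM -[leRHS]mul1r; apply: ler_pM => //.
    by rewrite ger0_norm ?brm_ge0// brm_le1.
  rewrite normrX -expr_div_n lerXn2r ?nnegrE//.
    by rewrite divr_ge0 ?(ltW br0)// mulr_ge0// ltW.
  set v := b / k.+1%:R * (u - w).
  have vl : b * r / M%:R <= `|v|.
    have ru : r <= `|u - w|.
      have := ler_normB u w; have := ler_normD (u - w) w; rewrite subrK.
      have : `|w| <= 1 by rewrite ler_norml.
      lra.
    rewrite /v normrM (gtr0_norm (divr_gt0 b0 kk0)).
    rewrite [leLHS](_ : _ = b / M%:R * r); last by ring.
    apply: ler_pM => //; first by rewrite divr_ge0 ?(ltW b0)// ltW.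
      by lra.
    by rewrite ler_pM2l// lef_pV2 ?posrE// ler_nat.
  have vp : 0 < `|v| by apply: lt_le_trans vl; rewrite divr_gt0.
  have := sinc_decay v => sd.
  apply: (@le_trans _ _ (2 / `|v|)).
    rewrite ler_pdivlMr//; apply: le_trans sd.
    by rewrite ler_wpM2l//; lra.
  rewrite ler_pdivrMr// mulrAC ler_pdivlMr//.
  by move: vl; rewrite ler_pdivrMr//; lra.
set K := (2 * M%:R) ^+ m in cv *.
have K0 : 0 <= K by rewrite exprn_ge0// mulr_ge0// ltW.
have S0 : 0 <= \sum_(k < M) `|c k| by apply: sumr_ge0.
have A1 : `|approx u| <= 2 ^+ m * b * ((\sum_(k < M) `|c k|) * (2 * (K / (b * r) ^+ m))).
  rewrite /approx normrM normrN; apply: ler_pM => //.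
    rewrite gtr0_norm ?invr_gt0// -[leRHS]invrK lef_pV2 ?posrE ?invr_gt0 ?mulr_gt0//.
    by rewrite invfM Z_lower.
  apply: (le_trans (ler_norm_sum _ _ _)); rewrite mulr_suml; apply: ler_sum => k _.
  rewrite normrM ler_wpM2l// normrM.
  apply: (@le_trans _ _ (1 * `|conv k u|)); last by rewrite mul1r cv.
  by rewrite ler_wpM2r// ger0_norm ?invr_ge0// invf_le1// ler1n.
apply: (le_trans A1).
rewrite [leLHS](_ : _ = 2 ^+ m * (\sum_(k < M) `|c k|) * 2 * K * (b / (b * r) ^+ m)); last by ring.
rewrite -[leRHS]mulrA ler_wpM2l ?mulr_ge0 ?(ltW m20)//.
rewrite powRN.
have bd0 : 0 < b `^ delta by exact: powR_gt0.
have t0 : 0 < (1 + b * r) ^+ p by rewrite exprn_gt0// ltr_pwDl// ltW.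
rewrite ler_pdivrMr ?exprn_gt0//.
rewrite -(ler_pM2r (mulr_gt0 bd0 t0)).
rewrite [leRHS](_ : _ = 2 ^+ p * (b * r) ^+ m); last by field; rewrite !gt_eqF.
have bdM : b `^ delta * (b * r) ^+ p <= (b * r) ^+ M.
  rewrite -!powR_mulrn ?(ltW br0)//.
  apply: (@le_trans _ _ ((b * r) `^ (p%:R + delta))).
    rewrite powRD ?(gt_eqF br0) ?implybT// mulrC ler_wpM2l ?powR_ge0//.
    by apply: ge0_ler_powR; rewrite ?nnegrE ?(ltW d0) ?(ltW b0) ?(ltW br0).
  by apply: ler_powR => //.
apply: (@le_trans _ _ ((b * r) * (2 ^+ p * (b * r) ^+ M))).
  apply: ler_pM => //; first exact: ltW.
    by rewrite mulr_ge0 ?(ltW bd0) ?(ltW t0).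
  apply: (@le_trans _ _ (b `^ delta * (2 ^+ p * (b * r) ^+ p))).
    by rewrite ler_wpM2l// ltW.
  by rewrite mulrCA ler_wpM2l ?exprn_ge0.
rewrite mulrCA ler_wpM2l ?exprn_ge0// -exprS ler_weXn2l//.
by apply: leq_trans mM; rewrite addn2.
Qed.

End Kernel.

Lemma brm_approx (p : nat) : exists m : nat, exists2 C : R, 0 < C &
  forall b, 1 <= b -> exists F : R -> R,
    (forall u, `|f u - F u| <= C * (b `^ (- delta) * (1 + b * `|1 - `|u| |) ^- p)) /\
    (forall (s : nat -> R) (c : nat -> R) (T B : R),
      (forall t, `|t| < T -> \sum_(j < N) cos (t * s j) * c j @[N --> \oo] --> (0 : R)) ->
      (forall N, \sum_(j < N) `|c j| <= B) -> m%:R * b < T ->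
      LE s c N F @[N --> \oo] --> (0 : R)).
Proof.
have [M pM] : exists M, p%:R + delta <= M%:R.
  by exists (Num.bound (p%:R + delta)); apply: ltW; rewrite archi_boundP// addr_ge0// ltW.
have [CD CD0 CDE] := fdiff_brm d0 pM.
have [c cE] := fdiff_coef R M.
(* Even, so that the power of sinc is nonnegative, and at least M + 2, so that its moment of order M
   is controlled. *)
pose m := (M + 2).*2.
have mM : (M + 2 <= m)%N by rewrite /m -addnn leq_addr.
have me : ~~ odd m by rewrite /m odd_double.
pose K1 := CD * 2 ^+ p * 2 * 2 ^+ m * pi * 2 ^+ m.
pose K2 := 2 ^+ m * (\sum_(k < M) `|c k|) * 2 * (2 * M%:R) ^+ m * 2 ^+ p.
have K10 : 0 < K1 by rewrite !mulr_gt0 ?exprn_gt0 ?pi_gt0.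
have K20 : 0 <= K2 by rewrite !mulr_ge0 ?exprn_ge0 ?mulr_ge0 ?sumr_ge0.
exists m, (K1 + K2); first by rewrite ltr_pwDl.
move=> b b1; exists (approx M m b c); split.
  move=> u; have b0 : 0 < b by exact: lt_le_trans b1.
  have r0 : 0 <= b `^ (- delta) * (1 + b * `|1 - `|u| |) ^- p.
    by rewrite mulr_ge0 ?powR_ge0// invr_ge0 exprn_ge0// addr_ge0// mulr_ge0// ltW.
  have [u2|u2] := leP `|u| 2.
    by apply: (le_trans (approx_near b1 mM me CD0 cE CDE pM u2)); rewrite ler_wpM2r// lerDl.
  by apply: (le_trans (approx_far b1 mM me _ pM u2)); rewrite ler_wpM2r// lerDr ltW.
move=> s a T B small aB mT.
have b0 : 0 < b by exact: lt_le_trans b1.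
have E N : LE s a N (approx M m b c) =
  - (cint (-3) 3 (fun y => sinc (b * y) ^+ m))^-1 * \sum_(k < M) c k * (k.+1%:R^-1 * LE s a N (conv m b k)).
  rewrite /LE /approx; under eq_bigr do rewrite -mulrDr -big_split/= mulrCA.
  rewrite -mulr_sumr; congr (_ * _).
  under eq_bigr do rewrite mulr_sumr.
  rewrite exchange_big/=; apply: eq_bigr => k _; rewrite !mulr_sumr.
  apply: eq_bigr => j _.
  by move: (conv _ _ _ (s j)) (conv _ _ _ (- s j)) (k.+1%:R^-1) => x y z; ring.
under eq_fun do rewrite E.
apply: cvg0Z; apply: cvg0_sum => k; apply: cvg0Z; apply: cvg0Z.
apply: (band_conv small aB); last exact: cont_brm.
  by rewrite divr_ge0// ltW.
apply: le_lt_trans mT; rewrite ler_wpM2l// ler_pdivrMr//.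
by rewrite ler_peMr ?(ltW b0)// ler1n.
Qed.

End Approximation.

(** * Kernel bound *)

Section Counting.
Variable R : realType.

Let psum_step (z w h : R) : 0 <= z -> 0 < h -> z + h <= w ->
  h * ((1 + w) ^+ 2)^-1 <= (1 + z)^-1 - (1 + w)^-1.
Proof.
move=> z0 h0 zw; have z1 : 0 < 1 + z by lra.
have w1 : 0 < 1 + w by lra.
have -> : (1 + z)^-1 - (1 + w)^-1 = (w - z) * ((1 + z) * (1 + w))^-1.
  by field; rewrite !gt_eqF.
apply: ler_pM; [exact: ltW|by rewrite invr_ge0 sqr_ge0|lra|].
rewrite lef_pV2 ?posrE ?mulr_gt0 ?exprn_gt0// expr2 ler_pM2r//; lra.
Qed.

(** Comparison with a telescoping sum: h / (1 + w)^2 <= 1/(1 + z) - 1/(1 + w) as soon as w >= z + h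
    and z >= 0. *)
Lemma separated_sum (z : nat -> R) (h : R) N : 0 < h ->
  (forall j, z j + h <= z j.+1) ->
  \sum_(j < N) ((1 + `|z j|) ^+ 2)^-1 <= 2 + 2 / h.
Proof.
move=> h0 zh; pose f j := ((1 + `|z j|) ^+ 2)^-1.
have f0 j : 0 <= f j by rewrite invr_ge0 sqr_ge0.
have f1 j : f j <= 1.
  by rewrite /f invf_le1 ?exprn_gt0 ?ltr_pwDl// exprn_ege1// lerDl.
(* The two branches describe the sum before and after z changes sign. The two terms next to the sign
   change cost h each, and each one-sided telescope at most 1. *)
have key n : h * \sum_(j < n.+1) f j <=
    if z n <= 0 then h * f n + (1 - z n)^-1 else 2 * h + 2 - (1 + z n)^-1.
  elim: n => [|n ih].
    rewrite big_ord_recr big_ord0/= add0r; case: ifPn => [z0|].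
      by rewrite lerDl invr_ge0; lra.
    rewrite -ltNge => z0; have := ler_wpM2l (ltW h0) (f1 0%N).
    have : (1 + z 0%N)^-1 <= 1 by rewrite invf_le1; lra.
    lra.
  rewrite big_ord_recr/= mulrDr; have hf := ler_wpM2l (ltW h0) (f1 n).
  have hf' := ler_wpM2l (ltW h0) (f1 n.+1); have zn := zh n.
  move: ih; case: ifPn => [zn0|]; case: ifPn => [zn1|].
  - have st : h * f n <= (1 - z n.+1)^-1 - (1 - z n)^-1.
      rewrite /f ler0_norm//; apply: psum_step; lra.
    lra.
  - rewrite -ltNge => zn1 ih.
    have : (1 - z n)^-1 <= 1 by rewrite invf_le1; lra.
    have : (1 + z n.+1)^-1 <= 1 by rewrite invf_le1; lra.
    lra.
  - by rewrite -ltNge => zn0; lra.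
  - rewrite -!ltNge => zn0 ih.
    have st : h * f n.+1 <= (1 + z n)^-1 - (1 + z n.+1)^-1.
      by rewrite /f gtr0_norm//; apply: psum_step => //; exact: ltW.
    lra.
have h2 : 0 <= 2 / h by rewrite divr_ge0// ltW.
case: N => [|n]; first by rewrite big_ord0; lra.
rewrite -(ler_pM2l h0) mulrDr mulrCA mulfV ?gt_eqF// mulr1.
have hf := ler_wpM2l (ltW h0) (f1 n).
apply: (le_trans (key n)); case: ifPn => [zn|].
  by have : (1 - z n)^-1 <= 1 by [rewrite invf_le1; lra]; lra.
by rewrite -ltNge => zn; have : 0 <= (1 + z n)^-1 by [rewrite invr_ge0; lra]; lra.
Qed.

End Counting.

(** * Localised test functions of integral one *)

Section Bump.
Variable R : realType.
Implicit Types (x t z eps : R).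

Let pp z : R := (z + `|z|) / 2.

Let isd_pp2 z : isd (fun z => pp z ^+ 2) z (2 * pp z).
Proof.
have [z0|z0|->] := ltgtP z 0.
- apply: (@isd_near _ (fun=> 0)).
    near=> w; have w0 : w < 0 by near: w; exact: lt_nbhsl.
    by rewrite /pp ltr0_norm// subrr mul0r expr0n.
  by rewrite /pp (ltr0_norm z0) subrr mul0r mulr0; exact: isdC.
- apply: (@isd_near _ (fun z => z ^+ 2)).
    near=> w; have w0 : 0 < w by near: w; exact: lt_nbhsr.
    by rewrite /pp gtr0_norm//; congr (_ ^+ 2); lra.
  rewrite /pp (gtr0_norm z0); apply: isd_eq.
    by apply: isdX; exact: isdI.
  by rewrite /=; lra.
- have H : h^-1 *: (pp (h *: 1 + 0) ^+ 2 - pp 0 ^+ 2) @[h --> (0 : R)^'] --> (2 * pp 0 : R).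
    rewrite /pp normr0 addr0 mul0r mulr0 expr0n.
    apply/cvgrPdist_le => e e0; near=> h.
    have he : `|h| <= e by near: h; apply: dnbhs0_le.
    have h0 : h != 0 by near: h; exact: nbhs_dnbhs_neq.
    rewrite sub0r normrN subr0 addr0 /GRing.scale/= mulr1 normrM.
    have p : `|(h + `|h|) / 2| <= `|h|.
      rewrite ger0_norm; first by have := ler_norm h; lra.
      by have := ler_norm (- h); rewrite normrN; lra.
    rewrite normrX normfV ler_pdivrMl ?normr_gt0//.
    apply: (@le_trans _ _ (`|h| ^+ 2)); first by rewrite lerXn2r ?nnegrE.
    by rewrite expr2 ler_wpM2l.
  by apply: DeriveDef; [exact: cvgP H|exact: cvg_lim H].
Unshelve. all: by end_near. Qed.

Variables (W : R -> R) (cW : continuous W) (W_ge0 : forall x, 0 <= W x) (W0 : forall x, 0 < x -> 0 < W x).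

(** The square of the positive part of eps^2 - (t - x)^2, normalised against the weight; it has
    exactly the C1 regularity that finite propagation asks for. *)
Lemma bump_exists x eps : 0 < eps -> eps < x -> x + eps < 1 -> exists h dh : R -> R,
  [/\ forall t, isd h t (dh t), continuous dh, forall t, 0 <= h t,
      forall t, eps <= `|t - x| -> h t = 0 & cint 0 1 (fun t => h t * W t) = 1].
Proof.
move=> e0 ex x1; pose q t := eps ^+ 2 - (t - x) ^+ 2.
pose h0 t := pp (q t) ^+ 2; pose dh0 t := 2 * pp (q t) * (- (2 * (t - x))).
have dq t : isd q t (- (2 * (t - x))).
  apply: isd_eq.
    by apply: isdB; [exact: isdC|apply: isdX; apply: isdB; [exact: isdI|exact: isdC]].
  by rewrite /=; ring.
have dh t : isd h0 t (dh0 t).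
  by apply: (@isd_comp _ (fun z => pp z ^+ 2) q); [exact: isd_pp2|exact: dq].
have cq : continuous q by rewrite -[q]/(fun t => eps ^+ 2 - (t - x) ^+ 2); cont.
have cpq : continuous (fun t => pp (q t)).
  by rewrite /pp; apply: contM; [apply: contD; [|exact: cont_norm]|]; cont.
have ch0 : continuous h0 by apply: contX.
have cdh0 : continuous dh0.
  by apply: contM; [apply: contM; [exact: contC|exact: cpq]|cont].
have ch0W : continuous (fun t => h0 t * W t) by apply: contM.
have h00 t : 0 <= h0 t by exact: sqr_ge0.
have hout t : eps <= `|t - x| -> h0 t = 0.
  move=> H; rewrite /h0 /pp ler0_norm ?subrr ?mul0r ?expr0n//.
  by rewrite /q subr_le0 -[(t - x) ^+ 2]real_normK ?num_real// lerXn2r ?nnegrE// ltW.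
pose Z := cint 0 1 (fun t => h0 t * W t).
have Z0 : 0 < Z.
  have [l l0 Hl] : exists2 l, 0 < l & forall t, x - eps / 2 <= t <= x + eps / 2 -> l <= h0 t * W t.
    have lu : x - eps / 2 <= x + eps / 2 by lra.
    have [c cin Hc] := EVT_min lu (continuous_subspaceT ch0W).
    exists (h0 c * W c); last by move=> t tin; apply: Hc; rewrite in_itv.
    move: cin; rewrite in_itv/= => /andP[c1 c2].
    rewrite mulr_gt0// ?W0//; last by lra.
    have qc : 0 < q c.
      rewrite /q subr_gt0 -[(c - x) ^+ 2]real_normK ?num_real// ltrXn2r ?nnegrE ?(ltW e0)//.
      by rewrite ltr_norml; apply/andP; split; lra.
    by rewrite /h0 /pp gtr0_norm// exprn_gt0//; lra.
  have i1 : 0 <= x - eps / 2 <= 1 by apply/andP; split; lra.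
  have i2 : x - eps / 2 <= x + eps / 2 <= 1 by apply/andP; split; lra.
  have lu : x - eps / 2 <= x + eps / 2 by lra.
  rewrite /Z (cint_split i1 ch0W) (cint_split i2 ch0W).
  have nn u v : 0 <= u -> 0 <= cint u v (fun t => h0 t * W t).
    by move=> u0; apply: cint_ge0 => t _; rewrite mulr_ge0.
  have n1 := nn 0 (x - eps / 2) (lexx 0).
  have n2 : 0 <= cint (x + eps / 2) 1 (fun t => h0 t * W t) by apply: nn; lra.
  suff : 0 < cint (x - eps / 2) (x + eps / 2) (fun t => h0 t * W t) by lra.
  apply: (@lt_le_trans _ _ (cint (x - eps / 2) (x + eps / 2) (fun=> l))).
    by rewrite cint_cst// mulr_gt0//; lra.
  by apply: le_cint => //; exact: contC.
exists (fun t => Z^-1 * h0 t), (fun t => Z^-1 * dh0 t); split.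
- by move=> t; exact: isdZ.
- by apply: contM; [exact: contC|].
- by move=> t; rewrite mulr_ge0// invr_ge0 ltW.
- by move=> t /hout ->; rewrite mulr0.
- transitivity (cint 0 1 (fun t => Z^-1 * (h0 t * W t))).
    by apply: eq_cint => t _; rewrite -mulrA.
  by rewrite cintZ// -/Z mulVf// gt_eqF.
Qed.

Lemma bump_avg x eps (h phi : R -> R) c M : continuous h -> continuous phi ->
  (forall t, 0 <= h t) -> (forall t, eps <= `|t - x| -> h t = 0) ->
  cint 0 1 (fun t => h t * W t) = 1 ->
  (forall t, `|t - x| < eps -> `|phi t - c| <= M) ->
  `|cint 0 1 (fun t => h t * phi t * W t) - c| <= M.
Proof.
move=> ch cphi h0 hout h1 phic.
have chW : continuous (fun t => h t * W t) by exact: contM.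
have -> : cint 0 1 (fun t => h t * phi t * W t) - c = cint 0 1 (fun t => (phi t - c) * (h t * W t)).
  rewrite (@eq_cint _ _ _ (fun t => (phi t - c) * (h t * W t)) (fun t => h t * phi t * W t - c * (h t * W t))).
    rewrite cintB; last 2 first.
    - by apply: contM => //; exact: contM.
    - by apply: contM => //; exact: contC.
    by rewrite cintZ// h1 mulr1.
  by move=> t _; ring.
have cpc : continuous (fun t => (phi t - c) * (h t * W t)).
  by apply: contM => //; apply: contD => //; exact: contC.
apply: (le_trans (cint_norm _ _ cpc)).
have -> : M = cint 0 1 (fun t => M * (h t * W t)) by rewrite cintZ// h1 mulr1.
apply: le_cint; [exact: cont_norm|by apply: contM => //; exact: contC|].
move=> t /andP[t0 t1]; rewrite normrM (ger0_norm (mulr_ge0 (h0 t) (W_ge0 t))).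
have [te|te] := leP eps `|t - x|; first by rewrite hout// mul0r !mulr0.
by rewrite ler_wpM2r ?phic// mulr_ge0.
Qed.

End Bump.

(** * Pointwise bound for the Bochner-Riesz kernel *)

Section KernelBound.
Variable R : realType.
Variables (nu delta : R) (s : nat -> R).
Hypothesis nu_gt : - (1 / 2) < nu.
Hypothesis zs : bessel_zeros nu s.
Hypothesis d0 : 0 < delta.
Implicit Types (x y t b Rad : R) (j J N : nat).

Local Notation al := (nu + 1 / 2).
Local Notation W := (Wt nu).
Local Notation e := (ef nu s).
Local Notation a := (fcoef nu s).

Let al0 : 0 < al. Proof. by move: nu_gt; lra. Qed.

Definition wgt Rad x := Num.min (Rad `^ al) ((x `^ al)^-1).

Definition BRkernel Rad J x y := \sum_(j < J) brm delta (s j / Rad) * (e j x * e j y).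

Lemma wgt_gt0 Rad x : 0 < Rad -> 0 < x -> 0 < wgt Rad x.
Proof. by move=> R0 x0; rewrite /wgt lt_min powR_gt0//= invr_gt0 powR_gt0. Qed.

Lemma wgt_half Rad x t : 0 < Rad -> 0 < x -> x / 2 <= t -> wgt Rad t <= 2 `^ al * wgt Rad x.
Proof.
move=> R0 x0 xt; have p2 : 1 <= 2 `^ al :> R.
  have := @ler_powR R 2 _ 0 al (ltW al0); rewrite powRr0; apply; lra.
have t0 : 0 < t by lra.
rewrite /wgt; case: (leP (Rad `^ al) ((x `^ al)^-1)) => _.
  by rewrite ge_min ler_peMl ?powR_ge0.
rewrite ge_min; apply/orP; right.
rewrite -[2 `^ al]invrK -invfM lef_pV2 ?posrE ?mulr_gt0 ?invr_gt0 ?powR_gt0//.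
rewrite mulrC ler_pdivrMr ?powR_gt0// -(powRM _ (ltW t0) (ler0n _ 2)).
by apply: ge0_ler_powR; rewrite ?nnegrE ?(ltW al0) ?(ltW x0) ?mulr_ge0 ?(ltW t0)//; lra.
Qed.

(** Since s_j <= R (1 + |1 - s_j/R|), the power s_j^al may be replaced by R^al at the price of a
    polynomial factor, which the decay of the multiplier error absorbs. *)
Lemma ef_wgt : exists2 C : R, 0 < C & forall j x Rad b, 0 < x -> 0 < Rad -> 1 <= b ->
  `|e j x| <= C * wgt Rad x * (1 + b * `|1 - s j / Rad|) `^ al.
Proof.
have [C C0 HC] := ef_bound nu_gt zs; exists C => // j x Rad b x0 R0 b1.
have [H1 H2] := HC j x x0; set r := `|1 - s j / Rad|.
have r0 : 0 <= r by exact: normr_ge0.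
have br : r <= b * r by rewrite ler_peMl.
have sR : s j <= Rad * (1 + b * r).
  apply: (@le_trans _ _ (Rad * (1 + r))); last by rewrite ler_pM2l// lerD2l.
  rewrite mulrC -ler_pdivrMr//; have := ler_norm (- (1 - s j / Rad)).
  by rewrite normrN -/r; lra.
have br0 : 0 <= 1 + b * r by lra.
have br1 : 1 <= 1 + b * r by lra.
rewrite /wgt; case: (leP (Rad `^ al) ((x `^ al)^-1)) => _.
  apply: (le_trans H1); rewrite -mulrA ler_pM2l// -(powRM _ (ltW R0) br0).
  apply: ge0_ler_powR => //; first exact: ltW.
    by rewrite nnegrE ltW// (s_gt0 zs).
  by rewrite nnegrE mulr_ge0// ltW.
apply: (le_trans H2); rewrite ler_peMr ?mulr_ge0 ?invr_ge0 ?powR_ge0 ?(ltW C0)//.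
by have := ler_powR br1 (ltW al0); rewrite powRr0.
Qed.

Let bN Rad j (b : R) := 1 + b * `|1 - s j / Rad|.

(** Compares the sum with the same sum for [F], which tends to 0. As p >= 2 al + 2, the error factor
    of exponent -p absorbs the growth of the [c j] and leaves inverse squares at the points
    (b/R)(s_j - R), which are separated by b g / R. *)
Lemma multiplier_sum : exists2 g : R, 0 < g &
  forall (c : nat -> R) (A CF b Rad : R) (p J : nat) (F : R -> R),
  0 < Rad -> 1 <= b -> 0 <= A -> 0 <= CF -> 2 * al + 2 <= p%:R ->
  (forall j, `|c j| <= A * (1 + b * `|1 - s j / Rad|) `^ (2 * al)) ->
  (forall u, `|brm delta u - F u| <= CF * (b `^ (- delta) * (1 + b * `|1 - `|u| |) ^- p)) ->
  LE (fun j => s j / Rad) c N F @[N --> \oo] --> (0 : R) -> Rad <= s J ->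
  `|\sum_(j < J) brm delta (s j / Rad) * c j| <=
    A * (CF * b `^ (- delta)) * (2 + 2 * Rad / (b * g)).
Proof.
have [g g0 sg] := s_spacing nu_gt zs; exists g => //.
move=> c A CF b Rad p J F R0 b1 A0 CF0 pal cA FC LE0 RJ.
have b0 : 0 < b by exact: lt_le_trans b1.
pose q := A * (CF * b `^ (- delta)).
have bd : 0 <= b `^ (- delta) by exact: powR_ge0.
have q0 : 0 <= q by rewrite /q !mulr_ge0.
have uj j : 0 < s j / Rad by rewrite divr_gt0// (s_gt0 zs).
have term j : `|c j| * (CF * (b `^ (- delta) * (bN Rad j b) ^- p)) <= q * ((1 + `|b / Rad * (s j - Rad)|) ^+ 2)^-1.
  have -> : `|b / Rad * (s j - Rad)| = b * `|1 - s j / Rad|.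
    rewrite -{2}(gtr0_norm b0) -normrM -normrN; congr `|_|.
    by field; rewrite gt_eqF.
  rewrite -/(bN Rad j b); have t1 : 1 <= bN Rad j b by rewrite lerDl mulr_ge0// ltW.
  have := cA j; rewrite -/(bN Rad j b); move: (bN Rad j b) t1 => t t1 ct.
  have t0 : 0 < t by exact: lt_le_trans t1.
  apply: (@le_trans _ _ (A * t `^ (2 * al) * (CF * (b `^ (- delta) * t ^- p)))).
    by rewrite ler_wpM2r// !mulr_ge0// invr_ge0 exprn_ge0// ltW.
  rewrite [leLHS](_ : _ = q * (t `^ (2 * al) * t ^- p)); last by rewrite /q; ring.
  rewrite ler_wpM2l// ler_pdivrMr ?exprn_gt0// [leRHS]mulrC ler_pdivlMr ?exprn_gt0//.
  rewrite -!powR_mulrn ?(ltW t0)// -powRD ?(gt_eqF t0) ?implybT//.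
  exact: ler_powR.
have cnt N : \sum_(j < N) ((1 + `|b / Rad * (s j - Rad)|) ^+ 2)^-1 <= 2 + 2 * Rad / (b * g).
  have h0 : 0 < b / Rad * g by rewrite mulr_gt0// divr_gt0.
  rewrite (_ : 2 * Rad / (b * g) = 2 / (b / Rad * g)); last by field; rewrite !gt_eqF.
  apply: (@separated_sum _ (fun j => b / Rad * (s j - Rad)) _ N h0) => j.
  by rewrite -mulrDr ler_pM2l ?divr_gt0//; have := sg j; lra.
have eqJ N : (J <= N)%N -> \sum_(j < N) brm delta (s j / Rad) * c j = \sum_(j < J) brm delta (s j / Rad) * c j.
  move=> JN; rewrite -!(big_mkord xpredT (fun j => brm delta (s j / Rad) * c j)).
  rewrite (big_cat_nat _ JN)//= [X in _ + X]big_nat_cond [X in _ + X]big1 ?addr0//.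
  move=> j /andP[/andP[Jj _] _]; rewrite (brm_out d0) ?mul0r//.
  rewrite gtr0_norm// ler_pdivlMr// mul1r; apply: le_trans RJ _.
  exact: (s_le zs).
set S := \sum_(j < J) _.
have main N : (J <= N)%N -> 2 * `|S| <= 2 * (q * (2 + 2 * Rad / (b * g))) + `|LE (fun j => s j / Rad) c N F|.
  move=> JN; rewrite /S -(eqJ _ JN).
  have -> : 2 * `|\sum_(j < N) brm delta (s j / Rad) * c j| = `|\sum_(j < N) c j * (brm delta (s j / Rad) + brm delta (- (s j / Rad)))|.
    rewrite -{1}(ger0_norm (ler0n R 2)) -normrM mulr_sumr; congr `|_|; apply: eq_bigr => j _.
    by rewrite /brm sqrrN; ring.
  set X := LE _ _ _ _; set Y := \sum_(j < N) _.
  rewrite -[Y](subrK X); apply: (le_trans (ler_normD _ _)); rewrite lerD2r /Y /X /LE -sumrB.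
  apply: (le_trans (ler_norm_sum _ _ _)).
  apply: (@le_trans _ _ (\sum_(j < N) 2 * (q * ((1 + `|b / Rad * (s j - Rad)|) ^+ 2)^-1))); last first.
    by rewrite -!mulr_sumr ler_pM2l// ler_wpM2l.
  apply: ler_sum => j _; rewrite -mulrBr normrM.
  apply: (@le_trans _ _ (2 * (`|c j| * (CF * (b `^ (- delta) * (bN Rad j b) ^- p))))); last by rewrite ler_pM2l.
  rewrite mulrCA ler_wpM2l//.
  have := FC (s j / Rad); have := FC (- (s j / Rad)); rewrite normrN (gtr0_norm (uj j)).
  rewrite -/(bN Rad j b); move: (F _) (F _) (brm _ _) (brm _ _) => f1 f2 f3 f4 h1 h2.
  rewrite [X in `|X|](_ : _ = (f4 - f2) + (f3 - f1)); last by ring.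
  by apply: (le_trans (ler_normD _ _)); rewrite mulr2n mulrDl mul1r lerD.
rewrite -/q -(ler_pM2l (ltr0n R 2)); apply/ler_addgt0Pr => eta eta0.
have /cvgrPdist_le /(_ eta eta0) [N0 _ HN] := LE0.
have := HN (maxn J N0) (leq_maxr _ _); have := main (maxn J N0) (leq_maxl _ _).
by rewrite /= sub0r normrN => h1 h2; apply: (le_trans h1); rewrite lerD2l.
Qed.


Lemma mean_cB (h g : R -> R) : continuous h -> continuous g -> exists B, forall N,
  \sum_(j < N) `|a j h * a j g| <= B.
Proof.
move=> ch cg.
exists (cint 0 1 (fun x => h x ^+ 2 * W x) + cint 0 1 (fun x => g x ^+ 2 * W x)) => N.
apply: (@le_trans _ _ (\sum_(j < N) (a j h ^+ 2 + a j g ^+ 2))).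
  apply: ler_sum => j _; rewrite normrM -[a j h ^+ 2]real_normK ?num_real// -[a j g ^+ 2]real_normK ?num_real//.
  have := sqr_ge0 (`|a j h| - `|a j g|); rewrite sqrrB.
  have := sqr_ge0 `|a j h|; have := sqr_ge0 `|a j g|; lra.
by rewrite big_split/=; apply: lerD; apply: (bessel_ineq nu_gt zs).
Qed.

Let cW : continuous W. Proof. exact: cont_Wt. Qed.

(** Approximates e_j(x) and e_j(y) by pairings with bumps whose radii tend to 0. The bounds are
    uniform in n and so survive in the limit, while the supports stay within eps of x and y. *)
Lemma kernel_bumps : exists2 C : R, 0 < C & forall x y eps, 0 < x < 1 -> 0 < y < 1 -> 0 < eps ->
  exists h g : nat -> R -> R,
  [/\ (forall n, exists2 dh, C1 (h n) dh & continuous (g n)),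
     (forall n t, eps <= `|t - x| -> h n t = 0) /\ (forall n t, eps <= `|t - y| -> g n t = 0),
     (forall n j Rad b, 0 < Rad -> 1 <= b ->
        `|a j (h n) * a j (g n)| <= C * (wgt Rad x * wgt Rad y) * (1 + b * `|1 - s j / Rad|) `^ (2 * al)) &
     (forall j, a j (h n) * a j (g n) @[n --> \oo] --> e j x * e j y)].
Proof.
have [C C0 HC] := ef_wgt.
exists ((C * 2 `^ al) ^+ 2); first by rewrite exprn_gt0// mulr_gt0// powR_gt0.
have W0 (x : R) : 0 <= W x by exact: Wt_ge0.
have Wp (x : R) : 0 < x -> 0 < W x by exact: Wt_gt0.
have one x eps : 0 < x < 1 -> 0 < eps -> exists h dh : nat -> R -> R,
    [/\ forall n, C1 (h n) (dh n), forall n t, eps <= `|t - x| -> h n t = 0,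
     forall n j Rad b, 0 < Rad -> 1 <= b ->
        `|a j (h n)| <= C * 2 `^ al * wgt Rad x * (1 + b * `|1 - s j / Rad|) `^ al &
     forall j, a j (h n) @[n --> \oo] --> e j x].
  (* The radius x / 2 keeps the bump where [wgt] is comparable with its value at x, and (1 - x) / 2
     keeps it away from the endpoint 1. *)
  move=> /andP[x0 x1] eps0; pose e0 := Num.min eps (Num.min (x / 2) ((1 - x) / 2)).
  have e00 : 0 < e0 by rewrite /e0 !lt_min eps0 !divr_gt0// subr_gt0.
  have e01 : e0 <= eps by rewrite /e0 ge_min lexx.
  have e02 : e0 <= x / 2 by rewrite /e0 !ge_min lexx orbT.
  have e03 : e0 <= (1 - x) / 2 by rewrite /e0 !ge_min lexx !orbT.
  pose ep n := e0 * harmonic n.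
  have ep0 n : 0 < ep n by rewrite mulr_gt0//= invr_gt0.
  have ep1 n : ep n <= e0 by rewrite ler_piMr ?(ltW e00)//= invf_le1// ler1n.
  have bx n : exists hd : (R -> R) * (R -> R), [/\ forall t, isd hd.1 t (hd.2 t), continuous hd.2,
      forall t, 0 <= hd.1 t, forall t, ep n <= `|t - x| -> hd.1 t = 0 & cint 0 1 (fun t => hd.1 t * W t) = 1].
    have x2 : ep n < x by have := ep1 n; lra.
    have x3 : x + ep n < 1 by have := ep1 n; lra.
    by have [h [dh H]] := bump_exists cW W0 Wp (ep0 n) x2 x3; exists (h, dh).
  have [hd Hhd] := choice bx.
  have ch n : continuous (hd n).1.
    by case: (Hhd n) => H _ _ _ _ t; exact: isd_continuous (H t).
  exists (fun n => (hd n).1), (fun n => (hd n).2); split.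
  - move=> n; case: (Hhd n) => H1 H2 _ H4 _; split=> //.
    apply: H4; rewrite gtr0_norm ?subr_gt0//; have := ep1 n; lra.
  - move=> n t te; case: (Hhd n) => _ _ _ H4 _; apply: H4.
    by rewrite (le_trans (ep1 n))// (le_trans e01).
  - move=> n j Rad b R0 b1; case: (Hhd n) => _ _ H3 H4 H5.
    rewrite /fcoef -[cint _ _ _]subr0.
    apply: (bump_avg cW W0 (ch n) _ H3 H4 H5); first exact: cont_ef.
    move=> t te; rewrite subr0.
    have xt : x / 2 <= t.
      by have := ep1 n; move: te; rewrite ltr_norml => /andP[h _]; lra.
    have t0 : 0 < t by lra.
    apply: (le_trans (HC j t Rad b t0 R0 b1)); rewrite ler_wpM2r ?powR_ge0// -[leRHS]mulrA.
    by rewrite ler_pM2l// wgt_half.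
  - move=> j; apply/cvgrPdist_le => eta eta0.
    have /cvgrPdist_le /(_ eta eta0) /nbhs_ballP[r /= r0 Hr] := @cont_ef _ nu s nu_gt j x.
    have epc : ep n @[n --> \oo] --> (0 : R) by apply: cvg0Z; exact: cvg_harmonic.
    have /cvgrPdist_lt /(_ r r0) := epc; apply: filterS => n.
    rewrite sub0r normrN (gtr0_norm (ep0 n)) => enr; case: (Hhd n) => _ _ H3 H4 H5.
    rewrite distrC /fcoef; apply: (bump_avg cW W0 (ch n) _ H3 H4 H5); first exact: cont_ef.
    by move=> t te; rewrite distrC; apply: Hr; rewrite /ball/= distrC (lt_trans te).
move=> x y eps x01 y01 eps0.
have [h [dh [h1 h2 h3 h4]]] := one x eps x01 eps0.
have [g [dg [g1 g2 g3 g4]]] := one y eps y01 eps0.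
exists h, g; split=> //.
- by move=> n; exists (dh n) => //; exact: C1_cont (g1 n).
- move=> n j Rad b R0 b1; rewrite normrM.
  have t0 : 0 <= b * `|1 - s j / Rad| by rewrite mulr_ge0//; lra.
  have t1 : 0 < 1 + b * `|1 - s j / Rad| by lra.
  have al2 : (1 + b * `|1 - s j / Rad|) `^ (2 * al) = (1 + b * `|1 - s j / Rad|) `^ al * (1 + b * `|1 - s j / Rad|) `^ al.
    by rewrite -powRD ?(gt_eqF t1) ?implybT//; congr (_ `^ _); ring.
  rewrite al2.
  have := h3 n j Rad b R0 b1; have := g3 n j Rad b R0 b1.
  move: (wgt _ _) (wgt _ _) (2 `^ al) ((1 + _) `^ al) => u2 u3 u4 u1 q1 q2.
  rewrite [leRHS](_ : _ = (C * u4 * u2 * u1) * (C * u4 * u3 * u1)); last by ring.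
  exact: ler_pM.
- by move=> j; apply: cvgM; [exact: h4|exact: g4].
Qed.


Lemma kernel_bound : exists2 C : R, 0 < C & forall Rad J x y,
  s 0%N <= Rad -> Rad <= s J -> 0 < x < 1 -> 0 < y < 1 ->
  `|BRkernel Rad J x y| <=
    C * (Rad * (1 + Rad * `|x - y|) `^ (- (1 + delta))) * (wgt Rad x * wgt Rad y).
Proof.
have [C1 C10 H1] := ef_wgt; have [C2 C20 H2] := kernel_bumps.
have [g g0 Hm] := multiplier_sum.
pose p := (Num.bound (2 * al + 2)).
have pal : 2 * al + 2 <= p%:R by apply: ltW; apply: archi_boundP; move: al0; lra.
have [m [CF CF0 HF]] := brm_approx d0 p.
have s0 := s_gt0 zs 0.
pose A := C1 ^+ 2 + C2; have A0 : 0 < A by rewrite addr_gt0// exprn_gt0.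
pose CG := CF + 2 ^+ p; have CG0 : 0 < CG by rewrite addr_gt0// exprn_gt0.
(* With b = R d / L the band m b stays below 2 (m + 1) b = R d / 2. Bumps of radius d / 4 leave a
   gap d / 2 between their supports, so finite speed covers this band. *)
pose L := 4 * m.+1%:R : R.
have L1 : 1 <= L by rewrite /L; have : 1 <= m.+1%:R :> R by [rewrite ler1n]; lra.
have L0 : 0 < L by lra.
pose C3 := (2 * (1 + (s 0)^-1) + 2 / g) * (1 + L) `^ (1 + delta).
have s0i : 0 < (s 0)^-1 by rewrite invr_gt0.
have g2 : 0 < 2 / g by rewrite divr_gt0.
have C30 : 0 < C3 by rewrite mulr_gt0 ?powR_gt0//; lra.
exists (A * CG * C3); first by rewrite (mulr_gt0 (mulr_gt0 A0 CG0) C30).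
(* The count 2 + 2 R / (b g) is of order R / b because b is at most a multiple of R, and the last
   condition bounds b below by a multiple of 1 + R d. The constant with s_0 admits b = 1 even for R
   close to s_0. *)
have final b Rad d : 1 <= b -> 0 < Rad -> b <= (1 + (s 0)^-1) * Rad -> 0 <= d -> 1 + Rad * d <= (1 + L) * b ->
    b `^ (- delta) * (2 + 2 * Rad / (b * g)) <= C3 * (Rad * (1 + Rad * d) `^ (- (1 + delta))).
  move=> b1 R0 bR dd0 db; have b0 : 0 < b by exact: lt_le_trans b1.
  have Rd0 : 0 < 1 + Rad * d by rewrite ltr_pwDl// mulr_ge0// ltW.
  have h1 : 2 + 2 * Rad / (b * g) <= (2 * (1 + (s 0)^-1) + 2 / g) * (Rad / b).
    rewrite [leRHS](_ : _ = 2 * (1 + (s 0)^-1) * (Rad / b) + 2 / g * (Rad / b)); last by ring.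
    rewrite lerD//; last by rewrite le_eqVlt; apply/orP; left; apply/eqP; field; rewrite !gt_eqF.
    by rewrite -mulrA ler_peMr// mulrA ler_pdivlMr// mul1r.
  apply: (@le_trans _ _ (b `^ (- delta) * ((2 * (1 + (s 0)^-1) + 2 / g) * (Rad / b)))).
    by rewrite ler_wpM2l ?powR_ge0.
  have h2 : b `^ (- (1 + delta)) <= (1 + L) `^ (1 + delta) * (1 + Rad * d) `^ (- (1 + delta)).
    have L10 : 0 < 1 + L by lra.
    rewrite !powRN ler_pdivlMr ?powR_gt0// mulrC ler_pdivrMr ?powR_gt0//.
    rewrite -(powRM _ (ltW L10) (ltW b0)).
    by apply: ge0_ler_powR; rewrite ?nnegrE ?(ltW Rd0) ?(mulr_ge0 (ltW L10) (ltW b0))//; move: d0; lra.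
  have h3 : b `^ (- delta) / b = b `^ (- (1 + delta)).
    rewrite !powRN powRD ?(gt_eqF b0) ?implybT// (powRr1 (ltW b0)) invfM mulrC; ring.
  have u0 : 0 <= 2 * (1 + (s 0)^-1) + 2 / g by lra.
  have {}h2 := ler_wpM2l (mulr_ge0 u0 (ltW R0)) h2.
  rewrite -h3 in h2; apply: le_trans (le_trans h2 _).
    by rewrite le_eqVlt; apply/orP; left; apply/eqP; field; rewrite !gt_eqF.
  by rewrite /C3 le_eqVlt; apply/orP; left; apply/eqP; ring.
move=> Rad J x y sR RJ; wlog xy : x y / x <= y.
  move=> H; have [xy|yx] := leP x y; first exact: H.
  move=> x01 y01; have := H y x (ltW yx) y01 x01.
  rewrite distrC [wgt _ y * _]mulrC; apply: le_trans.
  rewrite /BRkernel (eq_bigr (fun j : 'I_J => brm delta (s j / Rad) * (e j y * e j x)))// => j _.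
  by rewrite [e j x * _]mulrC.
move=> x01 y01; have R0 : 0 < Rad by exact: lt_le_trans sR.
have /andP[x0 x1] := x01; have /andP[y0 y1] := y01.
set d := `|x - y|; have dE : d = y - x by rewrite /d distrC ger0_norm// subr_ge0.
have d00 : 0 <= d by exact: normr_ge0.
have w0 : 0 <= wgt Rad x * wgt Rad y by rewrite mulr_ge0// ltW// wgt_gt0.
have wrap (S b : R) : 1 <= b -> b <= (1 + (s 0)^-1) * Rad -> 1 + Rad * d <= (1 + L) * b ->
    `|S| <= A * (wgt Rad x * wgt Rad y) * (CG * b `^ (- delta)) * (2 + 2 * Rad / (b * g)) ->
    `|S| <= A * CG * C3 * (Rad * (1 + Rad * d) `^ (- (1 + delta))) * (wgt Rad x * wgt Rad y).
  move=> b1 bR db /le_trans; apply.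
  have q0 : 0 <= A * CG * (wgt Rad x * wgt Rad y) by rewrite mulr_ge0// ltW// mulr_gt0.
  have := ler_wpM2l q0 (final b Rad d b1 R0 bR d00 db).
  move: (wgt _ _) (wgt _ _) (_ `^ _) (_ `^ _) (2 + _) => u1 u2 u3 u4 u5 h.
  rewrite [leLHS](_ : _ = A * CG * (u2 * u1) * (u4 * u5)); last by ring.
  by apply: (le_trans h); rewrite le_eqVlt; apply/orP; left; apply/eqP; ring.
have Ri : 1 <= (s 0)^-1 * Rad by rewrite mulrC ler_pdivlMr// mul1r.
(* At distances of order 1 / R absolute values suffice: b = 1 with the zero approximant. *)
have [bs|bs] := leP (Rad * d / L) 1.
  apply: (wrap _ 1) => //.
  - by rewrite mulrDl mul1r; lra.
  - by move: bs; rewrite ler_pdivrMr//; lra.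
  (* The multiplier is at most 1 and vanishes for |u| >= 1; for |u| < 1 the base is at most 2. This
     is the source of 2^p in [CG]. *)
  have FC (u : R) : `|brm delta u - 0| <= CG * (1 `^ (- delta) * (1 + 1 * `|1 - `|u| |) ^- p).
    have t0 : 0 < 1 + `|1 - `|u| | by rewrite ltr_pwDl.
    rewrite subr0 powR1 !mul1r (ger0_norm (brm_ge0 _ _)) ler_pdivlMr ?exprn_gt0//.
    have [u1|u1] := leP 1 `|u|; first by rewrite (brm_out d0)// mul0r ltW.
    apply: (@le_trans _ _ (1 * 2 ^+ p)); last by rewrite mul1r lerDr ltW.
    apply: ler_pM; [exact: brm_ge0|by rewrite exprn_ge0// ltW|exact: (brm_le1 d0)|].
    have t2 : 1 + `|1 - `|u| | <= 2 by rewrite gtr0_norm ?subr_gt0//; have := normr_ge0 u; lra.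
    by rewrite lerXn2r ?nnegrE ?(ltW t0).
  apply: (Hm (fun j => e j x * e j y) _ CG 1 Rad p J (fun=> 0)) => //.
  - by rewrite mulr_ge0// ltW.
  - exact: ltW.
  - move=> j; rewrite normrM.
    have t1 : 0 < 1 + 1 * `|1 - s j / Rad| by rewrite mul1r ltr_pwDl.
    have -> : (1 + 1 * `|1 - s j / Rad|) `^ (2 * al) = (1 + 1 * `|1 - s j / Rad|) `^ al * (1 + 1 * `|1 - s j / Rad|) `^ al.
      by rewrite -powRD ?(gt_eqF t1) ?implybT//; congr (_ `^ _); ring.
    have := H1 j x Rad 1 x0 R0 (lexx 1); have := H1 j y Rad 1 y0 R0 (lexx 1).
    have := powR_ge0 (1 + 1 * `|1 - s j / Rad|) al.
    have : C1 ^+ 2 <= A by rewrite lerDl ltW.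
    move: w0; move: (_ `^ _) (wgt _ _) (wgt _ _) => u1 u2 u3 w0 CA u10 q1 q2.
    apply: (@le_trans _ _ ((C1 * u3 * u1) * (C1 * u2 * u1))); first exact: ler_pM.
    rewrite [leLHS](_ : _ = C1 ^+ 2 * (u3 * u2) * (u1 * u1)); last by ring.
    by rewrite ler_wpM2r ?mulr_ge0// ler_wpM2r.
  - apply: cvg_trans (@cvg_cst _ (0 : R) nat \oo _); apply: near_eq_cvg; apply: nearW => N.
    by rewrite /LE big1// => j _; rewrite addr0 mulr0.
pose b := Rad * d / L.
have Rd0 : 0 < Rad * d by have := lt_trans ltr01 bs; rewrite pmulr_lgt0// invr_gt0.
have dp : 0 < d by move: Rd0; rewrite pmulr_rgt0.
have RdL : Rad * d = L * b by rewrite /b mulrCA mulfV ?mulr1// gt_eqF.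
have b1 : 1 <= b by exact: ltW.
have d1 : d <= 1 by rewrite dE; lra.
apply: (wrap _ b) => //.
- apply: (@le_trans _ _ (1 * Rad)); last by rewrite ler_pM2r// lerDl ltW.
  rewrite mul1r ler_pdivrMr// ler_pM2l//; lra.
- by rewrite RdL mulrDl mul1r lerD2r.
have [h [gg [h1 [h2 h2'] h3 h4]]] := H2 x y (d / 4) x01 y01 (divr_gt0 dp (ltr0n R 4)).
have [F [FC FL]] := HF b b1.
have bnd n : `|\sum_(j < J) brm delta (s j / Rad) * (a j (h n) * a j (gg n))| <=
    A * (wgt Rad x * wgt Rad y) * (CG * b `^ (- delta)) * (2 + 2 * Rad / (b * g)).
  apply: (Hm (fun j => a j (h n) * a j (gg n)) _ CG b Rad p J F) => //.
  - by rewrite mulr_ge0// ltW.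
  - exact: ltW.
  - move=> j; apply: (le_trans (h3 n j Rad b R0 b1)).
    rewrite ler_wpM2r ?powR_ge0// ler_wpM2r// lerDr; exact: sqr_ge0.
  - move=> u; apply: (le_trans (FC u)); rewrite ler_wpM2r ?lerDl ?exprn_ge0//.
    rewrite mulr_ge0 ?powR_ge0// invr_ge0 exprn_ge0// addr_ge0// mulr_ge0//; lra.
  have [dh Ch cg] := h1 n; have ch := C1_cont Ch.
  have [B HB] := mean_cB ch cg.
  apply: (FL _ _ (Rad * (d / 2)) B) => //.
    move=> t tT.
    have tR : `|t / Rad| < (y - d / 4) - (x + d / 4).
      rewrite normrM normfV (gtr0_norm R0) ltr_pdivrMr//; move: tT; rewrite dE; lra.
    have hv z : 0 <= z <= 1 -> x + d / 4 < z -> h n z = 0.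
      by move=> _ xz; apply: h2; rewrite ler_normr; apply/orP; left; lra.
    have gv z : 0 <= z <= 1 -> z < y - d / 4 -> gg n z = 0.
      by move=> _ xz; apply: h2'; rewrite ler_normr; apply/orP; right; lra.
    have := finite_speed nu_gt zs Ch cg hv gv tR.
    apply: cvg_trans; apply: near_eq_cvg; apply: nearW => N.
    by apply: eq_bigr => j _; congr (cos _ * _); ring.
  have -> : Rad * (d / 2) = 2 * m.+1%:R * b.
    by rewrite mulrA RdL /L; move: (b) (m.+1%:R : R) => u v; field.
  rewrite (ltr_pM2r (lt_le_trans ltr01 b1)).
  by rewrite -natrM ltr_nat mul2n -addnn addSn ltnS leq_addr.
have cv K : \sum_(j < K) brm delta (s j / Rad) * (a j (h n) * a j (gg n)) @[n --> \oo] --> BRkernel Rad K x y.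
  rewrite /BRkernel; elim: K => [|K ih].
    by rewrite big_ord0; under eq_fun do rewrite big_ord0; exact: cvg_cst.
  rewrite big_ord_recr/=; under eq_fun do rewrite big_ord_recr/=.
  by apply: cvgD => //; apply: cvgMr; exact: h4.
have H : `|\sum_(j < J) brm delta (s j / Rad) * (a j (h n) * a j (gg n))| @[n --> \oo] --> `|BRkernel Rad J x y|.
  by apply: cvg_norm; exact: cv.
rewrite -(cvg_lim _ H)//; apply: limr_le; first exact: cvgP H.
by apply: nearW.
Qed.

End KernelBound.

(** * Restricted weak type *)

Section LebesgueBorel.
Variable R : realType.
Local Notation mu := (@lebesgue_measure R).

(* No measurability: needed for superlevel sets of an uncountable supremum. *)
Lemma ge0_integral_mono d (T : measurableType d) (m : {measure set T -> \bar R}) (f g : T -> \bar R) :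
  (forall x, 0 <= f x)%E -> (forall x, f x <= g x)%E -> (\int[m]_x f x <= \int[m]_x g x)%E.
Proof.
move=> f0 fg; have g0 x : (0 <= g x)%E by exact: le_trans (fg x).
rewrite ge0_integralTE// ge0_integralTE//; apply: le_ereal_sup; apply: image_subset => h hf x.
exact: le_trans (hf x) (fg x).
Qed.

Lemma integral_leb (D : set R) (f : R -> \bar R) :
  measurable D -> measurable_fun D f ->
  (\int[@leb R]_(x in D) f x = \int[mu]_(x in D) f x)%E.
Proof.
move=> mD mf; rewrite integralE [RHS]integralE.
rewrite (@ge0_integral_leb R D (f ^\+)%E) ?(@ge0_integral_leb R D (f ^\-)%E)//.
- exact: measurable_funeneg.
- exact: measurable_funepos.
Qed.

(** A set of the completed sigma-algebra is a Borel set joined with part of a Borel null set; the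
    Borel part is kept. *)
Lemma leb_measurable_borel (E : set (LebT R)) : measurable E ->
  exists A : set R, [/\ measurable A, A `<=` E & (@leb R).-negligible (E `\` A)].
Proof.
move=> mE; have : (completed_algebra_gen mu).-sigma.-measurable E.
  by rewrite completed_caratheodory_measurable.
rewrite g_sigma_completed_algebra_genE => -[A mA [N [B [mB B0 NB]] <-]].
exists A; split=> //.
exists B; split; first exact: measurable_borel_leb.
  exact: B0.
by move=> x [[Ax|Nx] nAx]; [|exact: NB].
Qed.

End LebesgueBorel.

(** * Power weights away from and near the diagonal, and dyadic layers *)

Section Powers.
Variable R : realType.
Variables (nu delta : R).
Hypothesis d0 : 0 < delta.
Implicit Types (x y u Rad : R) (n i k : nat).

Local Notation al := (nu + 1 / 2).
Local Notation be := (al - delta).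
Hypothesis be0 : 0 < be.
Local Notation W := (Wt nu).
Local Notation mu := (@lebesgue_measure R).

Let al0 : 0 < al. Proof. by move: d0 be0; lra. Qed.

Let powRE x (a : R) : 0 < x -> x `^ a = expR (a * ln x).
Proof. by move=> x0; rewrite /powR gt_eqF. Qed.

(** The term of the least i with u < 2^i already suffices: for i > 0, u >= 2^(i-1) accounts for the
    factor 2^(1 + delta). Indicators of balls, rather than of shells, are kept because a maximal
    function controls balls. *)
Lemma powR_dyadic u I : 0 <= u < 2 ^+ I ->
  (1 + u) `^ (- (1 + delta)) <= \sum_(i < I.+1) 2 `^ (1 + delta) * (2 ^+ i) `^ (- (1 + delta)) * (u < 2 ^+ i)%R%:R.
Proof.
elim: I => [|I ih] /andP[u0 uI].
  rewrite big_ord_recr big_ord0/= add0r uI mulr1 expr0 powR1 mulr1.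
  have h1 : (1 + u) `^ (- (1 + delta)) <= 1.
    by rewrite powRN invf_le1 ?powR_gt0 ?ltr_pwDl// -[leLHS](powRr0 (1 + u)) ler_powR//; move: d0 u0; lra.
  apply: (le_trans h1); rewrite -[leLHS](powRr0 2); apply: ler_powR; move: d0; lra.
have tn i : 0 <= 2 `^ (1 + delta) * (2 ^+ i) `^ (- (1 + delta)) * (u < 2 ^+ i)%R%:R :> R.
  by rewrite !mulr_ge0 ?powR_ge0.
rewrite big_ord_recr/=; have [uI'|uI'] := ltP u (2 ^+ I).
  by apply: (le_trans (ih _)); [rewrite u0|rewrite lerDl].
rewrite uI mulr1; apply: (@le_trans _ _ (2 `^ (1 + delta) * (2 ^+ I.+1) `^ (- (1 + delta)))).
  have I0 : 0 < 2 ^+ I :> R by rewrite exprn_gt0.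
  rewrite exprS powRM ?(ltW I0)// [X in _ * (X * _)]powRN mulrA mulfV ?gt_eqF ?powR_gt0// mul1r.
  rewrite !powRN lef_pV2 ?posrE ?powR_gt0//; last by rewrite ltr_pwDl.
  apply: ge0_ler_powR; rewrite ?nnegrE ?(ltW I0)//; move: d0 u0 uI'; lra.
by rewrite lerDr sumr_ge0// => i _; exact: tn.
Qed.

(* On y <= x / 2 the natural majorant x^(-al-delta-1) y^(al+delta) is smaller than
   x^(-be) y^(be-1), so both off-diagonal regions share one bound. *)
Lemma weights_far x y Rad : 0 < x -> 0 < y -> 0 < Rad -> y <= x / 2 \/ 2 * x <= y ->
  Rad * (1 + Rad * `|x - y|) `^ (- (1 + delta)) * (wgt nu Rad x * wgt nu Rad y) * W y <=
    2 `^ (1 + delta) * (x `^ (- be) * y `^ (be - 1)).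
Proof.
move=> x0 y0 R0 far.
have wl t : 0 < t -> wgt nu Rad t <= t `^ (- al).
  by move=> t0; rewrite /wgt powRN ge_min lexx orbT.
(* Interpolates between the two members of the minimum, using al = delta + be. The resulting R^delta
   cancels the R^(-delta) of [dist], which makes the bound uniform in R. *)
have wm t : 0 < t -> wgt nu Rad t <= Rad `^ delta * t `^ (- be).
  move=> t0; have [Rt|Rt] := leP (al * ln Rad) (- al * ln t).
    apply: (@le_trans _ _ (Rad `^ al)); first by rewrite /wgt ge_min lexx.
    rewrite !powRE// -expRD ler_expR.
    have : al * (ln Rad + ln t) <= 0 by lra.
    rewrite pmulr_rle0// => h; have := @mulr_ge0_le0 _ be (ln Rad + ln t) (ltW be0) h.
    lra.
  apply: (le_trans (wl t t0)); rewrite !powRE// -expRD ler_expR.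
  have : 0 <= al * (ln Rad + ln t) by lra.
  rewrite pmulr_rge0// => h; have := mulr_ge0 (ltW d0) h.
  lra.
have wx0 := wgt_gt0 nu R0 x0; have wy0 := wgt_gt0 nu R0 y0.
have WE : W y = y `^ (2 * al) by rewrite /Wt (gtr0_norm y0); congr (_ `^ _); lra.
have dist t : 0 < t -> t / 2 <= `|x - y| ->
    Rad * (1 + Rad * `|x - y|) `^ (- (1 + delta)) <= 2 `^ (1 + delta) * (Rad `^ (- delta) * t `^ (- (1 + delta))).
  move=> t0 tx; apply: (@le_trans _ _ (Rad * (Rad * (t / 2)) `^ (- (1 + delta)))).
    rewrite ler_pM2l// !powRN lef_pV2 ?posrE ?powR_gt0 ?mulr_gt0 ?divr_gt0//; last first.
      by rewrite ltr_pwDl// mulr_ge0// ltW.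
    apply: ge0_ler_powR; rewrite ?nnegrE ?addr_ge0 ?mulr_ge0 ?(ltW R0) ?(ltW t0)//; first by move: d0; lra.
    by apply: (@le_trans _ _ (Rad * `|x - y|)); [rewrite ler_pM2l|rewrite lerDr].
  have l2 : ln (Rad * (t / 2)) = ln Rad + ln t - ln 2.
    by rewrite lnM ?posrE ?divr_gt0// ln_div ?posrE//; lra.
  rewrite -{1}(lnK (R0 : Rad \is Num.pos)) !powRE ?mulr_gt0 ?divr_gt0// l2 -!expRD ler_expR.
  lra.
case: far => [yx|xy].
  have xd : x / 2 <= `|x - y| by rewrite ler_normr; apply/orP; left; lra.
  have := dist x x0 xd; have := wl x x0; have := wm y y0.
  have : 0 <= Rad * (1 + Rad * `|x - y|) `^ (- (1 + delta)) by rewrite mulr_ge0 ?powR_ge0// ltW.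
  move: (Rad * _ `^ _) => D D0 h1 h2 h3.
  apply: (@le_trans _ _ (2 `^ (1 + delta) * (Rad `^ (- delta) * x `^ (- (1 + delta))) * (x `^ (- al) * (Rad `^ delta * y `^ (- be))) * W y)).
    rewrite ler_wpM2r ?Wt_ge0//; apply: ler_pM => //.
    - by rewrite mulr_ge0 ?ltW.
    - by apply: ler_pM => //; exact: ltW.
  rewrite WE !powRE// -!expRD ler_expR.
  have lyx : ln y - ln x <= 0 by rewrite subr_le0 ler_ln ?posrE//; lra.
  have q0 : 0 <= 2 * delta + 1 by move: d0; lra.
  by have := mulr_ge0_le0 q0 lyx; lra.
have xd : y / 2 <= `|x - y| by rewrite ler_normr; apply/orP; right; lra.
have := dist y y0 xd; have := wl y y0; have := wm x x0.
have : 0 <= Rad * (1 + Rad * `|x - y|) `^ (- (1 + delta)) by rewrite mulr_ge0 ?powR_ge0// ltW.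
move: (Rad * _ `^ _) => D D0 h1 h2 h3.
apply: (@le_trans _ _ (2 `^ (1 + delta) * (Rad `^ (- delta) * y `^ (- (1 + delta))) * (Rad `^ delta * x `^ (- be) * y `^ (- al)) * W y)).
  rewrite ler_wpM2r ?Wt_ge0//; apply: ler_pM => //.
  - by rewrite mulr_ge0 ?ltW.
  - by apply: ler_pM => //; exact: ltW.
by rewrite WE !powRE// -!expRD ler_expR; lra.
Qed.

(** With 1/x and 1/y in the minima the product is (y/x)^al. Near the diagonal the kernel is thus
    compared with a convolution kernel for Lebesgue measure. *)
Lemma weights_near x y Rad : 0 < x -> 0 < y -> 0 < Rad -> y <= 2 * x ->
  wgt nu Rad x * wgt nu Rad y * W y <= 2 `^ al.
Proof.
move=> x0 y0 R0 yx.
have wl t : 0 < t -> wgt nu Rad t <= t `^ (- al).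
  by move=> t0; rewrite /wgt powRN ge_min lexx orbT.
have WE : W y = y `^ (2 * al) by rewrite /Wt (gtr0_norm y0); congr (_ `^ _); lra.
apply: (@le_trans _ _ (x `^ (- al) * y `^ (- al) * W y)).
  rewrite ler_wpM2r ?Wt_ge0//; apply: ler_pM; rewrite ?wl//; exact/ltW/wgt_gt0.
rewrite WE !powRE// -!expRD ler_expR.
have : ln y <= ln 2 + ln x by rewrite -lnM ?posrE// ler_ln ?posrE ?mulr_gt0.
by move=> h; have := ler_wpM2l (ltW al0) h; lra.
Qed.

Lemma powR_integral (rho : R) : 0 < rho ->
  (\int[mu]_(y in `]0%R, rho[) (y `^ (be - 1))%:E <= (rho `^ be / be)%:E)%E.
Proof.
move=> r0; pose I n : set R := `[rho / n.+2%:R, rho]%classic.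
have mI n : measurable (I n) by exact: measurable_itv.
have lo n : 0 < rho / n.+2%:R by rewrite divr_gt0.
have IU : \bigcup_n I n = `]0%R, rho]%classic.
  apply/seteqP; split=> [y [n _]|y]/=; rewrite ?/I/= !in_itv/=.
    by move=> /andP[ny ->]; rewrite (lt_le_trans (lo n)).
  move=> /andP[y0 yr]; exists (Num.truncn (rho / y)) => //; rewrite /I/= in_itv/= yr andbT.
  rewrite ler_pdivrMr// mulrC -ler_pdivrMr//.
  by apply: (le_trans (ltW (truncnS_gt _))); rewrite ler_nat.
have mf (D : set R) : measurable D -> measurable_fun D (fun y => (y `^ (be - 1))%:E).
  by move=> mD; apply/measurable_EFinP; apply: measurable_funTS; exact: measurable_powR.
have f0 (y : R) : (0 <= (y `^ (be - 1))%:E)%E by rewrite lee_fin powR_ge0.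
have mr : measurable (`]0%R, rho]%classic : set R) by exact: measurable_itv.
apply: (@le_trans _ _ (\int[mu]_(y in `]0%R, rho]) (y `^ (be - 1))%:E)%E).
  apply: ge0_subset_integral => //; first exact: mf.
  by move=> y /=; rewrite !in_itv/= => /andP[-> /ltW].
have cv : (\int[mu]_(y in I n) (y `^ (be - 1))%:E @[n --> \oo] --> \int[mu]_(y in `]0%R, rho]) (y `^ (be - 1))%:E)%E.
  rewrite -IU; apply: ge0_nondecreasing_set_cvg_integral => //.
  - apply/nondecreasing_seqP => n; apply/subsetPset => y; rewrite /I/= !in_itv/=.
    move=> /andP[ny ->]; rewrite andbT; apply: le_trans ny.
    by rewrite ler_pM2l// lef_pV2 ?posrE// ler_nat.
  - by move=> n; exact: mf.
rewrite -(cvg_lim _ cv)//; apply: lime_le; first exact: cvgP cv.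
apply: nearW => n.
have lt : rho / n.+2%:R < rho by rewrite ltr_pdivrMr// ltr_pMr// ltr1n.
have dF y : rho / n.+2%:R <= y <= rho -> isd (fun y => be^-1 * y `^ be) y (y `^ (be - 1)).
  move=> /andP[ny _]; have y0 : 0 < y by exact: lt_le_trans (lo n) ny.
  apply: isd_eq; first by apply: isdZ; exact: isd_powR.
  by rewrite (mulKf (lt0r_neq0 be0)).
rewrite (integral_cc_FTC lt _ dF) ?lee_fin.
  by rewrite [rho `^ be / be]mulrC gerBl mulr_ge0 ?powR_ge0// invr_ge0 ltW.
move=> y /andP[ny _]; have y0 : 0 < y by exact: lt_le_trans (lo n) ny.
exact: isd_continuous (isd_powR (be - 1) y0).
Qed.

Local Notation q := (2^-1 `^ (2 * al) : R).

Lemma layer_ratio : 0 < q < 1.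
Proof.
rewrite powR_gt0//= powRE// -[ltRHS]expR0 ltr_expR lnV ?posrE//.
have l2 : 0 < ln 2 :> R by rewrite ln_gt0// ltr1n.
by rewrite mulrN oppr_lt0 mulr_gt0// mulr_gt0.
Qed.

Let qX k : q ^+ k = (2^-1 ^+ k) `^ (2 * al).
Proof.
elim: k => [|k ih]; first by rewrite !expr0 powR1.
have h0 : 0 <= 2^-1 :> R by [].
by rewrite !exprS ih (powRM _ h0 (exprn_ge0 k h0)).
Qed.

(** The least k with 2^(-k-1) < y works: minimality gives y <= 2^(-k), and [q ^+ k] is the weight at
    2^(-k). *)
Lemma layer_lower y : 0 < y < 1 -> exists k, 2^-1 ^+ k.+1 < y /\ W y <= q ^+ k.
Proof.
move=> /andP[y0 y1].
have ex : exists k, 2^-1 ^+ k.+1 < y.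
  have [k ky] : exists k : nat, y^-1 < k%:R.
    by exists (Num.bound y^-1); rewrite archi_boundP// invr_ge0 ltW.
  exists k; rewrite exprVn -[y]invrK ltf_pV2 ?posrE ?invr_gt0 ?exprn_gt0//.
  by apply: (lt_trans ky); rewrite -natrX ltr_nat (ltn_trans (ltn_expl k (ltnSn 1)))// ltn_exp2l.
have [k ky kmin] := ex_minnP ex; exists k; split => //.
have yk : y <= 2^-1 ^+ k.
  case: k ky kmin => [|k] ky kmin; first by rewrite expr0 ltW.
  by rewrite leNgt; apply/negP => /kmin; rewrite ltnn.
rewrite qX /Wt (gtr0_norm y0); have -> : 2 * nu + 1 = 2 * al by lra.
by apply: ge0_ler_powR; rewrite ?nnegrE ?exprn_ge0 ?(ltW y0)//; move: al0; lra.
Qed.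

(** Capping q^k at (4 y)^(2 al) makes the sum telescope: every active term equals (g k - g (k+1)) /
    (1 - q), and g 0 is at most (4 y)^(2 al). *)
Lemma layer_upper n y : 0 < y ->
  \sum_(k < n) q ^+ k * (2^-1 ^+ k < 4 * y)%R%:R <= 4 `^ (2 * al) / (1 - q) * W y.
Proof.
move=> y0; have /andP[q0 q1] := layer_ratio; have q10 : 0 < 1 - q by lra.
have WE : W y = y `^ (2 * al) by rewrite /Wt (gtr0_norm y0); congr (_ `^ _); lra.
have a20 : 0 < 2 * al by move: al0; lra.
pose g k := Num.min (q ^+ k) ((4 * y) `^ (2 * al)).
have g0 k : 0 <= g k by rewrite /g le_min exprn_ge0 ?powR_ge0// ltW.
have st k : q ^+ k * (2^-1 ^+ k < 4 * y)%R%:R <= (g k - g k.+1) / (1 - q).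
  rewrite ler_pdivlMr//.
  have qk : q ^+ k.+1 <= q ^+ k by rewrite exprS ler_piMl ?exprn_ge0// ltW.
  have gm : g k.+1 <= g k by rewrite /g le_min !ge_min qk lexx/= orbT.
  case: ltP => h; last by rewrite mulr0 mul0r subr_ge0.
  have h1 : q ^+ k <= (4 * y) `^ (2 * al).
    by rewrite qX; apply: ge0_ler_powR; rewrite ?nnegrE ?exprn_ge0 ?(ltW h) ?(ltW a20)// ltW// mulr_gt0.
  have -> : g k = q ^+ k by apply/min_idPl.
  have -> : g k.+1 = q ^+ k.+1 by apply/min_idPl; exact: le_trans h1.
  by rewrite exprS mulr1 mulrBr mulr1 [q ^+ k * q]mulrC.
apply: (@le_trans _ _ (\sum_(k < n) (g k - g k.+1) / (1 - q))); first exact: ler_sum.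
rewrite -mulr_suml mulrAC WE -(powRM _ (ler0n R 4) (ltW y0)) ler_pM2r ?invr_gt0//.
have -> : \sum_(k < n) (g k - g k.+1) = g 0%N - g n.
  elim: n => [|n ih]; first by rewrite big_ord0 subrr.
  by rewrite big_ord_recr/= ih addrA subrK.
apply: (@le_trans _ _ (g 0%N)); first by rewrite gerBl.
by rewrite /g ge_min lexx orbT.
Qed.

End Powers.

(** * Integrating the kernel over a set *)

Section KernelIntegral.
Variable R : realType.
Variables (nu delta : R) (s : nat -> R).
Hypothesis nu_gt : - (1 / 2) < nu.
Hypothesis zs : bessel_zeros nu s.
Hypothesis d0 : 0 < delta.
Implicit Types (x y u Rad h : R) (n i k J : nat) (A : set R).

Local Notation al := (nu + 1 / 2).
Local Notation be := (al - delta).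
Hypothesis be0 : 0 < be.
Local Notation W := (Wt nu).
Local Notation mu := (@lebesgue_measure R).
Local Notation K := (BRkernel nu delta s).

Lemma cont_kernelW Rad J x : continuous (fun y => K Rad J x y * W y).
Proof.
apply: contM; last exact: cont_Wt.
apply: cont_sum => j; apply: contM; first exact: contC.
by apply: contM; [exact: contC|exact: cont_ef].
Qed.

(** The number [h] bounds the averages over balls at x of the part of [A] to the right of x / 2;
    leaving it abstract admits both h = 1 and truncated maximal functions. Near the diagonal, the
    ball of radius 2^i / R has mass at most 2 h 2^i / R and weight R 2^(-i (1 + delta)), a geometric
    series of ratio 2^(-delta). *)
Lemma kernel_integral_bound : exists2 C : R, 0 < C & forall A x Rad J h,
  measurable A -> A `<=` `]0%R, 1%R[%classic -> 0 < x < 1 -> s 0%N <= Rad -> Rad <= s J -> 0 <= h ->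
  (forall r, 0 < r -> (mu (A `&` ([set y | (x / 2 < y)%R] `&` ball x r)) <= (h * (2 * r))%:E)%E) ->
  (\int[mu]_(y in A) (`|K Rad J x y| * W y)%:E <=
    (C * x `^ (- be))%:E * \int[mu]_(y in A) (y `^ (be - 1))%:E + (C * h)%:E)%E.
Proof.
have [CK CK0 HK] := kernel_bound nu_gt zs d0.
pose G : R := 2 `^ (- delta).
have G0 : 0 < G by rewrite powR_gt0.
have G1 : G < 1 by rewrite /G /powR gt_eqF// -[ltRHS]expR0 ltr_expR mulNr oppr_lt0 mulr_gt0// ln_gt0// ltr1n.
have G10 : 0 < 1 - G by lra.
pose C1 := CK * 2 `^ (1 + delta); pose C2 := CK * 2 `^ al * 2 `^ (1 + delta) * 2 / (1 - G).
have C10 : 0 < C1 by rewrite mulr_gt0 ?powR_gt0.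
have C20 : 0 < C2 by rewrite divr_gt0 ?mulr_gt0 ?powR_gt0.
exists (C1 + C2); first by rewrite addr_gt0.
move=> A x Rad J h mA A01 x01 sR RJ h0 Hh; have /andP[x0 x1] := x01.
have R0 : 0 < Rad by exact: lt_le_trans (s_gt0 zs 0) sR.
(* As |x - y| is at most 1, finitely many dyadic balls suffice; the geometric series keeps the
   constant independent of their number. *)
have [I RI] : exists I : nat, Rad < 2 ^+ I.
  exists (Num.bound Rad); apply: lt_trans (archi_boundP (ltW R0)) _.
  by rewrite -natrX ltr_nat ltn_expl.
pose B i := [set y | (x / 2 < y)%R] `&` ball x (2 ^+ i / Rad).
have mB i : measurable (B i).
  apply: measurableI; last exact: measurable_ball.
  rewrite (_ : [set y | (x / 2 < y)%R] = `]x / 2, +oo[%classic); first exact: measurable_itv.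
  by apply/seteqP; split=> y /=; rewrite in_itv/= andbT.
pose c i := CK * 2 `^ al * Rad * (2 `^ (1 + delta) * (2 ^+ i) `^ (- (1 + delta))).
have c0 i : 0 <= c i by rewrite !mulr_ge0 ?powR_ge0// ltW.
have pt y : A y -> `|K Rad J x y| * W y <= C1 * x `^ (- be) * y `^ (be - 1) + \sum_(i < I.+1) c i * \1_(B i) y.
  move=> Ay; have y01 : 0 < y < 1 by have := A01 _ Ay; rewrite /= in_itv.
  have /andP[y0 y1] := y01.
  have S0 : 0 <= \sum_(i < I.+1) c i * \1_(B i) y by apply: sumr_ge0 => i _; rewrite mulr_ge0.
  have T0 : 0 <= C1 * x `^ (- be) * y `^ (be - 1) by rewrite (mulr_ge0 (mulr_ge0 (ltW C10) (powR_ge0 _ _)) (powR_ge0 _ _)).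
  have KB := HK Rad J x y sR RJ x01 y01.
  apply: (@le_trans _ _ (CK * (Rad * (1 + Rad * `|x - y|) `^ (- (1 + delta))) * (wgt nu Rad x * wgt nu Rad y) * W y)).
    by rewrite ler_wpM2r// Wt_ge0.
  have [far|] := pselect (y <= x / 2 \/ 2 * x <= y).
    have H := weights_far d0 be0 x0 y0 R0 far.
    apply: (@le_trans _ _ (CK * (2 `^ (1 + delta) * (x `^ (- be) * y `^ (be - 1))))).
      move: H; move: (Rad * _ `^ _) (wgt _ _ _ * wgt _ _ _) => P w H.
      by rewrite [leLHS](_ : _ = CK * (P * w * W y)) ?ler_pM2l//; ring.
    by rewrite /C1 !mulrA lerDl.
  move=> /not_orP[/negP]; rewrite -ltNge => xy /negP; rewrite -ltNge => yx.
  have H := weights_near d0 be0 x0 y0 R0 (ltW yx).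
  have u01 : 0 <= Rad * `|x - y| < 2 ^+ I.
    rewrite mulr_ge0 ?(ltW R0)//=; apply: le_lt_trans RI; rewrite ler_piMr ?(ltW R0)//.
    by rewrite ler_norml; apply/andP; split; lra.
  have D := powR_dyadic d0 u01.
  apply: (@le_trans _ _ (CK * 2 `^ al * Rad * (1 + Rad * `|x - y|) `^ (- (1 + delta)))).
    move: (powR_ge0 (1 + Rad * `|x - y|) (- (1 + delta))) H.
    move: (_ `^ (- (1 + delta))) (wgt _ _ _ * wgt _ _ _) => P w P0 H.
    rewrite [leLHS](_ : _ = CK * Rad * P * (w * W y)); last by ring.
    rewrite [leRHS](_ : _ = CK * Rad * P * 2 `^ al); last by ring.
    by rewrite ler_wpM2l// !mulr_ge0// ltW.
  apply: (@le_trans _ _ (\sum_(i < I.+1) c i * \1_(B i) y)); last by rewrite lerDr.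
  apply: (@le_trans _ _ (CK * 2 `^ al * Rad * (\sum_(i < I.+1) 2 `^ (1 + delta) * (2 ^+ i) `^ (- (1 + delta)) * (Rad * `|x - y| < 2 ^+ i)%R%:R))).
    by rewrite ler_wpM2l// !mulr_ge0 ?powR_ge0// ltW.
  rewrite mulr_sumr; apply: ler_sum => i _; rewrite mulrA ler_wpM2l ?c0//.
  case: ltP => // hi; rewrite indicE mem_set//; split => //=.
  by rewrite /ball/= ltr_pdivlMr// mulrC.
have mpow : measurable_fun A (fun y => (y `^ (be - 1))%:E).
  by apply/measurable_EFinP; apply: measurable_funTS; exact: measurable_powR.
have mind i : measurable_fun A (fun y => (\1_(B i) y)%:E : \bar R).
  by apply/measurable_EFinP; apply: measurable_funTS; exact: measurable_indic.
have mci i : measurable_fun A (fun y => (c i)%:E * (\1_(B i) y)%:E)%E.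
  by apply: measurable_funeM.
have msum : measurable_fun A (fun y => \sum_(i < I.+1) (c i)%:E * (\1_(B i) y)%:E)%E.
  by apply: emeasurable_sum => i; exact: mci.
have cT0 : 0 <= C1 * x `^ (- be) by rewrite (mulr_ge0 (ltW C10) (powR_ge0 _ _)).
have mK : measurable_fun A (fun y => (`|K Rad J x y| * W y)%:E).
  apply/measurable_EFinP; apply: measurable_funTS; apply: continuous_measurable_fun.
  have -> : (fun y => `|K Rad J x y| * W y) = (fun y => `|K Rad J x y * W y|).
    by apply/funext => y; rewrite normrM (ger0_norm (Wt_ge0 _ _)).
  by apply: cont_norm; exact: cont_kernelW.
apply: (@le_trans _ _ (\int[mu]_(y in A) ((C1 * x `^ (- be))%:E * (y `^ (be - 1))%:E + \sum_(i < I.+1) (c i)%:E * (\1_(B i) y)%:E))%E).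
  apply: ge0_le_integral => //.
  - by move=> y _; rewrite lee_fin mulr_ge0 ?Wt_ge0.
  - apply: emeasurable_funD; first exact: emeasurable_funM.
    exact: msum.
  - move=> y Ay; have := pt y Ay; rewrite -lee_fin EFinD EFinM -sumEFin.
    by under eq_bigr do rewrite EFinM.
have f10 y : A y -> (0 <= (C1 * x `^ (- be))%:E * (y `^ (be - 1))%:E)%E.
  by move=> _; rewrite -EFinM lee_fin mulr_ge0 ?powR_ge0.
have m1 : measurable_fun A (fun y => (C1 * x `^ (- be))%:E * (y `^ (be - 1))%:E)%E.
  exact: measurable_funeM.
have f20 y : A y -> (0 <= \sum_(i < I.+1) (c i)%:E * (\1_(B i) y)%:E)%E.
  by move=> _; apply: sume_ge0 => i _; rewrite -EFinM lee_fin mulr_ge0.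
have p0 y : A y -> (0 <= (y `^ (be - 1))%:E)%E by rewrite lee_fin powR_ge0.
have i0 (k : nat) y : A y -> (0 <= (c k)%:E * (\1_(B k) y)%:E)%E.
  by move=> _; rewrite -EFinM lee_fin mulr_ge0.
have i1 (k : nat) y : A y -> (0 <= (\1_(B k) y)%:E :> \bar R)%E by rewrite lee_fin.
rewrite (ge0_integralD mu mA f10 m1 f20 msum).
rewrite (ge0_integralZl mu mA mpow p0); last by rewrite lee_fin.
apply: leeD.
  apply: lee_wpmul2r; first by apply: integral_ge0 => y _; rewrite lee_fin powR_ge0.
  by rewrite lee_fin ler_wpM2r ?powR_ge0// lerDl ltW.
rewrite (@ge0_integral_sum _ _ R mu A mA 'I_I.+1 (fun i : 'I_I.+1 => fun y => (c i)%:E * (\1_(B i) y)%:E)%E (fun i : 'I_I.+1 => mci i) (fun (i : 'I_I.+1) y Ay => i0 i y Ay)).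
apply: (@le_trans _ _ (\sum_(i < I.+1) (c i * (h * (2 * (2 ^+ i / Rad))))%:E)%E).
  apply: lee_sum => i _; rewrite (ge0_integralZl mu mA (mind i) (i1 i)) ?lee_fin//.
  rewrite (integral_indic mu mA (mB i)) [X in (_ <= X)%E]EFinM; apply: lee_wpmul2l; first by rewrite lee_fin.
  rewrite setIC; apply: Hh; rewrite divr_gt0// exprn_gt0//.
rewrite sumEFin lee_fin.
have E (i : nat) : c i * (h * (2 * (2 ^+ i / Rad))) = CK * 2 `^ al * 2 `^ (1 + delta) * 2 * h * G ^+ i.
  have p2 : 0 < 2 ^+ i :> R by rewrite exprn_gt0.
  have -> : G ^+ i = (2 ^+ i) `^ (- (1 + delta)) * 2 ^+ i.
    rewrite -[X in _ * X](powRr1 (ltW p2)) -powRD ?(gt_eqF p2) ?implybT//.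
    have -> : - (1 + delta) + 1 = - delta by ring.
    elim: (i) => [|n ih]; first by rewrite !expr0 powR1.
    by rewrite !exprS ih powRM// exprn_ge0.
  by rewrite /c; field; rewrite gt_eqF.
under eq_bigr do rewrite E.
rewrite -mulr_sumr; apply: (@le_trans _ _ (C2 * h)); last by rewrite ler_wpM2r// lerDr ltW.
rewrite [leRHS](_ : _ = CK * 2 `^ al * 2 `^ (1 + delta) * 2 * h * (1 - G)^-1); last first.
  by rewrite /C2; ring.
rewrite ler_wpM2l//.
  by rewrite !mulr_ge0 ?powR_ge0// ltW.
rewrite -[leRHS]mul1r ler_pdivlMr//.
have -> : (\sum_(i < I.+1) G ^+ i) * (1 - G) = 1 - G ^+ I.+1.
  elim: (I) => [|n ih]; first by rewrite big_ord_recr big_ord0/= add0r expr0 mul1r expr1.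
  by rewrite big_ord_recr/= mulrDl ih [G ^+ n.+2]exprSr; ring.
by rewrite gerBl exprn_ge0// ltW.
Qed.

(** [E] and [A] differ by a null set, which turns an integral for the completed measure into a Borel
    one. *)
Lemma coefE (E A : set R) j : @measurable _ (LebT R) E -> E `<=` `]0%R, 1%R[%classic ->
  measurable A -> A `<=` E -> (@leb R).-negligible (E `\` A) ->
  coef nu s \1_E j = \int[mu]_(y in A) (ef nu s j y * W y).
Proof.
move=> mE E01 mA AE nEA; rewrite /coef /Rintegral; congr fine.
have m01 : measurable (`]0%R, 1%R[%classic : set R) by exact: measurable_itv.
have m01' : @measurable _ (LebT R) `]0%R, 1%R[%classic by exact: measurable_borel_leb.
have cg : continuous (fun y => ef nu s j y * W y) by apply: contM; [exact: cont_ef|exact: cont_Wt].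
have mg : measurable_fun setT (fun y => ef nu s j y * W y) by exact: continuous_measurable_fun.
have mgl : measurable_fun setT (fun y : LebT R => ef nu s j y * W y).
  by move=> _ Y mY; rewrite setTI; apply: measurable_borel_leb; rewrite -[X in measurable X]setTI; exact: mg.
transitivity (\int[@leb R]_(x in `]0%R, 1%R[) (\1_E x * (ef nu s j x * W x))%:E)%E.
  apply: eq_integral => x; rewrite inE/= in_itv/= => /andP[x0 _].
  have -> : dens nu x = W x by rewrite /dens /Wt gtr0_norm.
  rewrite (psiE nu_gt zs j x0).
  by rewrite -mulrA.
transitivity (\int[@leb R]_(x in `]0%R, 1%R[) (\1_A x * (ef nu s j x * W x))%:E)%E.
  have mfl (D : set (LebT R)) : measurable D -> measurable_fun setT (fun x : LebT R => (\1_D x * (ef nu s j x * W x))%:E : \bar R).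
    move=> mD; apply/measurable_EFinP; apply: measurable_funM; last exact: mgl.
    exact: measurable_indic.
  apply: ae_eq_integral; [exact: m01'|by apply: measurable_funTS; exact: mfl| |].
    by apply: measurable_funTS; apply: mfl; exact: measurable_borel_leb.
  case: nEA => B [mB B0 EAB]; exists B; split=> // x /= /not_implyP[_ xne]; apply: EAB.
  split=> //; apply: contrapT => nE; apply: xne.
    by rewrite !indicE !memNset// => /AE.
  by rewrite !indicE !mem_set//; [exact: contrapT nE|exact: AE (contrapT nE)].
rewrite integral_leb//; last first.
  apply/measurable_EFinP; apply: measurable_funTS; apply: (@measurable_funM _ _ R setT \1_A); last exact: mg.
  by apply: measurable_indic.
have AD : A = `]0%R, 1%R[%classic `&` A by apply/seteqP; split=> [x Ax|x []//]; split=> //; exact/E01/AE.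
rewrite [in RHS]AD integral_mkcondr; apply: eq_integral => x _; rewrite patchE indicE.
by case: (x \in A); rewrite ?mul1r ?mul0r.
Qed.

Lemma s_unbounded Rad : exists J, Rad <= s J.
Proof.
have [g g0 sg] := s_ge_linear nu_gt zs.
exists (Num.bound (Rad / g)); have := sg 0%N (Num.bound (Rad / g)) (leq0n _).
have [R0|R0] := leP Rad 0; first by rewrite (le_trans R0)// ltW// (s_gt0 zs).
have : Rad / g < (Num.bound (Rad / g))%:R by apply: archi_boundP; rewrite divr_ge0// ltW.
by rewrite ltr_pdivrMr// subn0; have := s_gt0 zs 0; lra.
Qed.

(** The multiplier vanishes from index J on, so the partial sums are eventually constant and their
    [limn] is a finite kernel sum. *)
Lemma BR_le (E A : set R) Rad J x : @measurable _ (LebT R) E -> E `<=` `]0%R, 1%R[%classic ->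
  measurable A -> A `<=` E -> (@leb R).-negligible (E `\` A) ->
  0 < x -> 0 < Rad -> Rad <= s J ->
  ((`|BR nu delta s Rad \1_E x|)%:E <= \int[mu]_(y in A) (`|K Rad J x y| * W y)%:E)%E.
Proof.
move=> mE E01 mA AE nEA x0 R0 RJ.
have A01 : A `<=` `[0%R, 1%R]%classic.
  by move=> y /AE /E01 /=; rewrite !in_itv/= => /andP[/ltW -> /ltW ->].
have iA (f : R -> R) : continuous f -> mu.-integrable A (EFin \o f).
  move=> cf; apply: (@integrableS _ _ R mu `[0%R, 1%R]%classic A) => //.
  exact: continuous_integrable.
have cg j : continuous (fun y => ef nu s j y * W y).
  by apply: contM; [exact: cont_ef|exact: cont_Wt].
have -> : BR nu delta s Rad \1_E x = \int[mu]_(y in A) (K Rad J x y * W y).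
  have -> : \int[mu]_(y in A) (K Rad J x y * W y) =
      \sum_(j < J) brm delta (s j / Rad) * ef nu s j x * \int[mu]_(y in A) (ef nu s j y * W y).
    elim: (J) => [|n ih].
      rewrite big_ord0 -[RHS](mul0r (\int[mu]_(y in A) W y)) -RintegralZl//; last first.
        by apply: iA; exact: cont_Wt.
      by apply: eq_Rintegral => y _; rewrite /BRkernel big_ord0.
    rewrite big_ord_recr/= -ih -RintegralZl//; last exact: iA.
    rewrite -RintegralD//; last 2 first.
    - by apply: iA; exact: cont_kernelW.
    - by apply: iA; apply: contM; [exact: contC|exact: cg].
    by apply: eq_Rintegral => y _; rewrite /BRkernel big_ord_recr/=; ring.
  rewrite /BR; apply/cvg_lim => //.
  apply: (@cvg_near_cst _ _ _ _ _ _); exists J => // n /= Jn.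
  rewrite -(big_mkord xpredT (fun j => (Num.max (1 - s j ^+ 2 / Rad ^+ 2) 0) `^ delta * coef nu s \1_E j * psi nu s j x)).
  rewrite (big_cat_nat _ Jn)//= [X in _ + X]big_nat_cond [X in _ + X]big1 ?addr0.
    rewrite big_mkord; apply: eq_bigr => j _.
    rewrite (coefE _ mE E01 mA AE nEA) (psiE nu_gt zs)// /brm expr_div_n; ring.
  move=> j /andP[/andP[Jj _] _]; rewrite -expr_div_n -/(brm delta (s j / Rad)) (brm_out d0) ?mul0r//.
  rewrite gtr0_norm ?divr_gt0 ?(s_gt0 zs)// ler_pdivlMr// mul1r; apply: le_trans RJ _.
  exact: (s_le zs).
have ck : continuous (fun y => K Rad J x y * W y) by exact: cont_kernelW.
apply: (@le_trans _ _ (\int[mu]_(y in A) `|K Rad J x y * W y|)%:E).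
  by rewrite lee_fin; apply: le_normr_Rintegral => //; exact: iA.
rewrite /Rintegral fineK; last first.
  by apply: integrable_fin_num => //; apply: iA; exact: cont_norm.
rewrite le_eqVlt; apply/orP; left; apply/eqP; apply: eq_integral => y _.
by rewrite normrM (ger0_norm (Wt_ge0 _ _)).
Qed.

End KernelIntegral.

(** * Superlevel sets of the maximal operator *)

Section WeakType.
Variable R : realType.
Variables (nu delta : R) (s : nat -> R).
Hypothesis nu_gt : - (1 / 2) < nu.
Hypothesis zs : bessel_zeros nu s.
Hypothesis d0 : 0 < delta.
Implicit Types (x y u Rad h m lam : R) (n i k J : nat) (E A : set R).

Local Notation al := (nu + 1 / 2).
Local Notation be := (al - delta).
Hypothesis be0 : 0 < be.
Local Notation W := (Wt nu).
Local Notation mu := (@lebesgue_measure R).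
Local Notation Q := (2 * al + 1).

Let al0 : 0 < al. Proof. by move: d0 be0; lra. Qed.
Let Q0 : 0 < Q. Proof. by move: al0; lra. Qed.

Let mW A : measurable_fun A (fun y => (W y)%:E).
Proof. by apply/measurable_EFinP; apply: measurable_funTS; apply: continuous_measurable_fun; exact: cont_Wt. Qed.

Let W0 y : (0 <= (W y)%:E)%E. Proof. by rewrite lee_fin Wt_ge0. Qed.

Let mP A : measurable_fun A (fun y => (y `^ (be - 1))%:E).
Proof. by apply/measurable_EFinP; apply: measurable_funTS; exact: measurable_powR. Qed.

Let P0 y : (0 <= (y `^ (be - 1))%:E)%E. Proof. by rewrite lee_fin powR_ge0. Qed.

(** At rho = m^(1/Q), the radius where an interval at 0 has mass of order m, both pieces are of
    order m^(be/Q); beyond rho, y^(be-1) is W y times a decreasing power. An upper bound m > 0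
    stands in for the mass so that null sets are covered. *)
Lemma power_mass A m : measurable A -> A `<=` `]0%R, 1%R[%classic -> 0 < m ->
  (\int[mu]_(y in A) (W y)%:E <= m%:E)%E ->
  (\int[mu]_(y in A) (y `^ (be - 1))%:E <= ((be^-1 + 1) * m `^ (be / Q))%:E)%E.
Proof.
move=> mA A01 m0 Am; pose rho := m `^ Q^-1.
have rho0 : 0 < rho by rewrite powR_gt0.
pose D : set R := `]0%R, rho[%classic.
have mD : measurable D by exact: measurable_itv.
have mAD : measurable (A `&` D) by exact: measurableI.
have mAC : measurable (A `\` D) by exact: measurableD.
rewrite -(setDUK (@subIsetl _ A D)).
have -> : A `\` (A `&` D) = A `\` D by rewrite setDIr setDv set0U.
have dis : [disjoint A `&` D & A `\` D].
  by rewrite disj_set2E; apply/eqP/seteqP; split=> y // [[_ Dy] [_ nDy]].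
rewrite (@ge0_integral_setU _ _ R mu _ _ mAD mAC _ (@mP _) (fun y _ => P0 y) dis).
have -> : (be^-1 + 1) * m `^ (be / Q) = rho `^ be / be + rho `^ (- (al + delta + 1)) * m.
  have e1 : rho `^ be = m `^ (be / Q) by rewrite /rho -powRrM mulrC.
  have e2 : rho `^ (- (al + delta + 1)) * m = m `^ (be / Q).
    rewrite /rho -powRrM -[X in _ * X](powRr1 (ltW m0)) -powRD ?(gt_eqF m0) ?implybT//.
    congr (_ `^ _); rewrite -[X in _ + X](mulVf (lt0r_neq0 Q0)) -mulrDr mulrC.
    by congr (_ * _); ring.
  by rewrite e1 e2; ring.
rewrite EFinD; apply: leeD.
  apply: le_trans (powR_integral be0 rho0).
  exact: (@ge0_subset_integral _ _ R mu (A `&` D) D mAD mD _ (@mP _) (fun y _ => P0 y) (@subIsetr _ A D)).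
apply: (@le_trans _ _ (\int[mu]_(y in A `\` D) ((rho `^ (- (al + delta + 1)))%:E * (W y)%:E)%E)%E).
  apply: ge0_le_integral => //.
  - exact: mP.
  - by apply: measurable_funeM; exact: mW.
  move=> y [Ay nDy]; have := A01 _ Ay; rewrite /= in_itv/= => /andP[y0 y1].
  have ry : rho <= y.
    by rewrite leNgt; apply/negP => yr; apply: nDy; rewrite /D/= in_itv/= y0.
  rewrite -EFinM lee_fin /Wt (gtr0_norm y0).
  have -> : be - 1 = - (al + delta + 1) + (2 * nu + 1) by lra.
  rewrite powRD ?(gt_eqF y0) ?implybT// ler_wpM2r ?powR_ge0// !powRN lef_pV2 ?posrE ?powR_gt0//.
  by apply: ge0_ler_powR; rewrite ?nnegrE ?(ltW rho0) ?(ltW y0)//; move: d0 al0; lra.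
rewrite (ge0_integralZl mu mAC (@mW _))//; last by rewrite lee_fin powR_ge0.
rewrite EFinM; apply: lee_wpmul2l; first by rewrite lee_fin powR_ge0.
apply: le_trans Am.
exact: (@ge0_subset_integral _ _ R mu (A `\` D) A mAC mA _ (@mW _) (fun y _ => W0 y) (@subDsetl _ A D)).
Qed.

Lemma HL_ball A x r h : measurable A -> (HL_maximal \1_A x <= h%:E)%E -> 0 < r ->
  (mu (A `&` ball x r) <= (h * (2 * r))%:E)%E.
Proof.
move=> mA Hh r0.
have : (iavg \1_A (ball x r) <= h%:E)%E.
  apply: le_trans Hh; apply: ereal_sup_ubound; exists r => //=.
  by rewrite in_itv/= r0.
rewrite /iavg lebesgue_measure_ball ?(ltW r0)//.
under eq_integral do rewrite abse_EFin ger0_norm//.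
rewrite integral_indic//; last exact: measurable_ball.
rewrite inver mulrn_eq0/= gt_eqF//.
have r2 : 0 < (r *+ 2)^-1 by rewrite invr_gt0 pmulrn_lgt0.
rewrite lee_pdivrMl ?pmulrn_lgt0// -EFinM.
by rewrite mulrC -[r *+ 2]mulr_natl.
Qed.

Section SuperLevel.
Variables (E A : set R) (m CB : R).
Hypothesis CB0 : 0 < CB.
Hypothesis HCB : forall A x Rad J h,
  measurable A -> A `<=` `]0%R, 1%R[%classic -> 0 < x < 1 -> s 0%N <= Rad -> Rad <= s J -> 0 <= h ->
  (forall r, 0 < r -> (mu (A `&` ([set y | (x / 2 < y)%R] `&` ball x r)) <= (h * (2 * r))%:E)%E) ->
  (\int[mu]_(y in A) (`|BRkernel nu delta s Rad J x y| * W y)%:E <=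
    (CB * x `^ (- be))%:E * \int[mu]_(y in A) (y `^ (be - 1))%:E + (CB * h)%:E)%E.
Hypothesis mE : @measurable _ (LebT R) E.
Hypothesis E01 : E `<=` `]0%R, 1%R[%classic.
Hypothesis mA : measurable A.
Hypothesis AE : A `<=` E.
Hypothesis nEA : (@leb R).-negligible (E `\` A).
Hypothesis m0 : 0 < m.
Hypothesis Am : (\int[mu]_(y in A) (W y)%:E <= m%:E)%E.

Let A01 : A `<=` `]0%R, 1%R[%classic. Proof. by move=> x /AE /E01. Qed.

(** If 2^(-k-1) < x and x / 2 < y, then 2^(-k) < 4 y: [Ak k] contains all of [A] that matters near
    such an x. *)
Let Ak k := A `&` [set y | 2^-1 ^+ k < 4 * y].

Let mAk k : measurable (Ak k).
Proof.
apply: measurableI => //.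
rewrite (_ : [set y | _] = `]2^-1 ^+ k / 4, +oo[%classic); first exact: measurable_itv.
by apply/seteqP; split=> y /=; rewrite in_itv/= andbT ltr_pdivrMr// mulrC.
Qed.

(* The alternative: either the off-diagonal part exceeds lam / 2, or every admissible
   maximal function exceeds lam / (2 CB); testing h = 1 shows that the second case
   needs lam < 2 CB, which turns weak type 1 into weak type p1. *)
Lemma superlevel_point lam x :
  0 < lam -> 0 < x < 1 ->
  (lam%:E < `|Bmax nu delta s \1_E x|)%E ->
  x < ((be^-1 + 1) * m `^ (be / Q) / (lam / (2 * CB))) `^ be^-1 \/
  (lam / (2 * CB) < 1 /\ forall k, 2^-1 ^+ k.+1 < x -> ((lam / (2 * CB))%:E < HL_maximal \1_(Ak k) x)%E).
Proof.
move=> lam0 x01 xS; have /andP[x0 x1] := x01.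
set eta := lam / (2 * CB); have eta0 : 0 < eta by rewrite divr_gt0// mulr_gt0.
set T := (be^-1 + 1) * m `^ (be / Q).
have T0 : 0 < T by rewrite mulr_gt0 ?powR_gt0// addr_gt0// invr_gt0.
have te0 : 0 < T / eta by exact: (divr_gt0 T0 eta0).
have [xr|rx] := ltP x ((T / eta) `^ be^-1); [by left|right].
have [Rad R0 BRl] : exists2 Rad, 0 < Rad & lam < `|BR nu delta s Rad \1_E x|.
  move: xS; rewrite gee0_abs; last first.
    apply: (@le_trans _ _ (`|BR nu delta s 1 \1_E x|)%:E) => //.
    by apply: ereal_sup_ubound; exists 1 => //=.
  by move=> /ereal_sup_gt[_ [Rad R0 <-]]; rewrite lte_fin => ?; exists Rad.
(* Below the first zero the mean is the empty sum, [J = 0], and cannot exceed [lam]. *)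
have sR : s 0%N <= Rad.
  rewrite leNgt; apply/negP => Rs.
  have := BR_le nu_gt zs d0 mE E01 mA AE nEA x0 R0 (ltW Rs).
  rewrite integral0_eq; last by move=> y _; rewrite /BRkernel big_ord0 normr0 mul0r.
  by rewrite lee_fin => h; move: (lt_le_trans BRl h); rewrite ltNge ltW.
have [J RJ] := s_unbounded nu_gt zs Rad.
have BRK := BR_le nu_gt zs d0 mE E01 mA AE nEA x0 R0 RJ.
(* Because x >= rho, the off-diagonal term is at most CB eta = lam / 2; hence CB h has to exceed lam
   / 2. *)
have key h : 0 <= h -> (forall r, 0 < r -> (mu (A `&` ([set y | (x / 2 < y)%R] `&` ball x r)) <= (h * (2 * r))%:E)%E) -> eta < h.
  move=> h0 Hh; have := le_trans BRK (HCB mA A01 x01 sR RJ h0 Hh).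
  have xb : x `^ (- be) <= eta / T.
    rewrite powRN -[eta / T]invrK invf_div lef_pV2 ?posrE ?powR_gt0 ?te0//.
    have -> : T / eta = ((T / eta) `^ be^-1) `^ be.
      by rewrite -powRrM mulVf ?(lt0r_neq0 be0)// powRr1// ltW.
    by apply: ge0_ler_powR; rewrite ?nnegrE ?powR_ge0 ?(ltW be0) ?(ltW x0).
  have f1 : ((CB * x `^ (- be))%:E * \int[mu]_(y in A) (y `^ (be - 1))%:E <= (CB * eta)%:E)%E.
    apply: (@le_trans _ _ ((CB * (eta / T))%:E * T%:E)%E).
      apply: lee_pmul.
      - by rewrite lee_fin mulr_ge0 ?powR_ge0// ltW.
      - by apply: integral_ge0.
      - by rewrite lee_fin (ler_pM2l CB0); exact: xb.
      - exact: power_mass.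
    by rewrite -EFinM lee_fin -mulrA divfK// gt_eqF.
  move=> /le_trans /(_ (leeD f1 (lexx _))); rewrite -EFinD lee_fin => h2.
  have := lt_le_trans BRl h2; have -> : lam = 2 * (CB * eta).
    by rewrite /eta; field; rewrite gt_eqF.
  by rewrite -mulrDr mulrCA ltr_pM2l//; lra.
have adm h k : 2^-1 ^+ k.+1 < x -> (HL_maximal \1_(Ak k) x <= h%:E)%E -> forall r, 0 < r ->
    (mu (A `&` ([set y | (x / 2 < y)%R] `&` ball x r)) <= (h * (2 * r))%:E)%E.
  move=> kx Hh r r0; apply: le_trans (HL_ball (mAk k) Hh r0).
  apply: le_measure; rewrite ?inE.
  - apply: measurableI => //; apply: measurableI; last exact: measurable_ball.
    rewrite (_ : [set y | (x / 2 < y)%R] = `]x / 2, +oo[%classic); first exact: measurable_itv.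
    by apply/seteqP; split=> y /=; rewrite in_itv/= andbT.
  - by apply: measurableI; [exact: mAk|exact: measurable_ball].
  move=> y [Ay [/= xy yr]]; split => //; split => //=.
  by move: kx; rewrite exprS; lra.
split.
  apply: key => // r r0; rewrite mul1r.
  apply: (@le_trans _ _ (mu (ball x r))); last by rewrite lebesgue_measure_ball ?(ltW r0)// mulr_natl.
  apply: le_measure; rewrite ?inE.
  - apply: measurableI => //; apply: measurableI; last exact: measurable_ball.
    rewrite (_ : [set y | (x / 2 < y)%R] = `]x / 2, +oo[%classic); first exact: measurable_itv.
    by apply/seteqP; split=> y /=; rewrite in_itv/= andbT.
  - exact: measurable_ball.
  by move=> y [_ []].
move=> k kx; rewrite ltNge; apply/negP => Hh.
by have := key eta (ltW eta0) (adm eta k kx Hh); rewrite ltxx.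
Qed.

(** The weight on the superlevel set is dominated by a measurable [G]: on (0, rho) it is at most
    rho^(2 al), and any other x is charged to its dyadic layer, where W x <= q^k. The integrals of
    the two parts give the two terms of the constant. *)
Lemma superlevel_measure lam :
  0 < lam ->
  (mu_nu nu [set x : R | (lam%:E < `|Bmax nu delta s \1_E x|)%E] <=
   (((be^-1 + 1) `^ (Q / be) + 3 * (4 `^ (2 * al) / (1 - 2^-1 `^ (2 * al)))) *
     (m * (lam / (2 * CB)) `^ (- (Q / be))))%:E)%E.
Proof.
move=> lam0; set eta := lam / (2 * CB).
have eta0 : 0 < eta by rewrite divr_gt0// mulr_gt0.
have := fun x => @superlevel_point lam x lam0.
rewrite -/eta; set S := [set x : R | _]; set T := (be^-1 + 1) * m `^ (be / Q).
have T0 : 0 < T by rewrite mulr_gt0 ?powR_gt0// addr_gt0// invr_gt0.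
set rho := (T / eta) `^ be^-1 => Sx.
have rho0 : 0 < rho by rewrite powR_gt0// (divr_gt0 T0 eta0).
have /andP[q0 q1] := layer_ratio d0 be0; set q := 2^-1 `^ (2 * al) in q0 q1 *.
set CL := 4 `^ (2 * al) / (1 - q).
have CL0 : 0 <= CL by rewrite divr_ge0 ?powR_ge0// subr_ge0 ltW.
(* Records that the second alternative occurs only for eta < 1. Since Q / be >= 1, this is what
   bounds w / eta by eta^(-Q/be) at the end. *)
pose w : R := (eta < 1)%R%:R.
pose H k := [set x | (eta%:E < HL_maximal \1_(Ak k) x)%E].
have lAk k : locally_integrable setT (\1_(Ak k) : R -> R).
  by apply: locally_integrable_indic; [exact: openT|exact: mAk].
have mH k : measurable (H k).
  rewrite /H -[X in measurable X]setTI.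
  by apply: emeasurable_fun_o_infty => //; exact: measurable_HL_maximal.
have w0 : 0 <= w by [].
pose D : set R := `]0%R, rho[%classic.
have mD : measurable D by exact: measurable_itv.
pose g k x : \bar R := (w * q ^+ k * \1_(H k) x)%:E.
pose G x : \bar R := ((rho `^ (2 * al))%:E * (\1_D x)%:E + \sum_(0 <= k <oo) g k x)%E.
have g0 k x : (0 <= g k x)%E by rewrite /g lee_fin !mulr_ge0 ?exprn_ge0// ltW.
have Sg0 x : (0 <= \sum_(0 <= k <oo) g k x)%E by apply: nneseries_ge0.
have d1 x : (0 <= (rho `^ (2 * al))%:E * (\1_D x)%:E)%E by rewrite -EFinM lee_fin mulr_ge0 ?powR_ge0.
have mg k : measurable_fun setT (g k).
  apply/measurable_EFinP; apply: measurable_funM; first exact: measurable_cst.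
  by apply: measurable_indic; exact: mH.
have mSg : measurable_fun setT (fun x => \sum_(0 <= k <oo) g k x)%E.
  by apply: ge0_emeasurable_sum => //.
have mDi : measurable_fun setT (fun x => (\1_D x)%:E : \bar R).
  by apply/measurable_EFinP; exact: measurable_indic.
have mdi : measurable_fun setT (fun x => (rho `^ (2 * al))%:E * (\1_D x)%:E)%E.
  exact: measurable_funeM.
have mG : measurable_fun setT G by exact: emeasurable_funD.
have G0 x : (0 <= G x)%E by rewrite adde_ge0.
have step1 : (mu_nu nu S <= \int[mu]_x G x)%E.
  rewrite -(@integral_leb R setT G)// /mu_nu integral_mkcond.
  apply: ge0_integral_mono => x.
    by rewrite patchE; case: ifP => // _; rewrite lee_fin powR_ge0.
  rewrite patchE; case: ifPn => [|_]; last exact: G0.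
  rewrite inE => -[xS]; rewrite /= in_itv/= => x01; have /andP[x0 x1] := x01.
  have dW : dens nu x = W x by rewrite /dens /Wt gtr0_norm.
  rewrite dW; have [xr|[eta1 HH]] := Sx x x01 xS.
    apply: (@le_trans _ _ ((rho `^ (2 * al))%:E * (\1_D x)%:E)%E); last by rewrite leeDl.
    have Dx : D x by rewrite /D/= in_itv/= x0.
    rewrite indicE (mem_set Dx).
    rewrite mule1 lee_fin -dW /dens; have -> : 2 * nu + 1 = 2 * al by lra.
    by apply: ge0_ler_powR; rewrite ?nnegrE ?(ltW x0) ?(ltW xr) ?(ltW rho0)//; move: al0; lra.
  have [k [kx Wk]] := layer_lower d0 be0 x01.
  apply: (@le_trans _ _ (\sum_(0 <= k <oo) g k x)%E); last by rewrite leeDr.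
  apply: (@le_trans _ _ (\sum_(0 <= i < k.+1) g i x)%E); last exact: nneseries_lim_ge.
  rewrite big_nat_recr//=; apply: (@le_trans _ _ (g k x)); last first.
    by rewrite leeDr// sume_ge0.
  rewrite /g /w eta1 mul1r indicE mem_set; last exact: HH.
  by rewrite mulr1 lee_fin.
apply: (le_trans step1); rewrite /G.
rewrite (ge0_integralD mu measurableT (fun x _ => d1 x) mdi (fun x _ => Sg0 x) mSg).
have rQ : rho `^ (2 * al) * rho = (be^-1 + 1) `^ (Q / be) * (m * eta `^ (- (Q / be))).
  have b0 : 0 < be^-1 + 1 by rewrite addr_gt0// invr_gt0.
  rewrite -[X in _ * X](powRr1 (ltW rho0)) -powRD ?(gt_eqF rho0) ?implybT//.
  rewrite /rho -powRrM [be^-1 * _]mulrC /T powRM ?invr_ge0 ?(ltW eta0)//; last first.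
    by rewrite mulr_ge0 ?powR_ge0// ltW.
  rewrite powRM ?powR_ge0 ?(ltW b0)// -powRrM.
  have -> : be / Q * (Q / be) = 1 by rewrite -[be / Q]invf_div mulVf// mulf_neq0 ?invr_eq0 ?(lt0r_neq0 be0) ?(lt0r_neq0 Q0).
  rewrite (powRr1 (ltW m0)) -[eta^-1]powR_inv1 ?(ltW eta0)// -powRrM mulN1r; ring.
rewrite (mulrDl ((be^-1 + 1) `^ (Q / be)) (3 * CL)) EFinD; apply: leeD.
  rewrite (ge0_integralZl mu measurableT mDi)//; last by rewrite lee_fin powR_ge0.
  have muD : mu D = rho%:E by rewrite lebesgue_measure_itv/= lte_fin rho0 -EFinB subr0.
  have -> : (\int[mu]_x (\1_D x)%:E = rho%:E)%E.
    by rewrite (integral_indic mu measurableT mD) setIT; exact: muD.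
  rewrite -EFinM.
  by rewrite rQ.
rewrite (integral_nneseries mu measurableT mg (fun k x _ => g0 k x)).
(* The weak type (1,1) inequality for Lebesgue measure, with constant 3, separately on each
   layer. *)
have wH k : (\int[mu]_x g k x <= (w * q ^+ k * (3 / eta))%:E * mu (Ak k))%E.
  have -> : (\int[mu]_x g k x = (w * q ^+ k)%:E * mu (H k))%E.
    have mHi : measurable_fun setT (fun x => (\1_(H k) x)%:E : \bar R).
      by apply/measurable_EFinP; apply: measurable_indic.
    rewrite /g; under eq_integral do rewrite EFinM.
    rewrite (ge0_integralZl mu measurableT mHi)//; last by rewrite lee_fin mulr_ge0// exprn_ge0// ltW.
    by rewrite (integral_indic mu measurableT (mH k)) setIT.
  rewrite [(w * q ^+ k * (3 / eta))%:E]EFinM -muleA; apply: lee_wpmul2l; first by rewrite lee_fin mulr_ge0// exprn_ge0// ltW.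
  apply: le_trans (maximal_inequality (lAk k) eta0) _; apply: lee_wpmul2l.
    by rewrite lee_fin divr_ge0// ltW.
  under eq_integral do rewrite abse_EFin ger0_norm//.
  by rewrite (integral_indic mu measurableT (mAk k)) setIT.
apply: (@le_trans _ _ (\sum_(0 <= k <oo) ((w * q ^+ k * (3 / eta))%:E * mu (Ak k)))%E).
  by apply: lee_nneseries => // k _ _; apply: integral_ge0.
pose f k y : \bar R := (q ^+ k * (2^-1 ^+ k < 4 * y)%R%:R)%:E.
have f0 k y : (0 <= f k y)%E by rewrite /f lee_fin mulr_ge0// exprn_ge0// ltW.
have fE k y : f k y = ((q ^+ k)%:E * (\1_[set y | (2^-1 ^+ k < 4 * y)%R] y)%:E)%E.
  rewrite /f EFinM; congr (_ * _%:E)%E; rewrite indicE.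
  by case: ltP => h; [rewrite mem_set|rewrite memNset//= ltNge h].
have mBk k : measurable [set y : R | (2^-1 ^+ k < 4 * y)%R].
  rewrite (_ : [set y | _] = `]2^-1 ^+ k / 4, +oo[%classic); first exact: measurable_itv.
  by apply/seteqP; split=> y /=; rewrite in_itv/= andbT ltr_pdivrMr// mulrC.
have mBi k : measurable_fun A (fun y => (\1_[set y : R | (2^-1 ^+ k < 4 * y)%R] y)%:E : \bar R).
  by apply/measurable_EFinP; apply: measurable_funTS; exact: measurable_indic.
have mf k : measurable_fun A (f k).
  have -> : f k = (fun y => (q ^+ k)%:E * (\1_[set y | (2^-1 ^+ k < 4 * y)%R] y)%:E)%E.
    by apply/funext => y; exact: fE.
  by apply: measurable_funeM; exact: mBi.
have tE k : ((w * q ^+ k * (3 / eta))%:E * mu (Ak k) = (w * (3 / eta))%:E * \int[mu]_(y in A) f k y)%E.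
  under eq_integral do rewrite fE.
  rewrite (ge0_integralZl mu mA (mBi k)); last 2 first.
  - by move=> x _; rewrite lee_fin.
  - by rewrite lee_fin exprn_ge0// ltW.
  by rewrite (integral_indic mu mA (mBk k)) muleA -EFinM mulrAC setIC.
rewrite (eq_eseriesr (fun k _ => tE k)) nneseriesZl; last by move=> k _; apply: integral_ge0.
rewrite -(integral_nneseries mu mA mf (fun k x _ => f0 k x)).
(* With the sum over layers inside the integral over [A], [layer_upper] reassembles the weight. *)
have intb : (\int[mu]_(y in A) (\sum_(0 <= k <oo) f k y) <= (CL * m)%:E)%E.
  apply: (@le_trans _ _ (\int[mu]_(y in A) (CL%:E * (W y)%:E))%E).
    apply: ge0_le_integral => //.
    - by move=> y _; apply: nneseries_ge0.
    - by apply: ge0_emeasurable_sum => k *; [exact: f0|exact: mf].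
    - by apply: measurable_funeM; exact: mW.
    move=> y Ay; have := A01 Ay; rewrite /= in_itv/= => /andP[y0 _].
    apply: lime_le; first exact: is_cvg_nneseries.
    apply: nearW => n; rewrite big_mkord /f sumEFin -EFinM lee_fin.
    exact: (layer_upper d0 be0).
  rewrite (ge0_integralZl mu mA (@mW _))//.
  by rewrite [(CL * m)%:E]EFinM; apply: lee_wpmul2l; rewrite ?lee_fin.
apply: (@le_trans _ _ ((w * (3 / eta))%:E * (CL * m)%:E)%E).
  by apply: lee_wpmul2l => //; rewrite lee_fin mulr_ge0// divr_ge0// ltW.
rewrite -EFinM lee_fin.
have wE : w / eta <= eta `^ (- (Q / be)).
  rewrite /w; have [e1|e1] := ltP eta 1; last by rewrite mul0r powR_ge0.
  have ei : 1 <= eta^-1 by rewrite ltW// invf_gt1.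
  have p1 : 1 <= Q / be by rewrite ler_pdivlMr// mul1r; move: d0 al0; lra.
  have -> : eta `^ (- (Q / be)) = eta^-1 `^ (Q / be).
    by rewrite -[eta^-1]powR_inv1 ?(ltW eta0)// -powRrM mulN1r.
  by rewrite [true%:R / eta]mul1r -[leLHS](powRr1 (le_trans ler01 ei)); exact: ler_powR.
have k0 : 0 <= 3 * CL * m by rewrite (mulr_ge0 (mulr_ge0 (ler0n R 3) CL0) (ltW m0)).
have := ler_wpM2l k0 wE; move: (eta `^ _) => Y h; apply: le_trans (le_trans h _).
  by rewrite le_eqVlt; apply/orP; left; apply/eqP; ring.
by rewrite le_eqVlt; apply/orP; left; apply/eqP; ring.
Qed.

Lemma weak_norm_le :
  (weak_norm nu (Q / be) (Bmax nu delta s \1_E) <=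
   (((be^-1 + 1) `^ (Q / be) + 3 * (4 `^ (2 * al) / (1 - 2^-1 `^ (2 * al)))) `^ (Q / be)^-1 * (2 * CB) *
     m `^ (Q / be)^-1)%:E)%E.
Proof.
apply: ge_ereal_sup => _ [lam lam0 <-]; rewrite /= in lam0.
set p := Q / be; have p0 : 0 < p by rewrite divr_gt0.
have := superlevel_measure lam0; rewrite -/p.
set K := _ + 3 * _; set M := mu_nu _ _ => MK.
have K0 : 0 <= K.
  have /andP[q0 q1] := layer_ratio d0 be0.
  by rewrite addr_ge0 ?powR_ge0// mulr_ge0// divr_ge0 ?powR_ge0// subr_ge0 ltW.
have e0 : 0 < lam / (2 * CB) by rewrite divr_gt0// mulr_gt0.
have M0 : (0 <= M)%E by apply: integral_ge0 => x _; rewrite lee_fin powR_ge0.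
have B0 : 0 <= K * (m * (lam / (2 * CB)) `^ (- p)) by rewrite !mulr_ge0 ?powR_ge0// ltW.
apply: (@le_trans _ _ (lam%:E * (K * (m * (lam / (2 * CB)) `^ (- p)))%:E `^ p^-1)%E).
  apply: lee_wpmul2l; first by rewrite lee_fin ltW.
  apply: gt0_ler_poweR => //; first by rewrite invr_ge0 ltW.
  - by rewrite in_itv/= M0 leey.
  - by rewrite in_itv/= lee_fin B0 leey.
rewrite poweR_EFin -EFinM lee_fin le_eqVlt; apply/orP; left; apply/eqP.
rewrite powRM// ?mulr_ge0 ?powR_ge0 ?(ltW m0)// powRM ?powR_ge0 ?(ltW m0)// -powRrM mulNr mulfV ?gt_eqF//.
rewrite powR_inv1 ?(ltW e0)// invf_div.
move: (K `^ _) (m `^ _) => k1 k2; field.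
by rewrite !gt_eqF.
Qed.

End SuperLevel.

Lemma weak_type_restricted : exists C : R, forall E : set (LebT R), measurable E -> E `<=` `]0%R, 1%R[%classic ->
  (weak_norm nu (Q / be) (Bmax nu delta s \1_E) <= C%:E * Lp_norm nu (Q / be) \1_E)%E.
Proof.
have [CB CB0 HCB] := kernel_integral_bound nu_gt zs d0 be0.
set p := Q / be; have p0 : 0 < p by rewrite divr_gt0.
pose C := ((be^-1 + 1) `^ p + 3 * (4 `^ (2 * al) / (1 - 2^-1 `^ (2 * al)))) `^ p^-1 * (2 * CB).
have C0 : 0 <= C by rewrite mulr_ge0 ?powR_ge0// mulr_ge0// ltW.
exists C => E mE E01; have [A [mA AE nEA]] := leb_measurable_borel mE.
have A01 : A `<=` `]0%R, 1%R[%classic by move=> x /AE /E01.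
pose mm := (\int[mu]_(y in A) (W y)%:E)%E.
have mm0 : (0 <= mm)%E by apply: integral_ge0.
have mmf : mm \is a fin_num.
  apply: integrable_fin_num => //; apply: (@integrableS _ _ R mu `[0%R, 1%R]%classic A) => //.
    by move=> y /A01 /=; rewrite !in_itv/= => /andP[/ltW -> /ltW ->].
  by apply: continuous_integrable; exact: cont_Wt.
have mmE : mm = (fine mm)%:E by rewrite fineK.
have bound m : 0 < m -> (mm <= m%:E)%E -> (weak_norm nu p (Bmax nu delta s \1_E) <= (C * m `^ p^-1)%:E)%E.
  by move=> m0 mmm; exact: (weak_norm_le CB0 HCB mE E01 mA AE nEA m0 mmm).
(* One inequality is enough here, and it follows from A being contained in E. *)
have LA : (mm `^ p^-1 <= Lp_norm nu p \1_E)%E.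
  rewrite /Lp_norm; have h : (mm <= \int[@leb R]_(x in `]0%R, 1%R[) (`|\1_E x| `^ p * dens nu x)%:E)%E.
    have -> : mm = (\int[@leb R]_(x in A) (W x)%:E)%E.
      by rewrite integral_leb.
    rewrite integral_mkcond [leRHS]integral_mkcond; apply: ge0_integral_mono => x.
      by rewrite patchE; case: ifP.
    rewrite !patchE; case: ifPn => [|_].
      rewrite inE => Ax; have D := A01 _ Ax; rewrite mem_set// indicE mem_set; last exact: AE.
      rewrite normr1 powR1 mul1r /dens /Wt gtr0_norm//.
      by move: D; rewrite /= in_itv/= => /andP[].
    by case: ifP => // _; rewrite lee_fin mulr_ge0 ?powR_ge0.
  apply: gt0_ler_poweR => //; first by rewrite invr_ge0 ltW.
  - by rewrite in_itv/= mm0 leey.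
  - by rewrite in_itv/= leey andbT; apply: le_trans h.
apply: (@le_trans _ _ (C%:E * mm `^ p^-1)%E); last by apply: lee_wpmul2l; rewrite ?lee_fin.
(* [bound] asks for a positive m, so a null set is handled by letting m tend to 0; the choice below
   makes C m^(1/p) at most eps. *)
have [z|nz] := eqVneq (fine mm) 0.
  apply/lee_addgt0Pr => eps eps0.
  pose m := (eps / (C + 1)) `^ p.
  have e0 : 0 < eps / (C + 1) by rewrite divr_gt0// ltr_wpDl.
  have m0 : 0 < m by rewrite powR_gt0.
  have mmm : (mm <= m%:E)%E by rewrite mmE z lee_fin ltW.
  apply: (le_trans (bound m m0 mmm)); rewrite mmE z poweR_EFin powR0 ?invr_eq0 ?gt_eqF// mule0 add0e lee_fin.
  rewrite /m -powRrM mulfV ?gt_eqF// powRr1 ?(ltW e0)//.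
  rewrite mulrCA ler_piMr ?(ltW eps0)// ler_pdivrMr ?mul1r ?lerDl//.
  by rewrite ltr_wpDl.
have f0 : 0 < fine mm by rewrite lt0r nz fine_ge0.
have mmm : (mm <= (fine mm)%:E)%E by rewrite -mmE.
by apply: (le_trans (bound _ f0 mmm)); rewrite [in leRHS]mmE poweR_EFin.
Qed.

End WeakType.

Unset Implicit Arguments.

Theorem theorem4 (R : realType) (nu delta : R) (s : nat -> R) :
  -(1/2) < nu -> 0 < delta -> delta < nu + 1/2 ->
  bessel_zeros nu s ->
  let p1 := (4 * (nu + 1)) / (2 * nu + 1 - 2 * delta) in
  exists C : R, forall E : set (LebT R), measurable E -> E `<=` `]0%R, 1%R[ ->
    (weak_norm nu p1 (Bmax nu delta s (\1_E)) <= C%:E * Lp_norm nu p1 (\1_E))%E.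
Proof.
move=> nu_gt d0 dn zs p1; have be0 : 0 < nu + 1 / 2 - delta by move: dn; lra.
have -> : p1 = (2 * (nu + 1 / 2) + 1) / (nu + 1 / 2 - delta).
  rewrite /p1; have -> : 2 * nu + 1 - 2 * delta = 2 * (nu + 1 / 2 - delta) by field.
  have -> : 4 * (nu + 1) = 2 * (2 * (nu + 1 / 2) + 1) by field.
  by rewrite -mulf_div divff// mul1r.
exact: weak_type_restricted.
Qed.
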